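(* Let $X$ be an affine process on $K$ with parameters $(Q,b,B,c,\gamma,m,\mu)$, relative to the truncation function $\chi\equiv 0$, with $Q=0$, $c=0$, $\gamma=0$, $m(K)<\infty$, $\mu(K)\in K^*$ and $\int_{\|\xi\|\ge1}\|\xi\|\,\mu(d\xi)\in K^*$ (i.e. $\mu$ is a finite measure with finite first moment). If (i) $m$, or $\langle \eta,\mu(\cdot)\rangle$ for one $\eta\in K^\circ$, has an absolutely continuous component (with respect to Lebesgue measure) with a strictly positive density on $K^\circ$, (ii) $e^{Bt}(K^\circ)=K^\circ$ for all $t\in\mathbb R_+$ and $\tau(B)<0$, (iii) in case $m$ has no absolutely continuous component with a strictly positive density on $K^\circ$: $m(K^\circ)>0$ or $b\in K^\circ$, then $X$ is irreducible with respect to the Lebesgue measure on $-B^{-1}b+K$ and aperiodic.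
   Context: Setting. $V$ is a finite-dimensional real inner product space with norm $\|\cdot\|$; $V^*$ is identified with $V$. $K\subset V$ is a closed convex cone which is generating ($K-K=V$) and proper ($K\cap(-K)=\{0\}$). $K^*=\{u\in V:\langle u,x\rangle\ge0\ \forall x\in K\}$; $^\circ$ denotes interior. For a linear map $A$, $\tau(A)$ is the maximum of the real parts of its (complex) eigenvalues. Affine process. A time-homogeneous Markov process $X$ with state space $K\cup\{\Delta\}$ ($\Delta\notin K$ an absorbing cemetery), transition kernels $p_t(x,d\xi)$ and laws $\mathbb P^x$, is affine if (a) $p_s(x,\cdot)\to p_t(x,\cdot)$ weakly on $K$ as $s\to t$ for all $t\ge0,x\in K$; (b) there are functions $\phi:\mathbb R_+\times K^*\to\mathbb R_+$, $\psi:\mathbb R_+\times K^*\to V$ with $\int_K e^{-\langle u,\xi\rangle}p_t(x,d\xi)=e^{-\phi(t,u)-\langle\psi(t,u),x\rangle}$. It is known that then $X$ is Feller, and under the assumptions of the claim $\partial_t\phi=F(\psi)$, $\phi(0,u)=0$, $\partial_t\psi=R(\psi)$, $\psi(0,u)=u$, with $$F(u)=\langle b,u\rangle-\int_K(e^{-\langle u,\xi\rangle}-1)m(d\xi),\qquad R(u)=B^\top(u)-\int_K(e^{-\langle u,\xi\rangle}-1)\mu(d\xi),$$ where $b\in K$; $m$ is a finite Borel measure on $K$ with $m(\{0\})=0$; $\mu$ is a finite $K^*$-valued Borel measure on $K$ with $\mu(\{0\})=0$; $B^\top:V\to V$ is linear (adjoint of $B$) with $\langle x,B^\top(u)\rangle\ge0$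 whenever $u\in K^*,x\in K,\langle u,x\rangle=0$. Under these assumptions the process is conservative. It is taken in its càdlàg version. (So between jumps $X$ follows $\dot x=b+Bx$, and jumps have compensator $(m(d\xi)+\langle X_{t-},\mu(d\xi)\rangle)dt$.) Irreducibility and aperiodicity. For measurable $A$, let $\eta_A=\int_0^\infty 1_{\{X_t\in A\}}dt$. For a nontrivial $\sigma$-finite measure $\nu$, $X$ is $\nu$-irreducible (irreducible with respect to $\nu$) if $\nu(A)>0$ implies $\mathbb E^x[\eta_A]>0$ for all $x$. Then there is a maximal irreducibility measure (one with respect to which every irreducibility measure is absolutely continuous); $\mathcal B^+$ is the family of measurable sets of positive maximal irreducibility measure. A nonempty measurable set $C$ is small if there are $s>0$ and a nontrivial measure $\nu_s$ with $\mathbb P^x[X_s\in A]\ge\nu_s(A)$ for all $x\in C$ and measurable $A$. An irreducible process is aperiodic if for some small $C\in\mathcal B^+$ there is $T$ with $\mathbb P^x[X_t\in C]>0$ for all $t\ge T$, $x\in C$. *)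

(* Defs.v *)
From HB Require Import structures.
From mathcomp Require Import all_boot all_order all_algebra.
From mathcomp Require Import complex.
From mathcomp Require Import all_classical all_reals all_analysis.
From mathcomp Require Import measurable_realfun.

Set Implicit Arguments.
Unset Strict Implicit.
Unset Printing Implicit Defensive.

Import Order.TTheory GRing.Theory Num.Theory.
Import numFieldNormedType.Exports.

Local Open Scope classical_set_scope.
Local Open Scope ring_scope.

(* A finite-dimensional real inner product space V is represented, in the
   coordinates of an arbitrary basis, by 'cV[R]_n together with an arbitrary
   inner product ip : {dot 'cV[R]_n for idfun} (the basis need not be
   orthonormal). The topology is the library's one on matrices, which is the
   unique Hausdorff vector topology; measurable sets are the Borel sets. The
   Lebesgue measure [lebesgue_cV] is the one of these coordinates; the one
   normalized by ip differs from it by a positive constant factor. *)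

Section borel.
Context (R : realType) (m n : nat).

HB.instance Definition _ :=
  @isMeasurable.Build (sigma_display (@open 'M[R]_(m, n))) 'M[R]_(m, n)
    <<s @open 'M[R]_(m, n) >> (@sigma_algebra0 _ setT _) (@sigma_algebraC _ _)
    (@sigma_algebra_bigcup _ setT _).

End borel.

Section borel_lemmas.
Context {R : realType}.

Lemma open_measurable_mx m n (U : set 'M[R]_(m, n)) : open U -> measurable U.
Proof. exact: sub_sigma_algebra. Qed.

Lemma closed_measurable_mx m n (F : set 'M[R]_(m, n)) :
  closed F -> measurable F.
Proof.
move=> cF; rewrite -[F]setCK; apply: measurableC; apply: open_measurable_mx.
exact: closed_openC.
Qed.

Lemma measurable_translate n (K : set 'cV[R]_n) (v : 'cV[R]_n) :
  closed K -> measurable [set v + k | k in K].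
Proof.
move=> cK; apply: closed_measurable_mx.
have -> : [set v + k | k in K] = (fun x => x - v) @^-1` K.
  apply/seteqP; split=> [_ [k Kk <-]|x Kx] /=; first by rewrite addrC addKr.
  by exists (x - v) => //; rewrite addrC subrK.
apply: preimage_closed => // x _.
apply: (@cvgB R 'cV[R]_n _ (nbhs x) _ id (cst v)); first exact: cvg_id.
exact: cvg_cst.
Qed.

Definition col_of_tuple n (t : n.-tuple R) : 'cV[R]_n := \col_i tnth t i.

Lemma measurable_col_of_tuple n : measurable_fun setT (@col_of_tuple n).
Proof.
apply: (@measurability _ _ _ _ _ _ (@open 'cV[R]_n)) => //.
move=> _ [U oU <-]; rewrite setTI.
pose q2r (q : 'cV[rat]_n) : 'cV[R]_n := map_mx ratr q.
pose I := [set p : 'cV[rat]_n * nat | ball (q2r p.1) (p.2.+1%:R^-1) `<=` U].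
have -> : @col_of_tuple n @^-1` U =
    \bigcup_(p in I) \bigcap_(i in [set: 'I_n])
      (fun t : n.-tuple R => tnth t i) @^-1`
        (ball (q2r p.1 i ord0) (p.2.+1%:R^-1)).
  apply/seteqP; split=> [t Ut|t [[q k] /= sU tq]]; last first.
    apply: sU; split=> [|i j]; first by rewrite invr_gt0.
    by rewrite [col_of_tuple _ _ _]mxE ord1; exact: tq.
  have /nbhs_ballP[e /= e0 eU] := open_nbhs_nbhs (conj oU Ut).
  have [k ke] : exists k : nat, (k.+1%:R^-1 : R) < e / 2.
    have e20 : 0 < e / 2 by rewrite divr_gt0.
    have [k _ /(_ k (leqnn _))] := near_infty_natSinv_lt (PosNum e20).
    by exists k.
  have qP i : exists q : rat, ball (ratr q : R) (k.+1%:R^-1) (tnth t i).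
    have [] := @rat_in_itvoo R (tnth t i - k.+1%:R^-1) (tnth t i + k.+1%:R^-1).
      by rewrite ltrD2l gtrN ?invr_gt0 ?ltr0n.
    move=> q; rewrite in_itv/= => /andP[q1 q2]; exists q.
    rewrite /ball/= ltr_norml; apply/andP; split.
      by rewrite ltrBrDr addrC.
    by rewrite ltrBlDl.
  have [q {}qP] := choice qP.
  exists (\col_i q i, k) => /=; last by move=> i _; rewrite /= !mxE; exact: qP.
  move=> y qy; apply: eU.
  apply: (@le_ball _ _ _ (k.+1%:R^-1 + k.+1%:R^-1)).
    by rewrite [leRHS]splitr lerD// ltW.
  apply: (@ball_triangle _ _ (q2r (\col_i q i))) => //.
  apply: ball_sym; split=> [|i j]; first by rewrite invr_gt0.
  by rewrite !mxE; exact: qP.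
rewrite bigcup_mkcond; apply: countable_bigcupT_measurable => // p.
case: ifPn => // _.
apply: fin_bigcap_measurable => // i _.
rewrite -[X in measurable X]setTI; apply: measurable_tnth => //.
exact: measurable_ball.
Qed.

End borel_lemmas.


Section lebesgue.
Context {R : realType}.

Definition cons_tuple n (p : R * n.-tuple R) : n.+1.-tuple R :=
  [tuple of p.1 :: p.2].

Definition uncons_tuple n (t : n.+1.-tuple R) : R * n.-tuple R :=
  (thead t, [tuple of behead t]).

Lemma measurable_cons_tuple n : measurable_fun setT (@cons_tuple n).
Proof. exact: measurable_cons. Qed.

Lemma measurable_uncons_tuple n : measurable_fun setT (@uncons_tuple n).
Proof.
apply/measurable_fun_pairP; split; last exact: measurable_behead.
exact: (measurable_tnth ord0).
Qed.

Lemma cons_tupleK n : cancel (@cons_tuple n) (@uncons_tuple n).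
Proof. by move=> [x t]; congr pair; exact: val_inj. Qed.

Section push_cons.
Context n (mu : {sigma_finite_measure set (n.-tuple R) -> \bar R}).

Definition push_cons :=
  pushforward (lebesgue_measure \x mu)%E (@cons_tuple n).

Let push_cons0 : push_cons set0 = 0%E.
Proof. by rewrite /push_cons /pushforward preimage_set0 measure0. Qed.

Let push_cons_ge0 A : (0 <= push_cons A)%E.
Proof. by rewrite /push_cons /pushforward measure_ge0. Qed.

Let push_cons_sigma_additive : semi_sigma_additive push_cons.
Proof.
by apply: measure_semi_sigma_additive; exact: measurable_cons_tuple.
Qed.

HB.instance Definition _ := isMeasure.Build _ _ _ push_cons
  push_cons0 push_cons_ge0 push_cons_sigma_additive.

Let push_cons_sigma_finite : sigma_finite setT push_cons.
Proof.
have /sigma_finiteP[F [TF ndF Foo]] := sigma_finiteT (@lebesgue_measure R).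
have /sigma_finiteP[G [TG ndG Goo]] := sigma_finiteT mu.
exists (fun i => @uncons_tuple n @^-1` (F i `*` G i)).
  rewrite -preimage_bigcup; apply/seteqP; split=> // t _.
  have [i _ Fi] : (\bigcup_i F i) (thead t) by rewrite -TF.
  have [j _ Gj] : (\bigcup_i G i) [tuple of behead t] by rewrite -TG.
  exists (maxn i j) => //; split.
    by move: Fi; exact/subsetPset/ndF/leq_maxl.
  by move: Gj; exact/subsetPset/ndG/leq_maxr.
move=> i; have [mF Fi] := Foo i; have [mG Gi] := Goo i; split.
  rewrite -[X in measurable X]setTI.
  by apply: measurable_uncons_tuple => //; exact: measurableX.
rewrite /push_cons /pushforward -comp_preimage (_ : _ \o _ = id) ?preimage_id.
  by rewrite product_measure1E// lte_mul_pinfty// ge0_fin_numE.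
by apply/funext => x; exact: cons_tupleK.
Qed.

HB.instance Definition _ := Measure_isSigmaFinite.Build _ _ _ push_cons
  push_cons_sigma_finite.

End push_cons.

Fixpoint tuple_lebesgue n : {sigma_finite_measure set (n.-tuple R) -> \bar R} :=
  if n is n'.+1 then push_cons (tuple_lebesgue n')
  else \d_[tuple].

Section vector_lebesgue.
Context (n : nat).

Definition lebesgue_cV : set 'cV[R]_n -> \bar R :=
  pushforward (tuple_lebesgue n) (@col_of_tuple R n).

Let lebesgue_cV0 : lebesgue_cV set0 = 0%E.
Proof. by rewrite /lebesgue_cV /pushforward preimage_set0 measure0. Qed.

Let lebesgue_cV_ge0 A : (0 <= lebesgue_cV A)%E.
Proof. by rewrite /lebesgue_cV /pushforward measure_ge0. Qed.

Let lebesgue_cV_sigma_additive : semi_sigma_additive lebesgue_cV.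
Proof.
by apply: measure_semi_sigma_additive; exact: measurable_col_of_tuple.
Qed.

HB.instance Definition _ := isMeasure.Build _ _ _ lebesgue_cV
  lebesgue_cV0 lebesgue_cV_ge0 lebesgue_cV_sigma_additive.

End vector_lebesgue.

Lemma tuple_lebesgue_box n (A : 'I_n -> set R) :
  (forall i, measurable (A i)) ->
  tuple_lebesgue n [set t | forall i, A i (tnth t i)] =
  (\prod_(i < n) lebesgue_measure (A i))%E.
Proof.
elim: n A => [|n IH] A mA.
  rewrite big_ord0 /= diracE mem_set//= => -[]//.
rewrite big_ord_recl -IH => [|i]; last exact: mA.
rewrite /= /push_cons /pushforward.
have mB : measurable [set t : n.-tuple R | forall i, A (lift ord0 i) (tnth t i)].
  rewrite (_ : [set t | _] = \bigcap_(i in [set: 'I_n])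
      (fun t : n.-tuple R => tnth t i) @^-1` A (lift ord0 i)).
    apply: fin_bigcap_measurable => // i _.
    by rewrite -[X in measurable X]setTI; apply: measurable_tnth.
  by apply/seteqP; split=> t //= tA i; [move=> _|]; exact: tA.
rewrite -(@product_measure1E _ _ _ _ R lebesgue_measure (tuple_lebesgue n)
  (A ord0) [set t | forall i : 'I_n, A (lift ord0 i) (tnth t i)] (mA ord0) mB).
congr (product_measure1 _ _ _); apply/seteqP; split=> [[x t] /= xtA|[x t] [/= xA tA] i].
  split=> [|i]; first by have := xtA ord0.
  by have := xtA (lift ord0 i); rewrite /cons_tuple tnthS.
by case: (unliftP ord0 i) => [j ->|->]; rewrite /cons_tuple ?tnthS//; exact: tA.
Qed.

Lemma lebesgue_cV_box n (a b : 'cV[R]_n) :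
  (forall i, a i ord0 <= b i ord0) ->
  lebesgue_cV [set x | forall i, a i ord0 <= x i ord0 <= b i ord0] =
  (\prod_(i < n) (b i ord0 - a i ord0))%:E.
Proof.
move=> ab; rewrite /lebesgue_cV /pushforward.
rewrite (_ : _ @^-1` _ =
    [set t | forall i, `[a i ord0, b i ord0]%classic (tnth t i)]); last first.
  apply/seteqP; split=> t /= H i; have := H i;
    by rewrite /= in_itv/= /col_of_tuple mxE.
rewrite (@tuple_lebesgue_box n (fun i => `[a i ord0, b i ord0]%classic))//.
rewrite -prodEFin; apply: eq_bigr => i _.
rewrite lebesgue_measure_itv/= lte_fin; case: ltgtP (ab i) => // ->.
by rewrite subrr.
Qed.

End lebesgue.
Arguments lebesgue_cV {R n}.

Section cone_setting.
Context {R : realType} {n : nat}.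
Local Notation V := 'cV[R]_n.
Implicit Types (ip : {dot V for idfun}) (K : set V) (mu : set V -> V).

Definition ip_norm ip (x : V) : R := Num.sqrt (ip x x).

Record generating_proper_cone K : Prop := {
  cone_closed : closed K;
  cone0 : K 0;
  coneD : forall x y, K x -> K y -> K (x + y);
  coneZ : forall (a : R) x, 0 <= a -> K x -> K (a *: x);
  cone_generating : forall v, exists x y, [/\ K x, K y & v = x - y];
  cone_proper : forall x, K x -> K (- x) -> x = 0
}.

Definition dual_cone ip K : set V := [set u | forall x, K x -> 0 <= ip u x].

Definition gram ip : 'M[R]_n :=
  \matrix_(i, j) ip (delta_mx i ord0) (delta_mx j ord0).

(* The transpose B^T of the operator B with respect to ip, see [adjE]. *)
Definition adj ip (B : 'M[R]_n) : 'M[R]_n := invmx (gram ip) *m B^T *m gram ip.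

Lemma ip_gram ip (x y : V) : ip x y = (x^T *m gram ip *m y) ord0 ord0.
Proof.
have xE (z : V) : z = \sum_i z i ord0 *: delta_mx i ord0.
  rewrite {1}[z]matrix_sum_delta; apply: eq_bigr => i _.
  by rewrite big_ord_recl big_ord0 addr0.
rewrite -mulmxA mxE {1}[x]xE linear_sumlz; apply: eq_bigr => i _.
rewrite linearZl_LR /= !mxE; congr (_ * _).
rewrite {1}[y]xE linear_sumr; apply: eq_bigr => j _.
by rewrite linearZr_LR /= !mxE mulrC.
Qed.

Lemma gram_unit ip : gram ip \in unitmx.
Proof.
rewrite -row_free_unit -kermx_eq0; apply/eqP/row_matrixP => i; rewrite row0.
apply/eqP/negPn/negP => k0.
have : 0 < ip (row i (kermx (gram ip)))^T (row i (kermx (gram ip)))^T.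
  by rewrite neq0_dnorm_gt0// -(inj_eq trmx_inj) trmxK trmx0.
by rewrite ip_gram trmxK -row_mul mulmx_ker row0 mul0mx mxE ltxx.
Qed.

Lemma adjE ip (B : 'M[R]_n) (x u : V) : ip x (adj ip B *m u) = ip (B *m x) u.
Proof.
rewrite !ip_gram trmx_mul /adj !mulmxA; congr ((_ *m _ *m _) _ _).
by rewrite -!mulmxA (mulmxA (gram ip)) mulmxV ?gram_unit// mul1mx.
Qed.

(* [tau B] is a maximum as soon as n > 0: the set is finite and nonempty. *)
Definition tau (B : 'M[R]_n) : R :=
  sup [set complex.Re z | z in
    [set z : R[i] | eigenvalue (map_mx (real_complex R) B) z]].

Definition expmx (A : 'M[R]_n) : 'M[R]_n :=
  limn (series (fun k => (k`!%:R)^-1 *: A ^+ k)).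

(* Measures on K are represented by Borel measures on V carried by K. *)
Record cone_valued_measure ip K mu : Prop := {
  cvm_carrier : forall A, measurable A -> mu A = mu (A `&` K);
  cvm_dual : forall A, measurable A -> dual_cone ip K (mu A);
  cvm_sigma_additive : forall F : (set V)^nat,
    (forall i, measurable (F i)) -> trivIset setT F ->
    (\sum_(0 <= i < k) mu (F i)) @[k --> \oo] --> mu (\bigcup_i F i)
}.

(* The nonnegative measure <x, mu(.)>, for x in K. *)
Definition scalarize ip mu (x : V) : set V -> \bar R :=
  fun A => (ip x (mu A))%:E.

(* v is the integral over D of f with respect to the vector measure mu. Since K
   is generating, testing against the elements of K determines v. *)
Definition is_vintegral ip K mu (D : set V) (f : V -> R) (v : V) : Prop :=
  forall x, K x -> ((ip x v)%:E = \int[scalarize ip mu x]_(y in D) (f y)%:E)%E.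

Definition vintegral ip K mu (D : set V) (f : V -> R) : V :=
  xget 0 (is_vintegral ip K mu D f).

(* The parameter set (Q, b, B, c, gamma, m, mu), relative to the truncation
   function 0, in the case Q = 0, c = 0, gamma = 0. *)
Record affine_parameters ip K (b : V) (B : 'M[R]_n)
    (m : {measure set V -> \bar R}) mu : Prop := {
  param_b : K b;
  param_m_carrier : m (~` K) = 0%E;
  param_m0 : m [set 0] = 0%E;
  param_mu : cone_valued_measure ip K mu;
  param_mu0 : mu [set 0] = 0;
  param_B : forall u x, dual_cone ip K u -> K x -> ip u x = 0 ->
    0 <= ip x (adj ip B *m u)
}.

Definition F_exponent ip K (b : V) (m : {measure set V -> \bar R}) (u : V) : R :=
  ip b u - \int[m]_(xi in K) (expR (- ip u xi) - 1).

Definition R_exponent ip K (B : 'M[R]_n) mu (u : V) : V :=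
  adj ip B *m u - vintegral ip K mu K (fun xi => expR (- ip u xi) - 1).

(* Two-sided derivative at t > 0, right derivative at t = 0. *)
Definition time_derivative {W : normedModType R} (f : R -> W) (t : R) (l : W) :=
  (s - t)^-1 *: (f s - f t)
    @[s --> within [set s : R | 0 <= s] t^'] --> l.

Record riccati ip K b B (m : {measure set V -> \bar R}) mu
    (phi : R -> V -> R) (psi : R -> V -> V) : Prop := {
  riccati_phi0 : forall u, dual_cone ip K u -> phi 0 u = 0;
  riccati_psi0 : forall u, dual_cone ip K u -> psi 0 u = u;
  riccati_phi : forall (t : R) u, 0 <= t -> dual_cone ip K u ->
    time_derivative (phi ^~ u : R -> R^o) t (F_exponent ip K b m (psi t u));
  riccati_psi : forall (t : R) u, 0 <= t -> dual_cone ip K u ->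
    time_derivative (psi ^~ u) t (R_exponent ip K B mu (psi t u))
}.

(* p t x is a sub-probability on K: the missing mass sits at the cemetery. *)
Record affine_kernels ip K (p : R -> R.-spker V ~> V)
    (phi : R -> V -> R) (psi : R -> V -> V) : Prop := {
  kernels_carrier : forall (t : R) x, 0 <= t -> K x -> p t x (~` K) = 0%E;
  kernels_weak : forall (t : R) x, 0 <= t -> K x ->
    forall f : V -> R, {within K, continuous f} ->
      (exists M, forall y, K y -> `|f y| <= M) ->
      \int[p s x]_(y in K) f y @[s --> within [set s : R | 0 <= s] (nbhs t)]
        --> \int[p t x]_(y in K) f y;
  kernels_phi_ge0 : forall (t : R) u, 0 <= t -> dual_cone ip K u -> 0 <= phi t u;
  kernels_affine : forall (t : R) u x, 0 <= t -> dual_cone ip K u -> K x ->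
    (\int[p t x]_(xi in K) (expR (- ip u xi))%:E =
     (expR (- phi t u - ip (psi t u) x))%:E)%E
}.

End cone_setting.

Section process.
Context {R : realType} {n : nat} {d : measure_display}.
Context {Omega : measurableType d}.
Local Notation V := 'cV[R]_n.
Implicit Types (K : set V) (p : R -> R.-spker V ~> V).
Implicit Types (P : V -> probability Omega R).
(* [None] is the cemetery. The one-point compactification of the closed set K
   embeds into that of V. *)
Implicit Types (X : R -> Omega -> one_point_compactification V).

Definition in_state X (t : R) (A : set V) : set Omega :=
  [set w | exists2 y, A y & X t w = Some y].

(* Natural filtration; the events {X_r = None} are complements of generators. *)
Definition past X (s : R) : set (set Omega) :=
  <<s [set E | exists (r : R) A, [/\ 0 <= r <= s, measurable A & E = in_state X r A]] >>.

Record cadlag_markov_process K p P X : Prop := {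
  process_state : forall (t : R) w y, 0 <= t -> X t w = Some y -> K y;
  process_measurable : forall (t : R) A, 0 <= t -> measurable A ->
    measurable (in_state X t A);
  process_start : forall x, K x -> P x (in_state X 0 [set x]) = 1%E;
  process_markov : forall x (s t : R) G A, K x -> 0 <= s -> 0 <= t ->
    past X s G -> measurable A ->
    (P x (G `&` in_state X (s + t)%R A) =
     \int[P x]_(w in G) (if X s w is Some y then p t y A else 0))%E;
  process_absorbing : forall (s t : R) w, 0 <= s <= t -> X s w = None -> X t w = None;
  process_right_continuous : forall w (t : R), 0 <= t ->
    X s w @[s --> t^'+] --> X t w;
  process_left_limits : forall w (t : R), 0 < t ->
    exists l : one_point_compactification V, X s w @[s --> t^'-] --> l
}.

Definition affine_process ip K b B (m : {measure set V -> \bar R}) mu p P X :=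
  affine_parameters ip K b B m mu /\
  cadlag_markov_process K p P X /\
  exists phi psi, affine_kernels ip K p phi psi /\ riccati ip K b B m mu phi psi.

Definition occupation_time X (A : set V) (w : Omega) : \bar R :=
  (\int[lebesgue_measure]_(t in `[0%R, +oo[) (\1_(in_state X t A) w)%:E)%E.

(* Measures on K are again taken on V; an irreducibility measure is carried by K
   because the process never visits V `\` K. *)
Definition irreducible K P X (nu : {measure set V -> \bar R}) : Prop :=
  [/\ sigma_finite setT nu, nu setT != 0%E &
    forall A, measurable A -> (0 < nu A)%E ->
      forall x, K x -> (0 < \int[P x]_w occupation_time X A w)%E].

Definition maximal_irreducibility_measure K P X
    (nu : {measure set V -> \bar R}) : Prop :=
  irreducible K P X nu /\
  forall nu' : {measure set V -> \bar R}, irreducible K P X nu' -> nu' `<< nu.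

(* A belongs to the family B^+. *)
Definition accessible K P X (A : set V) : Prop :=
  measurable A /\
  exists2 nu, maximal_irreducibility_measure K P X nu & (0 < nu A)%E.

Definition small K P X (C : set V) : Prop :=
  [/\ measurable C, C `<=` K, C !=set0 &
    exists (s : R) (nu : {measure set V -> \bar R}), [/\ 0 < s, nu setT != 0%E &
      forall x A, C x -> measurable A -> (nu A <= P x (in_state X s A))%E]].

Definition aperiodic K P X : Prop :=
  exists C, [/\ small K P X C, accessible K P X C &
    exists2 T : R, 0 <= T &
      forall (t : R) x, T <= t -> C x -> (0 < P x (in_state X t C))%E].

End process.

Section density.
Context {R : realType} {n : nat}.
Local Notation V := 'cV[R]_n.

(* The absolutely continuous part f dx in the Lebesgue decomposition
   nu = f dx + s has a version f that is strictly positive on U. *)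
Definition has_positive_ac_component (nu : set V -> \bar R) (U : set V) : Prop :=
  exists (f : V -> R) (s : {measure set V -> \bar R}),
    [/\ measurable_fun setT f, forall y, 0 <= f y,
        forall y, U y -> 0 < f y,
        exists N, [/\ measurable N, lebesgue_cV N = 0%E & s (~` N) = 0%E] &
        forall A, measurable A ->
          (nu A = \int[lebesgue_cV]_(y in A) (f y)%:E + s A)%E].

End density.

(* Main.v *)
(* Write z = -B^{-1} b, let Phi be the flow of x' = b + B x, and let w_s(x) be the
   probability that the process started at x does not jump before s. Splitting at
   the first jump gives
     p_t(x, A) = w_t(x) 1_A(Phi_t x)
       + int_0^t w_s(x) int p_{t-s}(Phi_s x + xi, A) (m + <Phi_s x, mu>)(dxi) ds.
   For exponentials in place of 1_A this is an integrated form of the Riccati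
   equations, and it extends to indicators by a monotone class argument. As w is
   positive and Phi_t x - z = e^{tB} (x - z) tends to 0, for large t a single jump
   from x in K° reaches every A that charges z + e + K°, uniformly for bounded x; a
   point of K enters K° by the drift b or by a jump. Steinhaus' theorem applied to
   the sum of two jumps makes a ball around z + e small. Starting uniformly in this
   ball and stopping at an exponential time yields a maximal irreducibility measure,
   which charges the ball. *)

Require Import Defs.
From HB Require Import structures.
From mathcomp Require Import all_boot all_order all_algebra.
From mathcomp Require Import complex.
From mathcomp Require Import all_classical all_reals all_analysis.
From mathcomp Require Import measurable_realfun ring lra.
Set Implicit Arguments.
Unset Strict Implicit.
Unset Printing Implicit Defensive.
Import Order.TTheory GRing.Theory Num.Theory.
Import numFieldNormedType.Exports.
Local Open Scope classical_set_scope.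
Local Open Scope ring_scope.

(** * Inner products and cones *)

(** The parameters enter the hypotheses on the transition kernels only through Laplace transforms,
    so the first-jump formula is not read off the paths. It comes from differentiating in s the
    product of the survival probability up to s and the transform for the remaining time t - s
    started at the drifted point: the Riccati equations cancel everything but the jump term.

    For x in K the scalar measure <x, mu> is positive, but the argument also needs linearity in x
    along the flow. Hence mu is split into signed coordinate functionals, which recombine into
    positive measures at points of K.

    The vector e^{tB} (x - z) tends to 0 without having a sign in the cone order. A fixed interior
    vector e absorbs it after a time that depends only on a bound for x; this margin explains the
    sets z + e + K°. All of z + K is recovered by shrinking e, because the boundary of K is a
    Lebesgue null set, again by Steinhaus' theorem.

    The explicit irreducibility measure is maximal because it charges every set on which the process
    spends positive expected time from all points of the small ball. *)

Section matrix_topology.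
Context {R : realType}.

Lemma cvg_mxP {T} {F : set_system T} {FF : Filter F} m n
    (f : T -> 'M[R]_(m, n)) (l : 'M[R]_(m, n)) :
  f @ F --> l <-> forall i j, f x i j @[x --> F] --> l i j.
Proof.
split=> [fl i j|fl].
  exact: (cvg_comp _ _ fl (@coord_continuous R m n i j l)).
apply/cvgrPdist_lt => e e0.
have H : \forall x \near F, forall i, forall j, `|l i j - f x i j| < e.
  apply: filter_forall => i; apply: filter_forall => j.
  by move/cvgrPdist_lt: (fl i j); apply.
apply: filterS H => x Hx; have : ball l e (f x) by split.
by rewrite mx_norm_ball.
Qed.

Lemma coord_le_norm m n (A : 'M[R]_(m, n)) i j : `|A i j| <= `|A|.
Proof.
rewrite [leRHS]/Num.norm /= mx_normrE; apply/bigmax_geP; right => /=.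
by exists (i, j).
Qed.

Lemma mx_norm_le m n (A : 'M[R]_(m, n)) c : 0 <= c ->
  (forall i j, `|A i j| <= c) -> `|A| <= c.
Proof.
by move=> c0 Ac; rewrite [leLHS]/Num.norm /= mx_normrE; apply/bigmax_leP; split.
Qed.

Lemma norm_mulmx m n k (A : 'M[R]_(m, n)) (C : 'M[R]_(n, k)) :
  `|A *m C| <= n%:R * `|A| * `|C|.
Proof.
apply: mx_norm_le => [|i j]; first by rewrite !mulr_ge0.
rewrite mxE (le_trans (ler_norm_sum _ _ _))// -mulrA mulr_natl.
have -> : (`|A| * `|C|) *+ n = \sum_(l < n) (`|A| * `|C|).
  by rewrite sumr_const card_ord.
by apply: ler_sum => l _; rewrite normrM ler_pM// coord_le_norm.
Qed.

Lemma cvg_sum_ord {T} {F : set_system T} {FF : Filter F} n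
    (f : 'I_n -> T -> R) (l : 'I_n -> R) :
  (forall i, f i x @[x --> F] --> l i) ->
  (\sum_(i < n) f i x) @[x --> F] --> \sum_(i < n) l i.
Proof.
move=> fl; elim: n f l fl => [|n IH] f l fl.
  rewrite big_ord0 (_ : (fun=> _) = cst 0); first exact: cvg_cst.
  by apply/funext => x; rewrite big_ord0.
rewrite big_ord_recl; under eq_fun do rewrite big_ord_recl.
by apply: cvgD; [exact: fl|apply: IH => i; exact: fl].
Qed.

Lemma cvg_mulmx {T} {F : set_system T} {FF : Filter F} m n k
    (f : T -> 'M[R]_(m, n)) (g : T -> 'M[R]_(n, k))
    (A : 'M[R]_(m, n)) (C : 'M[R]_(n, k)) :
  f @ F --> A -> g @ F --> C -> (f x *m g x) @[x --> F] --> A *m C.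
Proof.
move=> /cvg_mxP fA /cvg_mxP gC; apply/cvg_mxP => i j; rewrite mxE.
under eq_fun do rewrite mxE.
by apply: cvg_sum_ord => l; apply: cvgM.
Qed.

(** Transposition carries the Heine-Borel theorem from row vectors to column vectors. *)
Lemma compact_cV n (A : set 'cV[R]_n) : bounded_set A -> closed A -> compact A.
Proof.
move=> [M [Mr AM]] cA.
have ctr p q : continuous (fun x : 'M[R]_(p, q) => x^T).
  by move=> x; apply/(@cvg_mxP _ (nbhs x) _) => i j; rewrite mxE; under eq_fun do rewrite mxE;
    exact: coord_continuous.
have -> : A = (fun x : 'rV[R]_n => x^T) @` [set x | A x^T].
  by apply/seteqP; split=> [x Ax|_ [x Ax <-]//]; exists x^T; rewrite /= trmxK.
apply: continuous_compact; first by apply: continuous_subspaceT; exact: ctr.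
apply: bounded_closed_compact; last exact: (closed_comp (fun x _ => ctr _ _ x)).
exists M; split=> // y My x /= Ax; have y0 := le_trans (normr_ge0 _) (AM y My _ Ax).
apply: mx_norm_le => // i j; rewrite -[x]trmxK mxE.
exact: le_trans (coord_le_norm _ _ _) (AM _ My _ Ax).
Qed.

End matrix_topology.

Section inner_product.
Context {R : realType} {n : nat}.
Local Notation V := 'cV[R]_n.
Implicit Types (ip : {dot V for idfun}) (K : set V).

Lemma ipC ip (x y : V) : ip x y = ip y x.
Proof. by rewrite hermC/= expr0 mul1r. Qed.

Lemma ip_ge0 ip (x : V) : 0 <= ip x x.
Proof.
have [->|x0] := eqVneq x 0; first by rewrite linear0r.
exact/ltW/neq0_dnorm_gt0.
Qed.

Lemma cvg_ip {T} {F : set_system T} {FF : Filter F} ip (f g : T -> V) (a c : V) :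
  f @ F --> a -> g @ F --> c -> ip (f x) (g x) @[x --> F] --> ip a c.
Proof.
move=> fa gc; rewrite ip_gram; under eq_fun do rewrite ip_gram.
have fT : (f x)^T @[x --> F] --> a^T.
  move/cvg_mxP in fa; apply/cvg_mxP => i j; rewrite mxE.
  by under eq_fun do rewrite mxE; exact: fa.
exact: (cvg_mxP _ _).1 (cvg_mulmx (cvg_mulmx fT (cvg_cst (gram ip))) gc) _ _.
Qed.

Lemma ip_cauchy_schwarz ip (x y : V) : ip x y ^+ 2 <= ip x x * ip y y.
Proof.
have [->|y0] := eqVneq y 0; first by rewrite !linear0r expr0n.
have yy : 0 < ip y y by exact: neq0_dnorm_gt0.
have := ip_ge0 ip (ip y y *: x - ip x y *: y).
rewrite !(linearBl, linearBr, linearZl_LR, linearZr_LR)/= (ipC ip y x) /GRing.scale/=.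
move=> H; have : 0 <= ip y y * (ip x x * ip y y - ip x y ^+ 2) by move: H; nra.
by rewrite pmulr_rge0// subr_ge0.
Qed.

Lemma ip_sqD ip (u a : V) (s : R) : ip (u + s *: a) (u + s *: a) =
  ip u u + 2 * s * ip a u + s ^+ 2 * ip a a.
Proof.
rewrite linearDl !linearDr/= !(linearZl_LR, linearZr_LR)/= (ipC ip u a).
by rewrite /GRing.scale/=; ring.
Qed.

(** The entries of [gram ip *m x] are the inner products of [x] with the basis vectors, which
    Cauchy-Schwarz bounds; the invertible Gram matrix transfers the bound to [x]. *)
Lemma ip_coercive ip : exists2 C : R, 0 < C & forall x, `|x| ^+ 2 <= C * ip x x.
Proof.
pose D := \sum_i ip (delta_mx i ord0) (delta_mx i ord0).
have D0 : 0 <= D by apply: sumr_ge0 => i _; exact: ip_ge0.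
pose N := n%:R * `|invmx (gram ip)|.
exists (N ^+ 2 * D + 1) => [|x]; first by rewrite ltr_wpDl// mulr_ge0// sqr_ge0.
have xx := ip_ge0 ip x.
have gx : `|gram ip *m x| <= Num.sqrt (D * ip x x).
  apply: mx_norm_le => [|i j]; first exact: sqrtr_ge0.
  rewrite ord1 -sqrtr_sqr ler_wsqrtr//.
  have -> : (gram ip *m x) i 0 = ip (delta_mx i ord0) x.
    rewrite ip_gram -mulmxA trmx_delta -rowE [RHS]mxE //.
  apply: le_trans (ip_cauchy_schwarz _ _ _) _; apply: ler_wpM2r => //.
  rewrite /D (bigD1 i)//= lerDl; apply: sumr_ge0 => k _; exact: ip_ge0.
have : `|x| <= N * Num.sqrt (D * ip x x).
  rewrite -{1}[x]mul1mx -(mulVmx (gram_unit ip)) -mulmxA.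
  apply: le_trans (norm_mulmx _ _) _; apply: ler_wpM2l => //.
move=> H; have := lerXn2r 2 (normr_ge0 x : _ \in Num.nneg) _ H.
rewrite exprMn sqr_sqrtr ?mulr_ge0// mulrA => h.
rewrite mulrDl mul1r (le_trans (h _)) ?lerDl// qualifE/=.
by rewrite !mulr_ge0// sqrtr_ge0.
Qed.

(** Bipolar theorem by projection. If [k] is the point of [K] nearest to [v], minimality in the
    directions [x] of [K] puts [k - v] in the dual cone, and minimality in the direction [- k] makes
    the product of [k - v] with [k] nonpositive; its product with [v] is then negative unless
    [v = k]. *)
Lemma dual_cone_bipolar ip K (v : V) : generating_proper_cone K ->
  (forall u, dual_cone ip K u -> 0 <= ip u v) -> K v.
Proof.
move=> hK uv; apply: contrapT => Kv.
have [C C0 hC] := ip_coercive ip.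
pose d (k : V) := ip (k - v) (k - v).
(* The minimum over [K] is sought among the points at least as near to [v] as 0, which form a
   compact set. *)
pose S := K `&` [set k | d k <= d 0].
have dcont : continuous d.
  move=> k; have h : (k' - v) @[k' --> k] --> k - v.
    apply: (@cvgB R V _ (nbhs k) _ id (cst v)); first exact: cvg_id.
    exact: cvg_cst.
  exact: (cvg_ip h h).
have cS : compact S.
  apply: compact_cV.
    exists (`|v| + (C * d 0 + 1)); split; first by rewrite num_real.
    move=> M MC k [_ /= kd]; apply: le_trans (ltW MC).
    rewrite -[k](subrK v) addrC (le_trans (ler_normD _ _))// lerD2l.
    have h1 := le_trans (hC (k - v)) (ler_wpM2l (ltW C0) kd).
    have := sqr_ge0 (`|k - v| - 1); nra.
  apply: closedI; first exact: cone_closed hK.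
  exact: (closed_comp (fun x _ => dcont x) (@closed_le R (d 0))).
have S0 : S !=set0 by exists 0; split => //=; exact: cone0 hK.
have [k /set_mem[Kk _] kmin] := compact_EVT_min S0 cS
  (continuous_subspaceT dcont).
have {}kmin x : K x -> d k <= d x.
  move=> Kx; have [xd|/ltW xd] := leP (d x) (d 0); first by apply: kmin; rewrite inE.
  apply: le_trans xd; apply: kmin; rewrite inE; split=> //=; exact: cone0 hK.
have dE (a : V) (s : R) : d (k + s *: a) = d k + 2 * s * ip a (k - v) + s ^+ 2 * ip a a.
  by rewrite /d addrAC ip_sqD.
have first_order a (r : R) : 0 < r -> (forall s, 0 <= s <= r -> K (k + s *: a)) ->
    0 <= ip a (k - v).
  move=> r0 Ka; rewrite leNgt; apply/negP => neg.
  have aa : 0 <= ip a a by exact: ip_ge0.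
  (* The step is short enough for the quadratic term of [dE] to stay below half of the negative
     linear term. *)
  pose s := Num.min r (- ip a (k - v) / (ip a a + 1)).
  have s0 : 0 < s by rewrite lt_min r0 divr_gt0// ?oppr_gt0// ltr_wpDl.
  have := kmin _ (Ka s _); rewrite (ltW s0) ge_min lexx/= dE => /(_ isT) h.
  have sle : s * (ip a a + 1) <= - ip a (k - v).
    by rewrite -ler_pdivlMr ?ltr_wpDl// ge_min lexx orbT.
  nra.
have ku (x : V) : K x -> 0 <= ip (k - v) x.
  move=> Kx; rewrite ipC; apply: (@first_order x 1) => // s /andP[s0 _].
  by apply: (coneD hK) => //; exact: (coneZ hK).
have := uv (k - v) ku.
have h2 : 0 <= ip (- k) (k - v).
  apply: (@first_order _ 1) => // s /andP[s0 s1].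
  rewrite scalerN -{1}[k]scale1r -scalerBl.
  by apply: (coneZ hK) => //; rewrite subr_ge0.
have kv : k - v != 0.
  by apply/negP => /eqP/subr0_eq kv; apply: Kv; rewrite -kv.
have uu : 0 < ip (k - v) (k - v) by exact: neq0_dnorm_gt0.
have -> : ip (k - v) v = ip (k - v) k - ip (k - v) (k - v).
  by rewrite -linearBr/= subKr.
by move: h2; rewrite linearNl/= (ipC ip k) => *; lra.
Qed.

End inner_product.

Section cones.
Context {R : realType} {n : nat}.
Local Notation V := 'cV[R]_n.
Implicit Types (ip : {dot V for idfun}) (K : set V).

Lemma cvx_interior_ball (A : set V) e : A° e ->
  exists2 r : R, 0 < r & forall y, `|y| <= r -> A (e + y).
Proof.
move=> /nbhs_ballP[r /= r0 rA]; exists (r / 2); first by rewrite divr_gt0.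
move=> y yr; apply: rA; rewrite mx_norm_ball /ball_/= opprD addNKr normrN.
by apply: le_lt_trans yr _; rewrite ltr_pdivrMr// ltr_pMr// ltr1n.
Qed.

Lemma interiorP (A : set V) e (r : R) : 0 < r ->
  (forall y, `|y| < r -> A (e + y)) -> A° e.
Proof.
move=> r0 rA; apply/nbhs_ballP; exists r => // y.
rewrite mx_norm_ball /ball_/= => ey.
by rewrite -[y](subrK e) addrC; apply: rA; rewrite distrC.
Qed.

Context (K : set V) (hK : generating_proper_cone K).

Lemma interior_coneD x y : K° x -> K y -> K° (x + y).
Proof.
move=> /cvx_interior_ball[r r0 rK] Ky; apply: (interiorP r0) => z /ltW zr.
by rewrite addrAC; apply: (coneD hK) => //; exact: rK.
Qed.

Lemma interior_coneZ (a : R) x : 0 < a -> K° x -> K° (a *: x).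
Proof.
move=> a0 /cvx_interior_ball[r r0 rK].
apply: (@interiorP _ _ (a * r)) => [|z zr]; first by rewrite mulr_gt0.
rewrite -[z](scalerKV (lt0r_neq0 a0)) -scalerDr; apply: (coneZ hK); first exact: ltW.
by apply: rK; rewrite normrZ normfV gtr0_norm// ler_pdivrMl// ltW.
Qed.

Lemma cone_sum m (f : 'I_m -> V) : (forall i, K (f i)) -> K (\sum_i f i).
Proof.
move=> fK; elim/big_ind : _ => //; [exact: cone0 hK|exact: coneD hK].
Qed.

(** Each basis vector is a difference of two elements of [K]. In the sum of all these elements the
    coefficients equal 1, and a perturbation with coordinates below 1 in absolute value leaves them
    nonnegative. *)
Lemma cone_interior_neq0 : exists e, K° e.
Proof.
have /choice[f fP] : forall i : 'I_n, exists p : V * V,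
    [/\ K p.1, K p.2 & delta_mx i ord0 = p.1 - p.2].
  by move=> i; have [x [y ?]] := cone_generating hK (delta_mx i ord0); exists (x, y).
exists (\sum_i ((f i).1 + (f i).2)); apply: (@interiorP _ _ 1) => // y y1.
have -> : y = \sum_i (y i ord0 *: (f i).1 - y i ord0 *: (f i).2).
  rewrite {1}[y]matrix_sum_delta; apply: eq_bigr => i _.
  rewrite big_ord_recl big_ord0 addr0 -scalerBr; congr (_ *: _).
  by case: (fP i).
rewrite -big_split/=; apply: cone_sum => i; case: (fP i) => K1 K2 _.
have yi : `|y i ord0| <= 1 by exact: le_trans (coord_le_norm _ _ _) (ltW y1).
rewrite ler_norml in yi; case/andP: yi => yi1 yi2.
rewrite (_ : _ + _ + _ = (1 + y i ord0) *: (f i).1 + (1 - y i ord0) *: (f i).2).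
  by apply: (coneD hK); apply: (coneZ hK) => //; lra.
by rewrite !scalerDl !scale1r scaleNr addrACA.
Qed.

Lemma interior_cone_scale e x : K° x -> exists2 c : R, 0 < c & K (x - c *: e).
Proof.
move=> /cvx_interior_ball[r r0 rK].
exists (r / (`|e| + 1)); first by rewrite divr_gt0// ltr_wpDl.
apply: rK; rewrite normrN normrZ gtr0_norm ?divr_gt0// ?ltr_wpDl//.
by rewrite mulrAC ler_pdivrMr ?ltr_wpDl// ler_wpM2l ?ltW// ltrDl.
Qed.

Lemma cone_lim {T} {F : set_system T} {FF : ProperFilter F} (f : T -> V) l :
  (forall x, K (f x)) -> f @ F --> l -> K l.
Proof.
move=> fK fl; apply: (@closed_cvg _ _ F FF f K (cone_closed hK)) fl.
exact: nearW.
Qed.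

Lemma cone_of_interior_shift e x : (forall d : R, 0 < d -> K (x + d *: e)) -> K x.
Proof.
move=> H; have : (x + (k.+1%:R^-1 : R) *: e) @[k --> \oo] --> x.
  rewrite -[X in _ --> X]addr0; apply: cvgD; first exact: cvg_cst.
  rewrite -(scale0r e); apply: cvgZr_tmp; exact: cvg_harmonic.
by apply: cone_lim => k; apply: H; rewrite invr_gt0.
Qed.

End cones.

Section dual_span.
Context {R : realType} {n : nat}.
Local Notation V := 'cV[R]_n.
Context (ip : {dot V for idfun}) (K : set V) (hK : generating_proper_cone K).

Lemma dual_coneD u v : dual_cone ip K u -> dual_cone ip K v -> dual_cone ip K (u + v).
Proof. by move=> Ku Kv x Kx; rewrite linearDl/= addr_ge0 ?Ku ?Kv. Qed.

Lemma dual_coneZ (a : R) u : 0 <= a -> dual_cone ip K u -> dual_cone ip K (a *: u).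
Proof.
by move=> a0 Ku x Kx; rewrite linearZl_LR/= /GRing.scale/= mulr_ge0 ?Ku.
Qed.

Lemma dual_cone0 : dual_cone ip K 0.
Proof. by move=> x Kx; rewrite linear0l. Qed.

(* The rank of a family of elements of the dual cone is at most n; at a family of
   maximal rank, a vector orthogonal to it is orthogonal to the whole dual cone,
   hence lies in K together with its opposite. *)
Lemma dual_cone_generating v : exists u w, [/\ dual_cone ip K u, dual_cone ip K w & v = u - w].
Proof.
pose fam m (U : 'M[R]_(m, n)) := forall i, dual_cone ip K (row i U)^T.
pose Q r := `[< exists m (U : 'M[R]_(m, n)), fam m U /\ \rank U = r >].
have exQ : exists r, Q r by exists 0%N; apply/asboolP; exists 0%N, 0; split; [case|rewrite mxrank0].
have leQ r : Q r -> (r <= n)%N by move=> /asboolP[m [U [_ <-]]]; exact: rank_leq_col.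
have [r /asboolP[m [U [famU <-]]] maxr] := ex_maxnP exQ leQ.
have Usub u : dual_cone ip K u -> (u^T <= U)%MS.
  move=> Ku; have /maxr : Q (\rank (col_mx U u^T)).
    apply/asboolP; exists (m + 1)%N, (col_mx U u^T); split => // i x Kx.
    case: (split_ordP i) => j ->; first by rewrite rowKu; exact: famU.
    by rewrite rowKd (_ : row j u^T = u^T) ?trmxK; [exact: Ku|rewrite ord1 row_id].
  rewrite -addsmxE => le1.
  have /mxrank_leqif_sup/geq_leqif : (U <= U + u^T)%MS by exact: addsmxSl.
  by rewrite le1 addsmx_sub => /esym/andP[].
have rk : row_full U.
  rewrite -cokermx_eq0; apply/eqP/matrixP => i j; rewrite [RHS]mxE.
  pose x := invmx (gram ip) *m col j (cokermx U).
  have ipx u : dual_cone ip K u -> ip u x = 0.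
    move=> /Usub/submxP[D uD].
    rewrite ip_gram /x -mulmxA (mulmxA (gram ip)) mulmxV ?gram_unit// mul1mx uD.
    by rewrite -mulmxA !colE (mulmxA U) mulmx_coker mul0mx mulmx0 mxE.
  have x0 : x = 0.
    apply: (cone_proper hK); apply: (dual_cone_bipolar (ip := ip) hK) => u /ipx ux.
      by rewrite ux.
    by rewrite linearNr/= ux oppr0.
  have : gram ip *m x = 0 by rewrite x0 mulmx0.
  rewrite /x mulmxA mulmxV ?gram_unit// mul1mx => /matrixP/(_ i ord0).
  by rewrite !mxE.
have /submxP[D vD] : (v^T <= U)%MS by apply: submx_full.
have comb (c : 'I_m -> R) : (forall i, 0 <= c i) -> dual_cone ip K (\sum_i c i *: (row i U)^T).
  move=> c0; elim/big_ind : _ => [||i _]; [exact: dual_cone0|exact: dual_coneD|].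
  by apply: dual_coneZ => //; exact: famU.
exists (\sum_i Num.max (D ord0 i) 0 *: (row i U)^T).
exists (\sum_i Num.max (- D ord0 i) 0 *: (row i U)^T); split.
- by apply: comb => i; rewrite le_max lexx orbT.
- by apply: comb => i; rewrite le_max lexx orbT.
- rewrite -sumrB -[v]trmxK vD mulmx_sum_row linear_sum/=; apply: eq_bigr => i _.
  rewrite -scalerBl linearZ/=; congr (_ *: _).
  by rewrite /Num.max; case: ifPn; case: ifPn; rewrite ?oppr_lt0 ?oppr_gt0; lra.
Qed.

End dual_span.

(** * The matrix exponential *)

Section derivatives.
Context {R : realType}.

Lemma is_derive_sum_ord n (f : 'I_n -> R -> R) (d : 'I_n -> R) (x : R) :
  (forall l, is_derive x 1 (f l) (d l)) ->
  is_derive x 1 (fun y => \sum_l f l y) (\sum_l d l).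
Proof.
move=> fd; have -> : (fun y => \sum_l f l y) = \sum_l f l.
  by apply/funext => y; rewrite fct_sumE.
exact: is_derive_sum.
Qed.

Lemma is_derive_mul (f g : R -> R) (df dg x : R) :
  is_derive x 1 f df -> is_derive x 1 g dg ->
  is_derive x 1 (fun y => f y * g y) (df * g x + f x * dg).
Proof.
move=> Hf Hg; have := is_deriveM Hf Hg.
by rewrite addrC /GRing.scale/= (mulrC (g x)).
Qed.

Lemma is_derive_mulr (f : R -> R) (c df x : R) :
  is_derive x 1 f df -> is_derive x 1 (fun y => f y * c) (df * c).
Proof.
by move=> fx; have := is_derive_mul fx (is_derive_cst c x 1); rewrite mulr0 addr0.
Qed.

Lemma nonincreasing_is_derive (f df : R -> R) (a b : R) : a <= b ->
  (forall x, a <= x <= b -> is_derive x 1 f (df x)) ->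
  (forall x, a <= x <= b -> df x <= 0) -> f b <= f a.
Proof.
move=> ab fd df0.
have [||c] := @MVT_segment R f df a b ab.
- by move=> x /itvP xab; apply: fd; rewrite !xab.
- by apply: derivable_within_continuous => x; rewrite in_itv/= => /fd[].
by rewrite in_itv/= => /df0 c0 fE; rewrite -subr_le0 fE mulr_le0_ge0// subr_ge0.
Qed.

(** Gronwall's argument: once [|G t|] is at most [c * (e / 2)], the function
    [(N t - e / 2) * expR (c * t)] is nonincreasing, so [N] exceeds [e / 2] by an exponentially
    small amount only. *)
Lemma cvg0_of_dissipation (N dN G : R -> R) (c : R) : 0 < c ->
  (forall t : R, is_derive t 1 N (dN t)) -> (forall t, 0 <= N t) ->
  (forall t, dN t <= - c * N t + G t) -> G t @[t --> +oo] --> 0 ->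
  N t @[t --> +oo] --> 0.
Proof.
move=> c0 NdN N0 dNle G0; apply/cvgrPdist_le => e e0.
have [T [_ GT]] : \forall t \near +oo, `|G t| <= c * (e / 2).
  have ce : 0 < c * (e / 2) by rewrite mulr_gt0// divr_gt0.
  by move/cvgrPdist_le: G0 => /(_ _ ce); apply: filterS => t; rewrite sub0r normrN.
pose T' := T + 1.
pose h t := (N t - e / 2) * expR (c * t).
have hd (t : R) : is_derive t 1 h ((dN t + c * (N t - e / 2)) * expR (c * t)).
  have d1 : is_derive t 1 (fun t => N t - e / 2) (dN t).
    have := @is_deriveB R R R N (cst (e / 2)) t 1 _ _ (NdN t) (is_derive_cst _ _ _).
    by rewrite subr0.
  have d2 : is_derive t 1 (fun t => expR (c * t)) (expR (c * t) * c).
    have d3 : is_derive t 1 (fun t : R => c * t) c.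
      have := @is_deriveZ R R R id c t 1 1 (is_derive_id _ _).
      by rewrite /GRing.scale/= mulr1.
    by have := @is_derive1_comp R expR (fun t => c * t) t _ _ (is_derive_expR _) d3.
  by apply: is_derive_eq (is_derive_mul d1 d2) _; ring.
have hle t : T' <= t -> N t <= e / 2 + h T' * expR (- (c * t)).
  move=> T't; have : h t <= h T'.
    apply: (nonincreasing_is_derive T't (fun x _ => hd x)) => x /andP[T'x _].
    rewrite pmulr_lle0 ?expR_gt0//.
    have := GT x; rewrite (lt_le_trans _ T'x) ?ltrDl// => /(_ isT).
    by move=> /(le_trans (ler_norm _)); have := dNle x; lra.
  rewrite {1}/h => H; rewrite -lerBlDl -ler_pdivrMr ?expR_gt0// expRN invrK//.
have lim0 : h T' * expR (- (c * t)) @[t --> +oo] --> 0.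
  rewrite -(mulr0 (h T')); apply: cvgM; first exact: cvg_cst.
  apply: (cvg_comp (fun t => c * t) (fun x => expR (- x)) _ (@cvgr_expR R)).
  by apply: gt0_cvgMry => //; exact: cvg_id.
have e2 : 0 < e / 2 by rewrite divr_gt0.
move/cvgrPdist_le: lim0 => /(_ _ e2) lim0.
near=> t.
have T't : T' <= t by near: t; apply: nbhs_pinfty_ge; rewrite num_real.
rewrite sub0r normrN ger0_norm// (le_trans (hle t _))//.
rewrite [leRHS]splitr lerD2l; apply: le_trans (ler_norm _) _.
by rewrite -normrN -sub0r; near: t.
Unshelve. all: by end_near. Qed.

End derivatives.

Lemma exprmxZ (R : comNzRingType) n (t : R) (B : 'M[R]_n) k :
  (t *: B) ^+ k = t ^+ k *: B ^+ k.
Proof.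
elim: k => [|k IH]; first by rewrite !expr0 scale1r.
by rewrite !exprSr IH -!mulmxE -scalemxAl -scalemxAr scalerA.
Qed.

Section matrix_exponential.
Context {R : realType} {n : nat}.
Variable B : 'M[R]_n.
Local Notation E t := (expmx (t *: B)).

(** The coefficient of t^k in the entry (i, j) of [C *m E t]. The factor [C] makes the family stable
    under termwise differentiation, which replaces [C] by [C *m B]. *)
Let coef (C : 'M[R]_n) i j k : R := (k`!%:R)^-1 * (C *m B ^+ k) i j.

Lemma norm_expmx_pow (C : 'M[R]_n) k : `|C *m B ^+ k| <= `|C| * (n%:R * `|B|) ^+ k.
Proof.
elim: k => [|k IH]; first by rewrite expr0 mulmx1 mulr1.
rewrite exprSr mulmxA; apply: le_trans (norm_mulmx _ _) _.
have := ler_wpM2l (mulr_ge0 (ler0n R n) (normr_ge0 B)) IH.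
by rewrite mulrAC exprSr mulrCA (mulrC (n%:R * `|B|)).
Qed.

Let is_cvg_coef C i j x : cvgn (pseries (coef C i j) x).
Proof.
apply: normed_cvg; rewrite /normed_series_of/=.
pose q := n%:R * `|B| * `|x|.
apply: (@series_le_cvg R _ (fun k => `|C| * exp_coeff q k)) => //.
- by move=> k; rewrite mulr_ge0// exp_coeff_ge0// mulr_ge0// mulr_ge0.
- move=> k; rewrite /coef !normrM normrX normfV normr_nat.
  rewrite /exp_coeff/= /q exprMn.
  rewrite (_ : `|C| * _ = k`!%:R^-1 * (`|C| * (n%:R * `|B|) ^+ k) * `|x| ^+ k); last by ring.
  apply: ler_wpM2r; rewrite ?exprn_ge0//; apply: ler_wpM2l; rewrite ?invr_ge0//.
  exact: le_trans (coord_le_norm _ _ _) (norm_expmx_pow _ _).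
- have := @is_cvg_seriesZ R _ `|C| (is_cvg_series_exp_coeff q).
  by [].
Qed.

Let coef_diffs C i j : pseries_diffs (coef C i j) = coef (C *m B) i j.
Proof.
apply/funext => k; rewrite /pseries_diffs /coef factS natrM invfM -mulrA mulVKf//.
by rewrite exprS -mulmxE mulmxA.
Qed.

Let limcoefE C i j x :
  limn (pseries (coef C i j) x) = \sum_l C i l * limn (pseries (coef 1%:M l j) x).
Proof.
apply/cvg_lim => //.
rewrite (_ : pseries _ x = fun N => \sum_l C i l * pseries (coef 1%:M l j) x N).
  by apply: cvg_sum_ord => l; apply: cvgM; [exact: cvg_cst|exact: is_cvg_coef].
apply/funext => N; rewrite /pseries/= /series/=.
under [RHS]eq_bigr do rewrite mulr_sumr.
rewrite exchange_big/=; apply: eq_bigr => k _.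
rewrite /coef mxE mulr_sumr mulr_suml; apply: eq_bigr => l _.
by rewrite mul1mx; ring.
Qed.

Lemma cvg_expmx t : series (fun k => (k`!%:R)^-1 *: (t *: B) ^+ k) @ \oo --> E t.
Proof.
suff : cvgn (series (fun k => (k`!%:R : R)^-1 *: (t *: B) ^+ k)) by [].
apply/cvg_ex; exists (\matrix_(i, j) limn (pseries (coef 1%:M i j) t)).
apply/cvg_mxP => i j; rewrite mxE.
rewrite (_ : (fun _ => _) = pseries (coef 1%:M i j) t); first exact: is_cvg_coef.
apply/funext => N; rewrite /series/= summxE; apply: eq_bigr => k _.
by rewrite /= /coef mul1mx exprmxZ !mxE; ring.
Qed.

Let expmxE t i j : E t i j = limn (pseries (coef 1%:M i j) t).
Proof.
have /(@cvg_mxP _ _ \oo _) /(_ i j)/cvg_lim <- // := @cvg_expmx t.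
congr (limn _); apply/funext => N; rewrite /series/= summxE; apply: eq_bigr => k _.
by rewrite /= /coef mul1mx exprmxZ !mxE; ring.
Qed.

Lemma is_derive_expmx (t : R) i j : is_derive t 1 (fun s => E s i j) ((B *m E t) i j).
Proof.
have -> : (fun s => E s i j) = (fun s => limn (pseries (coef 1%:M i j) s)).
  by apply/funext => s; rewrite expmxE.
have -> : (B *m E t) i j = limn (pseries (pseries_diffs (coef 1%:M i j)) t).
  rewrite coef_diffs mul1mx limcoefE mxE.
  by apply: eq_bigr => l _; rewrite expmxE.
apply: (@pseries_snd_diffs _ _ (`|t| + 1)); rewrite ?coef_diffs; try exact: is_cvg_coef.
by rewrite (ger0_norm (_ : 0 <= `|t| + 1)) ?ltrDl// addr_ge0.
Qed.

Lemma expmx_comm t : B *m E t = E t *m B.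
Proof.
pose S := series (fun k => (k`!%:R)^-1 *: (t *: B) ^+ k).
have h1 : (B *m S N) @[N --> \oo] --> B *m E t.
  by apply: cvg_mulmx; [exact: cvg_cst|exact: cvg_expmx].
have h2 : (S N *m B) @[N --> \oo] --> E t *m B.
  by apply: cvg_mulmx; [exact: cvg_expmx|exact: cvg_cst].
have SB N : B *m S N = S N *m B.
  rewrite /S /series/= mulmx_sumr mulmx_suml; apply: eq_bigr => k _.
  rewrite -scalemxAr -scalemxAl; congr (_ *: _).
  rewrite exprmxZ -scalemxAr -scalemxAl; congr (_ *: _).
  by rewrite !mulmxE -exprS exprSr.
apply: cvg_unique h1 _ => //.
by rewrite (_ : (fun _ => _) = (fun N => S N *m B))//; apply/funext.
Qed.

Lemma expmx0 : E 0 = 1%:M.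
Proof.
apply: (cvg_unique _ (@cvg_expmx 0)) => //.
rewrite /= -(cvg_shiftS _); apply: (@cvg_trans _ (cst (1%:M : 'M[R]_n) @ \oo)); last exact: cvg_cst.
rewrite (_ : (fun N => _) = cst 1%:M)//; apply/funext => N /=.
rewrite /series/= big_nat_recl//= big1 => [|k _].
  by rewrite fact0 invr1 scale1r expr0 addr0.
by rewrite scale0r exprS mul0r scaler0.
Qed.

Lemma is_derive_mulmx_expmx (A : R -> 'M[R]_n) (dA : 'M[R]_n) (t : R) i j s :
  (forall i j, is_derive t 1 (fun r => A r i j) (dA i j)) ->
  is_derive t 1 (fun r => (A r *m E (r + s)) i j)
    ((dA *m E (t + s) + A t *m (B *m E (t + s))) i j).
Proof.
move=> Ad; have -> : (fun r => (A r *m E (r + s)) i j) =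
    (fun r => \sum_l A r i l * E (r + s) l j).
  by apply/funext => r; rewrite mxE.
rewrite mxE [X in X + _]mxE [X in _ + X]mxE -big_split/=.
apply: is_derive_sum_ord => l; apply: is_derive_mul => //.
have h : is_derive t 1 (fun r : R => r + s) 1.
  have := @is_deriveD R R R id (cst s) t 1 _ _ (is_derive_id _ _) (is_derive_cst _ _ _).
  by rewrite addr0.
have := @is_derive1_comp R (fun r => E r l j) (fun r => r + s) t _ _ (is_derive_expmx _ _ _) h.
by rewrite mulr1.
Qed.

(** As [B] commutes with its exponential, the left-hand side has zero derivative in [t], and at
    [t = 0] it equals [E s]. This one identity yields both the inverse ([s = 0]) and the functional
    equation. *)
Let expmxND t s : E (- t) *m E (t + s) = E s.
Proof.
apply/matrixP => i j.
have d (r : R) : is_derive r 1 (fun r => (E (- r) *m E (r + s)) i j) 0.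
  have -> : 0 = ((- (B *m E (- r)) *m E (r + s) + E (- r) *m (B *m E (r + s))) i j).
    by rewrite mulNmx (expmx_comm (- r)) -mulmxA addrC subrr mxE.
  apply: (is_derive_mulmx_expmx (A := fun r => E (- r))) => k l.
  have := @is_derive1_comp R (fun r => E r k l) -%R r _ _ (is_derive_expmx _ _ _) (is_deriveNid _ _).
  by rewrite mulrN1 [(- (_ *m _)) k l]mxE.
have := @is_derive_0_is_cst R (fun r => (E (- r) *m E (r + s)) i j) t 0 d.
by move=> ->; rewrite oppr0 add0r expmx0 mul1mx.
Qed.

Lemma expmxNK t : E (- t) *m E t = 1%:M.
Proof. by have := expmxND t 0; rewrite addr0 expmx0. Qed.

Lemma expmxKN t : E t *m E (- t) = 1%:M.
Proof. by have := expmxNK (- t); rewrite opprK. Qed.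

Lemma expmxD t s : E (t + s) = E t *m E s.
Proof. by rewrite -(expmxND t s) mulmxA expmxKN mul1mx. Qed.

Lemma expmx_unit t : E t \in unitmx.
Proof. by case/mulmx1_unit: (expmxKN t). Qed.

Lemma continuous_expmx : continuous (fun t : R => E t).
Proof.
move=> t; apply/(@cvg_mxP _ _ (nbhs t) _) => i j.
have [d _] := is_derive_expmx t i j.
by have := differentiable_continuous ((derivable1_diffP _ _).1 d).
Qed.

End matrix_exponential.

(** An explicit product makes sense in every dimension, whereas [horner_mx] evaluates polynomials at
    matrices of positive size; the two agree there. *)
Fixpoint linear_factors (F : comNzRingType) n (A : 'M[F]_n) (r : seq F) : 'M[F]_n :=
  if r is z :: r' then linear_factors A r' *m (A - z%:M) else 1%:M.

Lemma linear_factorsE (F : comNzRingType) n (A : 'M[F]_n.+1) r :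
  linear_factors A r = horner_mx A (\prod_(z <- r) ('X - z%:P)).
Proof.
elim: r => [|z r IH]; first by rewrite big_nil; exact/esym/rmorph1.
by rewrite big_cons mulrC rmorphM/= IH rmorphB/= horner_mx_X horner_mx_C mulmxE.
Qed.

(** * Decay of the exponential of a matrix whose eigenvalues have negative real parts *)

Section exponential_decay.
Context {R : realType} {n : nat}.
Variable B : 'M[R]_n.
Local Notation E t := (expmx (t *: B)).
Local Notation toC := (map_mx (real_complex R)).

Let ReM (x y : R[i]) : complex.Re (x * y) =
  complex.Re x * complex.Re y - complex.Im x * complex.Im y.
Proof. by case: x y => [a b] [c d]. Qed.

Let ImM (x y : R[i]) : complex.Im (x * y) =
  complex.Re x * complex.Im y + complex.Im x * complex.Re y.
Proof. by case: x y => [a b] [c d]. Qed.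

Let Re_mul_toC (P : 'M[R[i]]_n) (M : 'M[R]_n) i j :
  complex.Re ((P *m toC M) i j) = \sum_l complex.Re (P i l) * M l j.
Proof.
rewrite mxE raddf_sum/=; apply: eq_bigr => l _.
by rewrite mxE ReM/= mulr0 subr0.
Qed.

Let Im_mul_toC (P : 'M[R[i]]_n) (M : 'M[R]_n) i j :
  complex.Im ((P *m toC M) i j) = \sum_l complex.Im (P i l) * M l j.
Proof.
rewrite mxE raddf_sum/=; apply: eq_bigr => l _.
by rewrite mxE ImM/= mulr0 add0r.
Qed.

Let is_derive_lin (c : 'I_n -> R) j (t : R) :
  is_derive t 1 (fun s => \sum_l c l * E s l j) (\sum_l c l * (B *m E t) l j).
Proof.
apply: is_derive_sum_ord => l.
exact: is_deriveZ (is_derive_expmx B t l j).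
Qed.

Local Notation factors := (linear_factors (toC B)).

Let flow r t i j := (factors r *m toC (E t)) i j.

Let flow_vanishes r := forall i j,
  complex.Re (flow r t i j) @[t --> +oo] --> 0 /\
  complex.Im (flow r t i j) @[t --> +oo] --> 0.

(** The product without the factor for [z] solves y' = z y + f, where f is the product with that
    factor. As Re z < 0 and f tends to 0, the squared modulus [N] is dissipated up to a vanishing
    source. *)
Let flow_vanishes_behead z r : complex.Re z < 0 ->
  flow_vanishes (z :: r) -> flow_vanishes r.
Proof.
move=> z0 H i j; have [HRe HIm] := H i j.
pose a t := complex.Re (flow r t i j); pose b t := complex.Im (flow r t i j).
pose f t := complex.Re (flow (z :: r) t i j); pose g t := complex.Im (flow (z :: r) t i j).
pose x := complex.Re z; pose y := complex.Im z.
have key t : (factors r *m toC (B *m E t)) i j = flow (z :: r) t i j + z * flow r t i j.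
  rewrite /flow/= -!mulmxA map_mxM mulmxBl mulmxBr !mulmxA mul_mx_scalar.
  by rewrite -scalemxAl !mxE subrK.
have da (t : R) : is_derive t 1 a (f t + (x * a t - y * b t)).
  have aE : a = fun t => \sum_l complex.Re (factors r i l) * E t l j.
    by apply/funext => s; rewrite /a /flow Re_mul_toC.
  rewrite [X in is_derive _ _ X _]aE; apply: is_derive_eq (is_derive_lin _ _ _) _.
  by rewrite -Re_mul_toC key raddfD/= ReM.
have db (t : R) : is_derive t 1 b (g t + (x * b t + y * a t)).
  have bE : b = fun t => \sum_l complex.Im (factors r i l) * E t l j.
    by apply/funext => s; rewrite /b /flow Im_mul_toC.
  rewrite [X in is_derive _ _ X _]bE; apply: is_derive_eq (is_derive_lin _ _ _) _.
  by rewrite -Im_mul_toC key raddfD/= ImM.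
pose N t := a t * a t + b t * b t.
have dN (t : R) : is_derive t 1 N (2 * (a t * (f t + (x * a t - y * b t)) + b t * (g t + (x * b t + y * a t)))).
  apply: is_derive_eq (is_deriveD (is_derive_mul (da t) (da t)) (is_derive_mul (db t) (db t))) _.
  by ring.
have N0 t : 0 <= N t by rewrite addr_ge0// -expr2 sqr_ge0.
have x0 : 0 < - x by rewrite oppr_gt0.
have N_0 : N t @[t --> +oo] --> 0.
  apply: (@cvg0_of_dissipation R N _ (fun t => (- x)^-1 * (f t * f t + g t * g t)) (- x) x0 dN N0).
    move=> t.
    (* Young's inequality with weight [- x]: the cross terms use up half of the damping
       [2 * x * N t], and the other half remains. *)
    have h (u v : R) : 2 * (u * v) <= - x * u ^+ 2 + (- x)^-1 * v ^+ 2.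
      rewrite -subr_ge0 (_ : _ - _ = (- x)^-1 * (- x * u - v) ^+ 2).
        by rewrite mulr_ge0// ?sqr_ge0// invr_ge0 ltW.
      by field; rewrite lt_eqF.
    have := h (a t) (f t); have := h (b t) (g t).
    by rewrite /N mulrDr; lra.
  rewrite -(mulr0 (- x)^-1); apply: cvgM; first exact: cvg_cst.
  have := cvgD (cvgM HRe HRe) (cvgM HIm HIm); rewrite mulr0 addr0; exact.
have sq (u : R -> R) : (forall t, u t ^+ 2 <= N t) -> u t @[t --> +oo] --> 0.
  move=> uN; apply/cvgrPdist_lt => e e0.
  have e2 : 0 < e ^+ 2 by rewrite exprn_gt0.
  move/cvgrPdist_lt: N_0 => /(_ _ e2); apply: filterS => t.
  rewrite !sub0r !normrN (ger0_norm (N0 t)) => Nt.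
  rewrite -(@ltr_pXn2r _ 2)// ?nnegrE ?(ltW e0)//.
  by rewrite real_normK ?num_real//; exact: le_lt_trans (uN t) Nt.
split; apply: sq => t; rewrite -/(a t) -/(b t) /N.
- by rewrite -!expr2 lerDl sqr_ge0.
- by rewrite -!expr2 lerDr sqr_ge0.
Qed.

(** Induction that peels off one linear factor at a time, from a vanishing product, as
    Cayley-Hamilton provides, down to the empty product, which leaves the exponential itself. *)
Let flow_vanishes_all r : all (fun z => complex.Re z < 0) r ->
  factors r = 0 -> flow_vanishes [::].
Proof.
move=> rneg r0; have : flow_vanishes r.
  move=> i j; rewrite (_ : (fun _ => _) = cst 0); last first.
    by apply/funext => t; rewrite /flow r0 mul0mx mxE.
  split; first exact: cvg_cst.
  rewrite (_ : (fun _ => _) = cst 0); first exact: cvg_cst.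
  by apply/funext => t; rewrite /flow r0 mul0mx mxE.
elim: r rneg {r0} => [_|z r IH]; first exact.
by rewrite [all _ _]/= => /andP[z0 r0] /(flow_vanishes_behead z0)/(IH r0).
Qed.

(** The supremum in [tau] is an upper bound once the set is known to be bounded; the eigenvalues are
    among the finitely many roots of the characteristic polynomial. *)
Lemma eigenvalue_Re_le_tau z : eigenvalue (toC B) z -> complex.Re z <= tau B.
Proof.
move=> ez; apply: sup_upper_bound; last by exists z.
split; first by exists (complex.Re z); exists z.
have [r rE] := closed_field_poly_normal (char_poly (toC B)).
exists (\sum_(y <- r) `|complex.Re y|) => _ [y /= ey <-].
have : y \in r.
  move: ey; rewrite eigenvalue_root_char rE rootZ ?root_prod_XsubC//.
  by rewrite lead_coef_eq0 monic_neq0// char_poly_monic.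
move=> yr; apply: le_trans (ler_norm _) _.
by rewrite (big_rem y)//= lerDl sumr_ge0.
Qed.

Lemma expmx_vanishes : (0 < n)%N -> tau B < 0 -> E t @[t --> +oo] --> (0 : 'M[R]_n).
Proof.
move=> n0 tauB.
have [r rE] := closed_field_poly_normal (char_poly (toC B)).
have rmon : lead_coef (char_poly (toC B)) = 1 by exact/monicP/char_poly_monic.
rewrite rmon scale1r in rE.
have rneg : all (fun z => complex.Re z < 0) r.
  apply/allP => z zr; apply: le_lt_trans tauB; apply: eigenvalue_Re_le_tau.
  by rewrite eigenvalue_root_char rE root_prod_XsubC.
have facr : factors r = 0.
  move: rE; clear -n0; case: n n0 B => // m _ A rE.
  by rewrite linear_factorsE -rE Cayley_Hamilton.
apply/cvg_mxP => i j; rewrite mxE.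
have [+ _] := flow_vanishes_all rneg facr i j.
by rewrite /flow/=; under eq_fun do rewrite mul1mx mxE/=.
Qed.

End exponential_decay.

(** * Lebesgue measure on column vectors *)

Section borel_coordinates.
Context {R : realType}.

Lemma measurable_coord m n (i : 'I_m) (j : 'I_n) :
  measurable_fun setT (fun x : 'M[R]_(m, n) => x i j).
Proof.
apply: (measurability _ (RGenOInfty.measurableE R)) => //.
move=> _ [_ [c ->] <-]; rewrite setTI; apply: open_measurable_mx.
apply: open_comp; first by move=> x _; exact: coord_continuous.
by rewrite set_itvE; exact: open_gt.
Qed.

Context {d : measure_display} {T : measurableType d}.

Lemma measurable_cVP n (f : T -> 'cV[R]_n) : measurable_fun setT f <->
  forall i, measurable_fun setT (fun x => f x i ord0).
Proof.
split=> [mf i|mf].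
  exact: (measurableT_comp (@measurable_coord n 1 i ord0) mf).
pose g x : n.-tuple R := [tuple f x i ord0 | i < n].
have -> : f = @col_of_tuple R n \o g.
  apply/funext => x; apply/colP => i.
  by rewrite /= /col_of_tuple mxE tnth_mktuple.
apply: measurableT_comp; first exact: measurable_col_of_tuple.
apply/measurable_fun_tnthP => i.
by rewrite (_ : _ \o _ = fun x => f x i ord0)//; apply/funext => x/=; rewrite tnth_mktuple.
Qed.

Lemma measurable_fun_mulmx m n (f : T -> 'M[R]_(m, n)) (g : T -> 'cV[R]_n) :
  (forall i j, measurable_fun setT (fun x => f x i j)) -> measurable_fun setT g ->
  measurable_fun setT (fun x => f x *m g x).
Proof.
move=> mf /measurable_cVP mg; apply/measurable_cVP => i.
under eq_fun do rewrite mxE.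
by apply: measurable_sum => j; exact: measurable_funM.
Qed.

Lemma measurable_cVD n (f g : T -> 'cV[R]_n) :
  measurable_fun setT f -> measurable_fun setT g ->
  measurable_fun setT (fun x => f x + g x).
Proof.
move=> /measurable_cVP mf /measurable_cVP mg; apply/measurable_cVP => i.
by under eq_fun do rewrite mxE; exact: measurable_funD.
Qed.

Lemma measurable_cVN n (f : T -> 'cV[R]_n) :
  measurable_fun setT f -> measurable_fun setT (fun x => - f x).
Proof.
move=> /measurable_cVP mf; apply/measurable_cVP => i.
by under eq_fun do rewrite mxE; exact: measurable_funN.
Qed.

Lemma measurable_cVB n (f g : T -> 'cV[R]_n) :
  measurable_fun setT f -> measurable_fun setT g ->
  measurable_fun setT (fun x => f x - g x).
Proof. by move=> mf mg; apply: measurable_cVD => //; exact: measurable_cVN. Qed.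

Lemma measurable_fun_ip n (ip : {dot 'cV[R]_n for idfun}) (f g : T -> 'cV[R]_n) :
  measurable_fun setT f -> measurable_fun setT g ->
  measurable_fun setT (fun x => ip (f x) (g x)).
Proof.
move=> /measurable_cVP mf mg; under eq_fun do rewrite ip_gram -mulmxA mxE.
apply: measurable_sum => i; apply: measurable_funM.
  by under eq_fun do rewrite mxE; exact: mf.
have : measurable_fun setT (fun x => gram ip *m g x).
  by apply: measurable_fun_mulmx => // *; exact: measurable_cst.
by move/measurable_cVP; exact.
Qed.

End borel_coordinates.

Section borel_structure.
Context {R : realType} {n : nat}.
Local Notation V := 'cV[R]_n.

Lemma continuous_measurable_cV (f : V -> R) :
  continuous f -> measurable_fun setT f.
Proof.
move=> cf; apply: (measurability _ (RGenOInfty.measurableE R)) => //.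
move=> _ [_ [c ->] <-]; rewrite setTI; apply: open_measurable_mx.
by apply: open_comp => [x _|]; [exact: cf|rewrite set_itvE; exact: open_gt].
Qed.

Lemma measurable_norm_cV : measurable_fun setT (fun x : V => `|x|).
Proof. by apply: continuous_measurable_cV => x; exact: norm_continuous. Qed.

(* The identity from the sigma-algebra generated by G to the Borel sets is measurable
   as soon as its coordinates are. *)
Lemma borel_cV_generated (G : set (set V)) : G `<=` measurable ->
  (forall i c, <<s G >> [set x : V | c < x i ord0]) -> @measurable _ V = <<s G >>.
Proof.
move=> mG Gi; apply/seteqP; split; last first.
  by apply: smallest_sub => //; exact: sigma_algebra_measurable.
move=> A mA.
have mid : measurable_fun setT (id : g_sigma_algebraType G -> V).
  apply/measurable_cVP => i.
  apply: (measurability _ (RGenOInfty.measurableE R)) => //.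
  by move=> _ [_ [c ->] <-]; rewrite setTI set_itvE; exact: Gi.
by have := mid measurableT A mA; rewrite setTI.
Qed.

Definition box (a b : V) : set V :=
  [set x | forall i, a i ord0 <= x i ord0 <= b i ord0].

Lemma measurable_box a b : measurable (box a b).
Proof.
rewrite (_ : box a b = \bigcap_(i in [set: 'I_n])
    ((fun x : V => x i ord0) @^-1` `[a i ord0, b i ord0]%classic)).
  apply: fin_bigcap_measurable => // i _; rewrite -[X in measurable X]setTI.
  exact: measurable_coord.
by apply/seteqP; split=> x xab i; [move=> _|]; have := xab i; rewrite /= in_itv/=; auto.
Qed.

Lemma box_setI a b a' b' : box a b `&` box a' b' =
  box (\col_i Num.max (a i ord0) (a' i ord0)) (\col_i Num.min (b i ord0) (b' i ord0)).
Proof.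
apply/seteqP; split=> x.
  by move=> [h h'] i; rewrite !mxE ge_max le_min; case/andP: (h i) => -> ->; exact: h'.
move=> h; split=> i; have := h i; rewrite !mxE ge_max le_min => /andP[/andP[? ?] /andP[? ?]]; exact/andP.
Qed.

Lemma borel_cV_boxes : @measurable _ V = <<s [set A | exists a b, A = box a b] >>.
Proof.
apply: borel_cV_generated => [_ [a [b ->]]|i c]; first exact: measurable_box.
pose a k : V := \col_j if j == i then c + k.+1%:R^-1 else - k%:R.
pose b k : V := \col_j k%:R.
have -> : [set x : V | c < x i ord0] = \bigcup_k \bigcup_l (box (\col_j if j == i then c + k.+1%:R^-1 else - l%:R) (\col_j l%:R)).
  apply/seteqP; split=> [x /= cx|x [k _ [l _ /(_ i)]]]; last first.
    by rewrite !mxE eqxx => /andP[+ _]; apply: lt_le_trans; rewrite ltrDl invr_gt0.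
  have [k ck] : exists k : nat, (k.+1%:R^-1 : R) < x i ord0 - c.
    have e0 : 0 < x i ord0 - c by rewrite subr_gt0.
    by have [k _ /(_ k (leqnn _))] := near_infty_natSinv_lt (PosNum e0); exists k.
  exists k => //; exists (Num.bound `|x|) => // j; rewrite !mxE.
  have xj : `|x j ord0| <= (Num.bound `|x|)%:R.
    by apply: le_trans (coord_le_norm _ _ _) _; rewrite ltW// archi_boundP.
  move: xj; rewrite ler_norml => /andP[x1 x2]; rewrite x2 andbT.
  by case: eqP => [->|//]; rewrite -lerBrDl ltW.
apply: sigma_algebra_bigcup => k; apply: sigma_algebra_bigcup => l.
by apply: sub_gen_smallest; exists (\col_j if j == i then c + k.+1%:R^-1 else - l%:R), (\col_j l%:R).
Qed.

Lemma box_bounded (M : R) x : `|x| <= M -> box (const_mx (- M)) (const_mx M) x.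
Proof.
by move=> xM i; rewrite !mxE -ler_norml (le_trans (coord_le_norm _ _ _) xM).
Qed.

End borel_structure.

Section lebesgue_cV_theory.
Context {R : realType} {n : nat}.
Local Notation V := 'cV[R]_n.
Local Notation leb := (@lebesgue_cV R n).

Lemma lebesgue_box_lty (a b : V) : (leb (box a b) < +oo)%E.
Proof.
have [ab|/existsNP[i /negP abi]] := pselect (forall i, a i ord0 <= b i ord0).
  by rewrite /box lebesgue_cV_box// ltry.
rewrite (_ : box a b = set0) ?measure0//; apply/seteqP; split=> // x /(_ i).
by move=> /andP[/le_trans/[apply]]; exact/negP.
Qed.

Lemma lebesgue_bounded_lty (A : set V) (M : R) : measurable A ->
  (forall x, A x -> `|x| <= M) -> (leb A < +oo)%E.
Proof.
move=> mA AM; apply: le_lt_trans (lebesgue_box_lty (const_mx (- M)) (const_mx M)).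
apply: le_measure; rewrite ?inE//; first exact: measurable_box.
by move=> x /AM; exact: box_bounded.
Qed.

Lemma sigma_finite_lebesgue_cV : sigma_finite setT leb.
Proof.
exists (fun k => box (const_mx (- k%:R)) (const_mx k%:R)).
  apply/esym/seteqP; split=> // x _; exists (Num.bound `|x|) => //.
  by apply: box_bounded; rewrite ltW// archi_boundP.
by move=> k; split; [exact: measurable_box|exact: lebesgue_box_lty].
Qed.

HB.instance Definition _ := Measure_isSigmaFinite.Build _ _ _ leb
  sigma_finite_lebesgue_cV.

Lemma measurable_shift (v : V) : measurable_fun setT (fun x : V => x + v).
Proof. by apply: measurable_cVD; [exact: measurable_id|exact: measurable_cst]. Qed.

Lemma measurable_preimageT (f : V -> V) A :
  measurable_fun setT f -> measurable A -> measurable (f @^-1` A).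
Proof. by move=> mf mA; have := mf measurableT A mA; rewrite setTI. Qed.

Lemma lebesgue_shift (v : V) A : measurable A ->
  leb ((fun x => x + v) @^-1` A) = leb A.
Proof.
move=> mA; pose G := [set A : set V | exists a b, A = box a b].
apply/esym.
have mv := measurable_shift v.
apply: (measure_unique G (fun k => box (const_mx (- k%:R)) (const_mx k%:R)) borel_cV_boxes
  _ _ _ leb (pushforward leb (fun x => x + v))) => //.
- by move=> _ _ [a [b ->]] [a' [b' ->]]; rewrite box_setI; do 2 eexists.
- by move=> k; do 2 eexists.
- apply/seteqP; split=> // x _; exists (Num.bound `|x|) => //.
  by apply: box_bounded; rewrite ltW// archi_boundP.
- move=> _ [a [b ->]]; rewrite /pushforward.
  change (leb (box a b) = leb ((fun x => x + v) @^-1` box a b)).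
  have -> : (fun x => x + v) @^-1` box a b = box (a - v) (b - v).
    by apply/seteqP; split=> x h i; have := h i; rewrite !mxE lerBlDr lerBrDr.
  have [ab|nab] := pselect (forall i, a i ord0 <= b i ord0).
    rewrite /box !lebesgue_cV_box//; last by move=> i; rewrite !mxE lerD2r.
    by congr EFin; apply: eq_bigr => i _; rewrite !mxE; ring.
  have e (c c' : V) : ~ (forall i, c i ord0 <= c' i ord0) -> box c c' = set0.
    move=> /existsNP[i /negP ni]; apply/seteqP; split=> // x /(_ i).
    by move=> /andP[/le_trans/[apply]]; exact/negP.
  rewrite !e//; apply: contra_not nab => h i; have := h i.
  by rewrite !mxE lerD2r.
- by move=> k; exact: lebesgue_box_lty.
Qed.

End lebesgue_cV_theory.

Section lebesgue_cV_linear.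
Context {R : realType} {n : nat}.
Local Notation V := 'cV[R]_n.
Local Notation leb := (@lebesgue_cV R n).
Local Notation unit_box := (box (0 : V) (const_mx 1)).

Lemma lebesgue_unit_box : leb unit_box = 1%E.
Proof.
rewrite /box lebesgue_cV_box => [|i]; last by rewrite !mxE.
by rewrite big1// => i _; rewrite !mxE subr0.
Qed.

Lemma lebesgue_open_gt0 (A : set V) : open A -> A !=set0 -> (0 < leb A)%E.
Proof.
move=> oA [x Ax]; have /nbhs_ballP[e /= e0 eA] := open_nbhs_nbhs (conj oA Ax).
pose r := e / 2; have r0 : 0 < r by rewrite divr_gt0.
have sub : box (x - const_mx r) (x + const_mx r) `<=` A.
  move=> y xy; apply: eA; split=> // i j; have := xy i.
  rewrite (ord1 j) !mxE /ball/= ltr_norml => /andP[h1 h2].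
  have re : r < e by rewrite ltr_pdivrMr// ltr_pMr// ltr1n.
  by apply/andP; split; lra.
apply: (@lt_le_trans _ _ (leb (box (x - const_mx r) (x + const_mx r)))); last first.
  by apply: le_measure; rewrite ?inE//; [exact: measurable_box|exact: open_measurable_mx].
rewrite /box lebesgue_cV_box => [|i]; last by rewrite !mxE; have := r0; lra.
rewrite lte_fin; apply: prodr_gt0 => i _; rewrite !mxE.
by rewrite opprD addrACA subrr add0r opprK addr_gt0.
Qed.

Lemma measurable_mulmx_cst (M : 'M[R]_n) : measurable_fun setT (fun x : V => M *m x).
Proof.
by apply: measurable_fun_mulmx => [*|]; [exact: measurable_cst|exact: measurable_id].
Qed.

Lemma tonelli_sections d1 d2 (T1 : measurableType d1) (T2 : measurableType d2)
    (m1 : {sigma_finite_measure set T1 -> \bar R})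
    (m2 : {sigma_finite_measure set T2 -> \bar R}) (S : set (T1 * T2)) :
  measurable S -> (\int[m1]_x m2 (xsection S x) = \int[m2]_y m1 (ysection S y))%E.
Proof.
move=> mS; have := @indic_fubini_tonelli _ _ _ _ R m1 m2 S mS.
rewrite (_ : fubini_F _ _ = m2 \o xsection S).
  by rewrite (_ : fubini_G _ _ = m1 \o ysection S)//; exact: indic_fubini_tonelli_GE.
exact: indic_fubini_tonelli_FE.
Qed.

Lemma ge0_integral_cst_on d (T : measurableType d) (m : {measure set T -> \bar R})
    (A : set T) (c : \bar R) (f : T -> \bar R) : measurable A -> (0 <= c)%E ->
  (forall x, A x -> f x = c) -> (forall x, ~ A x -> f x = 0%E) ->
  (\int[m]_x f x = c * m A)%E.
Proof.
move=> mA c0 fA f0.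
rewrite (_ : f = (fun=> c) \_ A); first by rewrite -integral_mkcond integral_cst.
apply/funext => x; rewrite patchE.
by case: ifPn => [/set_mem/fA//|/negP xA]; apply: f0 => Ax; apply: xA; exact/mem_set.
Qed.

(* The uniqueness of the Haar measure, by Tonelli's theorem. *)
Let lebesgue_preimage_mulmx_eq (M : 'M[R]_n) A B : M \in unitmx ->
  measurable A -> measurable B ->
  (leb (mulmx M @^-1` A) * leb B = leb (fun x => B (- (M *m x))%R) * leb A)%E.
Proof.
move=> uM mA mB.
have mM := measurable_mulmx_cst M.
have mMN : measurable_fun setT (fun x : V => - (M *m x)) by exact: measurable_cVN.
have m1 : measurable_fun setT (fun z : V * V => z.1) by exact: measurable_fst.
have m2 : measurable_fun setT (fun z : V * V => z.2) by exact: measurable_snd.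
have pre (f : V * V -> V) D : measurable_fun setT f -> measurable D -> measurable (f @^-1` D).
  by move=> mf mD; have := mf measurableT D mD; rewrite setTI.
(* The sections of [S] at fixed second coordinate give the left-hand side. Translating each section
   at fixed first coordinate [x] by [M *m x] turns [S] into [S'], whose sections at fixed second
   coordinate give the right-hand side. *)
pose S := (fun z : V * V => M *m z.1 + z.2) @^-1` A `&` snd @^-1` B.
have mS : measurable S.
  apply: measurableI; last exact: pre.
  by apply: pre => //; apply: measurable_cVD => //; exact: (measurableT_comp mM).
pose S' := snd @^-1` A `&` (fun z : V * V => z.2 - M *m z.1) @^-1` B.
have mS' : measurable S'.
  apply: measurableI; first exact: pre.
  by apply: pre => //; apply: measurable_cVB => //; exact: (measurableT_comp mM).
transitivity (\int[leb]_y leb (ysection S y))%E.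
  rewrite (@ge0_integral_cst_on _ _ _ B (leb (mulmx M @^-1` A)))// => y.
    move=> By; rewrite -(@lebesgue_shift R n (invmx M *m y) (mulmx M @^-1` A)).
      congr (leb _); apply/seteqP; split=> x.
        by rewrite /ysection/= inE => -[/= + _]; rewrite mulmxDr mulmxA mulmxV// mul1mx.
      by rewrite /= mulmxDr mulmxA mulmxV// mul1mx => h; rewrite /ysection/= inE; split.
    exact: measurable_preimageT.
  move=> nBy; rewrite (_ : ysection S y = set0) ?measure0//.
  by apply/seteqP; split=> // x; rewrite /ysection/= inE => -[].
rewrite -tonelli_sections//.
transitivity (\int[leb]_x leb (xsection S' x))%E.
  apply: eq_integral => x _.
  rewrite -(@lebesgue_shift R n (M *m x) (xsection S' x)); last exact: measurable_xsection.
  congr (leb _); apply/seteqP; split=> y; rewrite /xsection/= !inE/= => -[].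
    by rewrite /= addrC => h1 h2; split => //=; rewrite addrK.
  by rewrite /= addrK addrC.
rewrite tonelli_sections//.
rewrite (@ge0_integral_cst_on _ _ _ A (leb (fun x => B (- (M *m x))%R)))// => y.
  move=> Ay; rewrite -(@lebesgue_shift R n (- (invmx M *m y)) (fun x => B (- (M *m x))%R)).
    congr (leb _); apply/seteqP; split=> x; rewrite /ysection/= inE/=.
      by rewrite mulmxBr mulmxA mulmxV// mul1mx opprB => -[].
    by rewrite mulmxBr mulmxA mulmxV// mul1mx opprB.
  exact: (measurable_preimageT mMN).
move=> nAy; rewrite (_ : ysection S' y = set0) ?measure0//.
by apply/seteqP; split=> // x; rewrite /ysection/= inE => -[].
Qed.

(** Taking the unit box as second set in the previous identity isolates the constant [leb D]. It is
    finite because [D] is bounded, and nonzero because the preimage under [M] of the preimage under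
    [invmx M] of the unit box has measure 1. *)
Lemma lebesgue_preimage_mulmx (M : 'M[R]_n) : M \in unitmx ->
  exists2 c : R, 0 < c & forall A, measurable A ->
    leb (mulmx M @^-1` A) = (c%:E * leb A)%E.
Proof.
move=> uM.
pose D : set V := fun x => unit_box (- (M *m x)).
have mD : measurable D.
  by apply: (measurable_preimageT (f := fun x : V => - (M *m x)));
    [apply: measurable_cVN; exact: measurable_mulmx_cst|exact: measurable_box].
have key A : measurable A -> leb (mulmx M @^-1` A) = (leb D * leb A)%E.
  move=> mA; rewrite -[LHS]mule1 -lebesgue_unit_box.
  by apply: lebesgue_preimage_mulmx_eq => //; exact: measurable_box.
have Doo : (leb D < +oo)%E.
  apply: (@lebesgue_bounded_lty R n D (n%:R * `|invmx M|)) => // x Dx.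
  rewrite -[x]mul1mx -(mulVmx uM) -mulmxA -[leRHS]mulr1.
  apply: le_trans (norm_mulmx _ _) _; apply: ler_wpM2l; first by rewrite mulr_ge0.
  apply: mx_norm_le => // i j; have := Dx i; rewrite !mxE (ord1 j) => /andP[h0 h1].
  by rewrite -normrN ger0_norm.
have D0 : leb D != 0%E.
  apply/eqP => D0.
  have mU : measurable (mulmx (invmx M) @^-1` unit_box).
    by apply: measurable_preimageT; [exact: measurable_mulmx_cst|exact: measurable_box].
  have := key _ mU; rewrite D0 mul0e.
  rewrite (_ : mulmx M @^-1` _ = unit_box); first by rewrite lebesgue_unit_box => /eqP; rewrite onee_eq0.
  by apply/seteqP; split=> x /=; rewrite mulmxA mulVmx// mul1mx.
exists (fine (leb D)) => [|A mA].
  by rewrite fine_gt0// Doo lt0e D0 measure_ge0.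
by rewrite key// fineK// ge0_fin_numE.
Qed.

End lebesgue_cV_linear.

Lemma measurable_halfspace (R : realType) n (i : 'I_n) (c : R) :
  measurable [set x : 'cV[R]_n | c < x i ord0].
Proof.
have := @measurable_coord R n 1 i ord0 measurableT _ (measurable_itv `]c, +oo[).
by rewrite setTI set_itvE.
Qed.

(** * Steinhaus' theorem: a set of positive measure meets its small translates *)

Section steinhaus.
Context {R : realType} {n : nat}.
Local Notation V := 'cV[R]_n.
Local Notation leb := (@lebesgue_cV R n).
Let cube k : set V := box (const_mx (- k%:R)) (const_mx k%:R).
(** The symmetric difference of [E] and its translate by [v]. *)
Let shift_diff (E : set V) v : set V := [set x | ~ (E x <-> E (x - v))].

Let measurable_shift_diff E v : measurable E -> measurable (shift_diff E v).
Proof.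
move=> mE.
have mEv : measurable ((fun x => x - v) @^-1` E).
  by apply: measurable_preimageT => //; exact: measurable_shift.
rewrite (_ : shift_diff E v = (E `\` (fun x => x - v) @^-1` E) `|`
    ((fun x => x - v) @^-1` E `\` E)).
  by apply: measurableU; exact: measurableD.
apply/seteqP; split=> x /=.
  move=> h; have [Ex|nEx] := pselect (E x); have [Ev|nEv] := pselect (E (x - v)).
  - by exfalso; apply: h; split.
  - by left.
  - by right.
  - by exfalso; apply: h; split.
by move=> [[Ex nE]|[Ex nE]] h; apply: nE; apply/h.
Qed.

(** Continuity of translation in measure at 0. The cubes make the notion meaningful for sets of
    infinite measure, so that it is stable under complements. *)
Let shift_continuous (E : set V) := forall k (e : R), 0 < e -> exists2 d : R, 0 < d &
  forall v, `|v| < d -> (leb (cube k `&` shift_diff E v) <= e%:E)%E.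

Let mcube k : measurable (cube k). Proof. exact: measurable_box. Qed.

Let shift_continuousC E : shift_continuous E -> shift_continuous (~` E).
Proof.
move=> cE k e e0; have [d d0 dE] := cE k e e0; exists d => // v /dE.
rewrite (_ : shift_diff (~` E) v = shift_diff E v)//; apply/seteqP; split=> x /= h h'; apply: h.
  by split; apply: contra_not => /h'.
by have [h1 h2] := h'; split=> Ex; apply: contrapT => /h2 || apply: contrapT => /h1; exact.
Qed.

Let shift_continuousI E F : measurable E -> measurable F ->
  shift_continuous E -> shift_continuous F -> shift_continuous (E `&` F).
Proof.
move=> mE mF cE cF k e e0.
have e20 : 0 < e / 2 by rewrite divr_gt0.
have [d d0 dE] := cE k _ e20; have [d' d'0 dF] := cF k _ e20.
exists (Num.min d d'); first by rewrite lt_min d0.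
move=> v; rewrite lt_min => /andP[/dE vE /dF vF].
apply: (@le_trans _ _ (leb (cube k `&` shift_diff E v `|` cube k `&` shift_diff F v))).
  apply: le_measure; rewrite ?inE.
  - by apply: measurableI => //; apply: measurable_shift_diff; exact: measurableI.
  - by apply: measurableU; apply: measurableI => //; exact: measurable_shift_diff.
  - rewrite -setIUr; apply: setIS => x /= h; apply: contrapT => /not_orP[].
    by move=> /contrapT hE /contrapT hF; apply: h; split=> -[/hE ? /hF ?].
apply: le_trans (measureU2 _ _ _) _; try by apply: measurableI => //; exact: measurable_shift_diff.
by rewrite (splitr e) EFinD leeD.
Qed.

(** Finite unions follow from complements and intersections. The tail [T N] has small measure in a
    cube, and it enters the estimate twice: as it stands and translated. *)
Let shift_continuous_bigcup (F : (set V)^nat) : (forall i, measurable (F i)) ->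
  (forall i, shift_continuous (F i)) -> shift_continuous (\bigcup_i F i).
Proof.
move=> mF cF k e e0.
pose U N := \big[setU/set0]_(i < N) F i.
have mU N : measurable (U N) by apply: bigsetU_measurable.
have cU N : shift_continuous (U N).
  elim: N => [|N IH].
    rewrite /U big_ord0 => j r r0; exists 1 => // v _.
    rewrite (_ : shift_diff set0 v = set0) ?setI0 ?measure0 ?lee_fin ?ltW//.
    by apply/seteqP; split=> // x; apply.
  rewrite /U big_ord_recr/= -[X in shift_continuous X]setCK setCU.
  apply: shift_continuousC; apply: shift_continuousI.
  - by apply: measurableC; exact: mU.
  - by apply: measurableC; exact: mF.
  - exact: shift_continuousC.
  - by apply: shift_continuousC; exact: cF.
pose T N := \bigcup_i F i `\` U N.
have mT N : measurable (T N) by apply: measurableD => //; exact: bigcup_measurable.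
have UU N x : U N x <-> exists2 i, (i < N)%N & F i x.
  rewrite /U -(bigcup_mkord N F); split; first by move=> [i /= iN Fx]; exists i.
  by move=> [i iN Fx]; exists i.
have T0 : leb (cube k.+1 `&` T N) @[N --> \oo] --> 0%E.
  have := @nonincreasing_cvg_mu _ _ R leb (fun N => cube k.+1 `&` T N).
  rewrite (_ : \bigcap_N _ = set0); last first.
    apply/seteqP; split=> // x h; have [_ [[i _ Fx] _]] := h 0%N I.
    by have [_ [_]] := h i.+1 I; apply; apply/UU; exists i.
  rewrite measure0; apply => //.
  - apply: le_lt_trans (lebesgue_box_lty (const_mx (- k.+1%:R)) (const_mx k.+1%:R)).
    by apply: le_measure; rewrite ?inE//; [exact: measurableI|exact: mcube].
  - by move=> i; exact: measurableI.
  - move=> N M NM; apply/subsetPset; apply: setIS => x [Fx nU]; split=> // /UU[i iN Fi].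
    by apply: nU; apply/UU; exists i => //; exact: leq_trans iN NM.
have e40 : (0 < (e / 4)%:E)%E by rewrite lte_fin divr_gt0.
have [N TN] : exists N, (leb (cube k.+1 `&` T N) <= (e / 4)%:E)%E.
  have nb : nbhs (0 : \bar R)%E [set y | (y < (e / 4)%:E)%E].
    exact: (@open_ereal_lt' R 0%E _ e40).
  by have [N _ /(_ N (leqnn _)) /= h] := T0 _ nb; exists N; exact: ltW.
have e20 : 0 < e / 2 by rewrite divr_gt0.
have [d d0 dU] := cU N k _ e20.
(* A shift shorter than 1 keeps the translates of points of [cube k] inside [cube k.+1], where the
   tail was made small. *)
exists (Num.min d 1); first by rewrite lt_min d0 ltr01.
move=> v; rewrite lt_min => /andP[/dU vU v1].
pose T' := (fun x => x - v) @^-1` T N.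
have mT' : measurable T' by apply: measurable_preimageT => //; exact: measurable_shift.
have cubeS x : cube k x -> cube k.+1 x.
  by move=> h i; have := h i; rewrite !mxE -natr1 => /andP[? ?]; apply/andP; split; lra.
apply: (@le_trans _ _ (leb (cube k `&` shift_diff (U N) v `|` (cube k.+1 `&` T N `|` cube k `&` T')))).
  apply: le_measure; rewrite ?inE.
  - by apply: measurableI => //; apply: measurable_shift_diff; exact: bigcup_measurable.
  - by apply: measurableU; [|apply: measurableU]; apply: measurableI => //; exact: measurable_shift_diff.
  - move=> x [kx h].
    have [Tx|nTx] := pselect (T N x); first by right; left; split => //; exact: cubeS.
    have [Tv|nTv] := pselect (T N (x - v)); first by right; right.
    left; split=> // h'; apply: h.
    have E y : ~ T N y -> (\bigcup_i F i) y <-> U N y.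
      move=> nT; split=> [Fy|/UU[i _ Fy]]; last by exists i.
      by apply: contrapT => nU; apply: nT.
    by rewrite (E x nTx) (E _ nTv).
apply: le_trans (measureU2 _ _ _) _.
- by apply: measurableI => //; exact: measurable_shift_diff.
- by apply: measurableU; exact: measurableI.
rewrite (_ : e = e / 2 + (e / 4 + e / 4)); last by field.
rewrite 2!EFinD leeD//.
apply: le_trans (measureU2 _ _ _) _; try exact: measurableI.
apply: leeD => //.
apply: le_trans TN.
rewrite -(@lebesgue_shift R n (- v) (cube k.+1 `&` T N)); last exact: measurableI.
apply: le_measure; rewrite ?inE; first exact: measurableI.
  by apply: measurable_preimageT; [exact: measurable_shift|exact: measurableI].
move=> x [kx Tx]; split=> // i; have := kx i; rewrite !mxE -natr1 => /andP[? ?].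
have := coord_le_norm v i ord0; move: v1; rewrite ler_norml => v1 /andP[? ?].
by apply/andP; split; lra.
Qed.

Let shift_continuous_halfspace i c : shift_continuous [set x | c < x i ord0].
Proof.
move=> k e e0.
pose p := \prod_(j < n | j != i) (k%:R + k%:R : R).
have p0 : 0 <= p by apply: prodr_ge0 => j _; rewrite addr_ge0.
(* Inside the cube the symmetric difference lies in a slab of width [2 * d] and cross-section [p],
   whose volume is then at most [e]. *)
pose d := e / (2 * (p + 1)).
have d0 : 0 < d by rewrite divr_gt0// mulr_gt0// ltr_wpDl.
exists d => // v vd.
pose a : V := \col_j if j == i then c - d else - k%:R.
pose b : V := \col_j if j == i then c + d else k%:R.
apply: (@le_trans _ _ (leb (box a b))).
  apply: le_measure; rewrite ?inE.
  - apply: measurableI => //; apply: measurable_shift_diff.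
    exact: measurable_halfspace.
  - exact: measurable_box.
  - move=> x [kx /= h] j; rewrite !mxE; case: eqP => [->|_]; last by have := kx j; rewrite !mxE.
    have := le_lt_trans (coord_le_norm v i ord0) vd; rewrite ltr_norml => /andP[v1 v2].
    apply: contrapT => /negP; rewrite negb_and -!ltNge => /orP[xc|xc]; apply: h; rewrite !mxE; split; lra.
rewrite lebesgue_cV_box => [|j]; last first.
  by rewrite !mxE; case: eqP => _; [lra|have := ler0n R k; lra].
rewrite lee_fin (bigD1 i)//= !mxE eqxx (eq_bigr (fun=> k%:R + k%:R)) => [|j ji]; last first.
  by rewrite !mxE (negbTE ji) opprK.
rewrite -/p (_ : c + d - (c - d) = 2 * d); last by ring.
rewrite /d; set q := 2 * (p + 1); have q0 : 0 < q by rewrite mulr_gt0// ltr_wpDl.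
rewrite (_ : 2 * (e / q) * p = e * (2 * p / q)); last by ring.
by rewrite ler_piMr ?(ltW e0)// ler_pdivrMr// mul1r /q; lra.
Qed.

Let shift_continuous_measurable E : measurable E -> shift_continuous E.
Proof.
pose G := [set A : set V | measurable A /\ shift_continuous A].
have GE : @measurable _ V = <<s G >>.
  apply: borel_cV_generated => [A []//|i c]; apply: sub_gen_smallest.
  by split; [exact: measurable_halfspace|exact: shift_continuous_halfspace].
rewrite GE; apply: (dynkin_induction GE).
- by move=> A F [mA cA] [mF cF]; split; [exact: measurableI|exact: shift_continuousI].
- move=> k e e0; exists 1 => // v _; rewrite (_ : shift_diff setT v = set0).
    by rewrite setI0 measure0 lee_fin ltW.
  by apply/seteqP; split=> // x; apply.
- by move=> A [].
- by move=> A _; exact: shift_continuousC.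
- by move=> F mF _; exact: shift_continuous_bigcup.
Qed.

(** [W] is covered by its intersection with the translate and by the symmetric difference, and for
    small shifts the latter has at most half of the measure of [W]. *)
Lemma lebesgue_setI_shift (W : set V) (M : R) : measurable W ->
  (forall x, W x -> `|x| <= M) -> (0 < leb W)%E ->
  exists2 d : R, 0 < d & exists2 c : R, 0 < c & forall v, `|v| < d ->
    (c%:E <= leb (W `&` (fun x => (x - v)%R) @^-1` W))%E.
Proof.
move=> mW WM W0.
have Woo := lebesgue_bounded_lty mW WM.
have Wfin : leb W = (fine (leb W))%:E by rewrite fineK// ge0_fin_numE.
pose w := fine (leb W); have w0 : 0 < w by rewrite fine_gt0// W0.
have [d d0 dW] := shift_continuous_measurable mW (Num.bound M) (divr_gt0 w0 (ltr0n _ 2)).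
exists d => //; exists (w / 2); first by rewrite divr_gt0.
move=> v /dW h.
have mWv : measurable ((fun x => x - v) @^-1` W).
  by apply: measurable_preimageT => //; exact: measurable_shift.
have : (leb W <= leb (W `&` (fun x => (x - v)%R) @^-1` W) + (w / 2)%:E)%E.
  apply: (@le_trans _ _ (leb ((W `&` (fun x => x - v) @^-1` W) `|`
      (cube (Num.bound M) `&` shift_diff W v)))).
    apply: le_measure; rewrite ?inE//.
      apply: measurableU; apply: measurableI => //; exact: measurable_shift_diff.
    move=> x Wx; have [Wv|nWv] := pselect (W (x - v)); [by left|right]; split.
      apply: box_bounded; apply: le_trans (WM _ Wx) _; rewrite ltW// archi_boundP//.
      exact: le_trans (WM _ Wx).
    by move=> h'; apply: nWv; apply/h'.
  apply: le_trans (measureU2 _ _ _) _.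
  - exact: measurableI.
  - by apply: measurableI => //; exact: measurable_shift_diff.
  - exact: leeD.
rewrite Wfin -/w -leeBlDr// -EFinB (_ : w - w / 2 = w / 2)//; by field.
Qed.

End steinhaus.

(** * A monotone class of Laplace transforms *)

Section laplace_class.
Context {R : realType} {n : nat}.
Local Notation V := 'cV[R]_n.
Context (ip : {dot V for idfun}) (K : set V) (hK : generating_proper_cone K).

(** The cut-off by [K] makes the exponential bounded on the whole space when [u] is in the dual
    cone. *)
Definition cone_exp (u x : V) : R := \1_K x * expR (- ip u x).

Inductive exp_algebra : (V -> R) -> Prop :=
| exp_algebra_exp u : dual_cone ip K u -> exp_algebra (cone_exp u)
| exp_algebra_lin (a b : R) f g : exp_algebra f -> exp_algebra g ->
    exp_algebra (fun x => a * f x + b * g x).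

Lemma cone_expD u v x : cone_exp u x * cone_exp v x = cone_exp (u + v) x.
Proof.
rewrite /cone_exp mulrACA -expRD -opprD linearDl indicE.
by case: (x \in K) => /=; rewrite ?mulr0 ?mul0r// !mul1r.
Qed.

Lemma cone_exp0 x : cone_exp 0 x = \1_K x.
Proof. by rewrite /cone_exp linear0l oppr0 expR0 mulr1. Qed.

Lemma exp_algebraM f g : exp_algebra f -> exp_algebra g ->
  exp_algebra (fun x => f x * g x).
Proof.
move=> af; elim: af g => {f} [u Ku|a b f1 f2 _ IH1 _ IH2] g ag.
  elim: ag => {g} [v Kv|a b g1 g2 _ IH1 _ IH2].
    rewrite (_ : (fun _ => _) = cone_exp (u + v)); first by apply/exp_algebra_exp/dual_coneD.
    by apply/funext => x; rewrite cone_expD.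
  rewrite (_ : (fun _ => _) = fun x => a * (cone_exp u x * g1 x) + b * (cone_exp u x * g2 x)).
    exact: exp_algebra_lin.
  by apply/funext => x; ring.
rewrite (_ : (fun _ => _) = fun x => a * (f1 x * g x) + b * (f2 x * g x)).
  by apply: exp_algebra_lin; [exact: IH1|exact: IH2].
by apply/funext => x; ring.
Qed.

Lemma exp_algebra_bounded f : exp_algebra f -> exists C, forall x, `|f x| <= C.
Proof.
elim=> {f} [u Ku|a b f g _ [C fC] _ [C' gC']].
  exists 1 => x; rewrite /cone_exp indicE; case: (boolP (x \in K)) => [/set_mem/Ku ux|_].
    by rewrite mul1r ger0_norm ?expR_ge0// -expR0 ler_expR oppr_le0.
  by rewrite mul0r normr0.
exists (`|a| * C + `|b| * C') => x; apply: le_trans (ler_normD _ _) _.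
by rewrite !normrM lerD// ler_wpM2l.
Qed.

Context (D : (V -> R) -> Prop).
Hypothesis D_exp : forall u, dual_cone ip K u -> D (cone_exp u).
Hypothesis D_lin : forall (a b : R) f g, D f -> D g -> D (fun x => a * f x + b * g x).
Hypothesis D_lim : forall (f_ : nat -> V -> R) f (M : R), (forall k, D (f_ k)) ->
  (forall k x, `|f_ k x| <= M) -> (forall x, f_ k x @[k --> \oo] --> f x) -> D f.

Lemma exp_algebra_class f : exp_algebra f -> D f.
Proof. by elim=> [u /D_exp//|a b g h _ Dg _ Dh]; exact: D_lin. Qed.

(** The Taylor polynomials of the exponential at [- S] stay in the algebra, because it is closed
    under products, and they are bounded by [expR C] when [|S|] is bounded by [C]. *)
Let class_expR S : exp_algebra S -> D (fun x => \1_K x * expR (- S x)).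
Proof.
move=> aS; have [C SC] := exp_algebra_bounded aS.
pose T (J : nat) x : R := \1_K x * series (exp_coeff (- S x)) J.
have powS j : exp_algebra (fun x => \1_K x * S x ^+ j).
  elim: j => [|j IH].
    rewrite (_ : (fun _ => _) = cone_exp 0); first by apply/exp_algebra_exp/dual_cone0.
    by apply/funext => x; rewrite cone_exp0 expr0 mulr1.
  rewrite (_ : (fun _ => _) = fun x => (\1_K x * S x ^+ j) * S x); first exact: exp_algebraM.
  by apply/funext => x; rewrite exprSr mulrA.
have aT J : exp_algebra (T J).
  elim: J => [|J IH].
    rewrite (_ : T 0%N = fun x => 0 * cone_exp 0 x + 0 * cone_exp 0 x).
      by apply: exp_algebra_lin; apply/exp_algebra_exp/dual_cone0.
    by apply/funext => x; rewrite /T /series/= big_geq// mulr0; ring.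
  rewrite (_ : T J.+1 = fun x => 1 * T J x + ((-1) ^+ J / J`!%:R) * (\1_K x * S x ^+ J)).
    exact: exp_algebra_lin.
  apply/funext => x; rewrite /T /series/= big_nat_recr//= mulrDr mul1r; congr (_ + _).
  rewrite /exp_coeff/= (exprNn (S x)).
  by move: ((-1) ^+ J) (S x ^+ J) (J`!%:R^-1) (\1_K x) => p q r t; ring.
apply: (@D_lim T _ (expR C)).
- by move=> k; exact: exp_algebra_class.
- move=> k x; rewrite /T indicE; case: (x \in K); last by rewrite mul0r normr0 expR_ge0.
  rewrite mul1r /series/=; apply: le_trans (ler_norm_sum _ _ _) _.
  apply: (@le_trans _ _ (series (exp_coeff C) k)).
    apply: ler_sum => i _; rewrite /exp_coeff/= normrM normrX normrN normfV normr_nat.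
    by rewrite ler_wpM2r ?invr_ge0// lerXn2r ?nnegrE// (le_trans _ (SC x)).
  have C0 : 0 <= C by exact: le_trans (SC x).
  apply: nondecreasing_cvgn_le; last exact: is_cvg_series_exp_coeff.
  by apply: nondecreasing_series => i _ _; exact: exp_coeff_ge0.
- move=> x; apply: cvgM; first exact: cvg_cst.
  exact: is_cvg_series_exp_coeff.
Qed.

Definition dual_halfspaces (l : seq (V * R)) : set V :=
  [set x | forall q, q \in l -> q.2 < ip q.1 x].

Let dual_seq (l : seq (V * R)) := forall q, q \in l -> dual_cone ip K q.1.

(** At a point of [K], a term tends to 0 as N grows if the strict inequality of its half-space
    holds, and is at least N otherwise; the factor N in front settles the case of equality. So
    [expR (- gauge l N x)] tends to the indicator of the intersection of the half-spaces. *)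
Let gauge (l : seq (V * R)) (N : nat) (x : V) : R :=
  \sum_(q <- l) N%:R * expR (N%:R * q.2) * cone_exp (N%:R *: q.1) x.

Let exp_algebra_gauge l N : dual_seq l -> exp_algebra (gauge l N).
Proof.
elim: l => [|q l IH] lK.
  rewrite (_ : gauge _ _ = fun x => 0 * cone_exp 0 x + 0 * cone_exp 0 x).
    by apply: exp_algebra_lin; apply/exp_algebra_exp/dual_cone0.
  by apply/funext => x; rewrite /gauge big_nil; ring.
rewrite (_ : gauge _ _ = fun x => N%:R * expR (N%:R * q.2) * cone_exp (N%:R *: q.1) x + 1 * gauge l N x).
  apply: exp_algebra_lin; last by apply: IH => r rl; apply: lK; rewrite inE rl orbT.
  by apply/exp_algebra_exp/dual_coneZ => //; apply: lK; rewrite inE eqxx.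
by apply/funext => x; rewrite /gauge big_cons mul1r.
Qed.

Let gauge_term (q : V * R) N x : K x ->
  N%:R * expR (N%:R * q.2) * cone_exp (N%:R *: q.1) x = N%:R * expR (- (N%:R * (ip q.1 x - q.2))).
Proof.
move=> Kx; rewrite /cone_exp indicE mem_set// mul1r -mulrA -expRD linearZl_LR/=.
by congr (_ * expR _); rewrite /GRing.scale/=; ring.
Qed.

Let cvg_natexp (a : R) : 0 < a -> (N%:R * expR (- (N%:R * a))) @[N --> \oo] --> 0.
Proof.
move=> a0; apply/cvgrPdist_le => e e0.
near=> N.
have N0 : (0 : R) < N%:R by rewrite ltr0n; near: N; exact: nbhs_infty_gt.
rewrite sub0r normrN ger0_norm ?mulr_ge0 ?expR_ge0//.
rewrite expRN ler_pdivrMr ?expR_gt0//.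
have Na : 0 <= N%:R * a by rewrite mulr_ge0// ltW.
have h : (N%:R * a) ^+ 2 / 2 <= expR (N%:R * a).
  have := @expR_ge1Dxn _ (N%:R * a) 1%N Na.
  by rewrite (_ : 2`! = 2%N)//; lra.
have big : 2 / (e * a ^+ 2) <= N%:R.
  by near: N; apply: nbhs_infty_ger.
rewrite ler_pdivrMr ?mulr_gt0 ?exprn_gt0// in big.
apply: le_trans (ler_wpM2l (ltW e0) h).
have -> : e * ((N%:R * a) ^+ 2 / 2) = N%:R * (N%:R * (e * a ^+ 2) / 2) by field.
by rewrite ler_peMr// ler_pdivlMr// mul1r.
Unshelve. all: by end_near. Qed.

Let class_dual_halfspaces l : dual_seq l -> D (\1_(dual_halfspaces l `&` K)).
Proof.
move=> lK; apply: (@D_lim (fun N x => \1_K x * expR (- gauge l N x)) _ 1).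
- by move=> N; apply/class_expR/exp_algebra_gauge.
- move=> N x; rewrite indicE; case: (boolP (x \in K)) => [/set_mem Kx|_]; last by rewrite mul0r normr0.
  rewrite mul1r ger0_norm ?expR_ge0// -expR0 ler_expR oppr_le0.
  by apply: sumr_ge0 => q _; rewrite gauge_term// mulr_ge0// expR_ge0.
move=> x; have [Kx|nKx] := pselect (K x); last first.
  rewrite (_ : (fun _ => _) = cst 0); last by apply/funext => N; rewrite indicE memNset// mul0r.
  have -> : (\1_(dual_halfspaces l `&` K) x : R) = 0 by rewrite indicE memNset// => -[].
  exact: cvg_cst.
have [lx|nlx] := pselect (dual_halfspaces l x).
  have -> : (\1_(dual_halfspaces l `&` K) x : R) = \1_K x * expR (- 0).
    by rewrite !indicE !mem_set// oppr0 expR0 mulr1.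
  apply: cvgM; first exact: cvg_cst.
  apply: (@cvg_comp _ _ _ (fun N => - gauge l N x) expR \oo _ _ _ (@continuous_expR R _)).
  apply: cvgN; rewrite /gauge; elim: l lx {lK} => [|q l IH] lx.
    by under eq_fun do rewrite big_nil; exact: cvg_cst.
  under eq_fun do rewrite big_cons gauge_term//.
  have h1 : 0 < ip q.1 x - q.2 by rewrite subr_gt0; apply: lx; rewrite inE eqxx.
  have h2 : dual_halfspaces l x by move=> r rl; apply: lx; rewrite inE rl orbT.
  by have := cvgD (cvg_natexp h1) (IH h2); rewrite addr0; exact.
have -> : (\1_(dual_halfspaces l `&` K) x : R) = 0 by rewrite indicE memNset// => -[].
have /existsNP[q /not_implyP[ql /negP]] := nlx; rewrite -leNgt => qx.
have lower N : N%:R <= gauge l N x.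
  rewrite /gauge (big_rem q)//= gauge_term// ler_wpDr//.
    by apply: sumr_ge0 => r _; rewrite gauge_term// mulr_ge0// expR_ge0.
  by rewrite ler_peMr// -expR0 ler_expR oppr_ge0 mulr_ge0_le0// subr_le0.
apply: (@squeeze_cvgr _ _ _ _ (cst 0) (fun N => expR (- N%:R)) _ _ _ (cvg_cst _) (@cvgn_expR R)).
apply: nearW => N; rewrite indicE mem_set// mul1r expR_ge0/= ler_expR lerN2.
exact: lower.
Qed.

Let G : set (set V) := [set A | exists2 l, dual_seq l & A = dual_halfspaces l].

Let measurable_dual_halfspaces l : measurable (dual_halfspaces l).
Proof.
rewrite (_ : dual_halfspaces l = \bigcap_(q in [set` l]) [set x | q.2 < ip q.1 x]).
  apply: fin_bigcap_measurable => [|q _]; first exact: finite_seq.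
  have mq : measurable_fun setT (fun x : V => ip q.1 x).
    by apply: measurable_fun_ip; [exact: measurable_cst|exact: measurable_id].
  have := mq measurableT _ (measurable_itv `]q.2, +oo[).
  by rewrite setTI set_itvE.
by apply/seteqP; split=> x h q ql; exact: h.
Qed.

(** Every linear form is a difference of two elements of the dual cone, so the half-spaces given by
    that cone already make the coordinates measurable. *)
Let borel_dual_halfspaces : @measurable _ V = <<s G >>.
Proof.
apply: borel_cV_generated => [_ [l _ ->]//|i c].
have mu u : dual_cone ip K u ->
    measurable_fun (setT : set (g_sigma_algebraType G)) (fun x : g_sigma_algebraType G => ip u (x : V)).
  move=> Ku; apply: (measurability _ (RGenOInfty.measurableE R)) => //.
  move=> _ [_ [a ->] <-]; rewrite setTI set_itvE; apply: sub_gen_smallest.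
  exists [:: (u, a)]; first by move=> q; rewrite inE => /eqP ->.
  by apply/seteqP; split=> x /=; [move=> xa q; rewrite inE => /eqP ->|move=> /(_ (u, a)); rewrite inE eqxx; apply].
(* The vector that represents the i-th coordinate with respect to [ip]. *)
pose w : V := (delta_mx 0 i *m invmx (gram ip))^T.
have wx x : ip w x = x i ord0.
  by rewrite ip_gram trmxK -[_ *m gram ip]mulmxA mulVmx ?gram_unit// mulmx1 -rowE mxE.
have [u [u' [Ku Ku' wE]]] := dual_cone_generating ip hK w.
have := measurable_funB (mu u Ku) (mu u' Ku').
move=> /(_ measurableT _ (measurable_itv `]c, +oo[)); rewrite setTI set_itvE.
congr (<<s G >> _); apply/seteqP; split=> x /=; by rewrite -wx wE linearBl.
Qed.

(** Finite intersections of half-spaces form a pi-system that generates the Borel sets, so Dynkin's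
    theorem applies: complements come from subtraction from the indicator of [K], disjoint unions
    from bounded limits. *)
Lemma laplace_class_indic : forall A, measurable A -> D (\1_(A `&` K)).
Proof.
have D1K : D (\1_K).
  rewrite (_ : \1_K = cone_exp 0); first by apply/D_exp/dual_cone0.
  by apply/funext => x; rewrite cone_exp0.
rewrite borel_dual_halfspaces; apply: (@dynkin_induction _ V G (fun A => D (\1_(A `&` K))) borel_dual_halfspaces).
- move=> _ _ [l lK ->] [l' l'K ->]; exists (l ++ l').
    by move=> q; rewrite mem_cat => /orP[/lK|/l'K].
  apply/seteqP; split=> [x [lx l'x] q|x h]; first by rewrite mem_cat => /orP[/lx|/l'x].
  by split=> q ql; apply: h; rewrite mem_cat ql ?orbT.
- by rewrite setTI.
- by move=> _ [l lK ->]; exact: class_dual_halfspaces lK.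
- move=> S _ DS; have := D_lin 1 (-1) D1K DS; congr D; apply/funext => x.
  rewrite !indicE !in_setI in_setC; case: (x \in K); case: (x \in S) => /=; ring.
- move=> F _ tF DF.
  pose U N := \big[setU/set0]_(i < N) F i.
  have DU N : D (\1_(U N `&` K)).
    elim: N => [|N IH].
      have := D_lin 0 0 D1K D1K; congr D; apply/funext => x.
      by rewrite /U big_ord0 set0I [in RHS]indicE in_set0 !mul0r addr0.
    have := D_lin 1 1 IH (DF N); congr D; apply/funext => x.
    rewrite /U big_ord_recr/= !indicE !in_setI in_setU.
    case: (x \in K); rewrite ?andbF ?andbT/=; last by ring.
    have [/set_mem xN|] := boolP (x \in F N); rewrite ?orbT/=; last by move=> _; rewrite ?orbF !mul1r addr0.
    rewrite memNset ?orbT/=; first by ring.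
    rewrite -(bigcup_mkord N F) => -[j /= jN Fj].
    by have /= := tF j N I I (ex_intro _ x (conj Fj xN)) => jNE; move: jN; rewrite jNE ltnn.
  apply: (@D_lim (fun N => \1_(U N `&` K)) _ 1) => //.
    by move=> k x; rewrite indicE; case: (_ \in _); rewrite ?normr1 ?normr0.
  move=> x; have [[[j _ Fj] Kx]|nx] := pselect ((\bigcup_i F i `&` K) x).
    rewrite [X in _ --> X]indicE mem_set; last by split => //; exists j.
    apply: cvg_near_cst; exists j.+1 => // N /= jN.
    by rewrite indicE mem_set//; split=> //; rewrite /U -(bigcup_mkord N F); exists j.
  rewrite [X in _ --> X]indicE memNset//.
  apply: cvg_near_cst; apply: nearW => N; rewrite indicE memNset//.
  by move=> [UN Kx]; apply: nx; split=> //; move: UN; rewrite /U -(bigcup_mkord N F) => -[j _ Fj]; exists j.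
Qed.

End laplace_class.

(** * Bounded integration and vector measures *)

Section bounded_integration.
Import HBNNSimple.
Context {R : realType} {d : measure_display} {T : measurableType d}.
Implicit Types (f : T -> R) (nu : {measure set T -> \bar R}).

Definition bounded_measurable (D : set T) f :=
  measurable_fun D f /\ exists M, forall x, D x -> `|f x| <= M.

Lemma bounded_measurableS (D E : set T) f : measurable D -> E `<=` D ->
  bounded_measurable D f -> bounded_measurable E f.
Proof.
move=> mD ED [mf [M fM]]; split; first exact: measurable_funS mf.
by exists M => x /ED; exact: fM.
Qed.

Lemma bounded_measurable_funTS (D : set T) f : measurable D ->
  bounded_measurable setT f -> bounded_measurable D f.
Proof. by move=> mD; apply: bounded_measurableS. Qed.

Lemma bounded_measurable_integrable nu f (D : set T) : (nu D < +oo)%E ->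
  measurable D -> bounded_measurable D f -> nu.-integrable D (EFin \o f).
Proof.
move=> nuoo mD [mf [M fM]]; apply: measurable_bounded_integrable => //.
exists M; split; rewrite ?num_real// => y My x Dx; exact: le_trans (fM x Dx) (ltW My).
Qed.

Lemma bounded_measurable_lin (D : set T) (a b : R) f g : bounded_measurable D f ->
  bounded_measurable D g -> bounded_measurable D (fun x => a * f x + b * g x).
Proof.
move=> [mf [M fM]] [mg [M' gM']]; split.
  by apply: measurable_funD; apply: measurable_funM.
exists (`|a| * M + `|b| * M') => x Dx; apply: le_trans (ler_normD _ _) _.
by rewrite !normrM lerD// ler_wpM2l//; [exact: fM|exact: gM'].
Qed.

Lemma bounded_measurable_indic D A : measurable A -> bounded_measurable D \1_A.
Proof.
move=> mA; split; first exact: measurable_indic.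
by exists 1 => x _; rewrite indicE; case: (_ \in _); rewrite ?normr1 ?normr0.
Qed.

Lemma bounded_measurable_lim (D : set T) (f_ : nat -> T -> R) f (M : R) : measurable D ->
  (forall k, bounded_measurable D (f_ k)) -> (forall k x, D x -> `|f_ k x| <= M) ->
  (forall x, D x -> f_ k x @[k --> \oo] --> f x) -> bounded_measurable D f.
Proof.
move=> mD mf_ fM fl; split.
  by apply: (measurable_fun_cvg (h := f_)) => [k|x Dx]; [case: (mf_ k)|exact: fl].
exists M => x Dx; apply: (cvgr_to_le (cvg_norm (fl x Dx))); apply: nearW => k; exact: fM.
Qed.

Lemma Rintegral_lin nu (D : set T) (a b : R) f g : (nu D < +oo)%E -> measurable D ->
  bounded_measurable D f -> bounded_measurable D g ->
  \int[nu]_(x in D) (a * f x + b * g x) =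
  a * (\int[nu]_(x in D) f x) + b * (\int[nu]_(x in D) g x).
Proof.
move=> nuoo mD bf bg.
have i1 := bounded_measurable_integrable nuoo mD bf.
have i2 := bounded_measurable_integrable nuoo mD bg.
have Z (k : R) h : bounded_measurable D h -> bounded_measurable D (fun x => k * h x).
  move=> [mh [M hM]]; split; first exact: measurable_funM.
  by exists (`|k| * M) => x Dx; rewrite normrM ler_wpM2l//; exact: hM.
rewrite RintegralD ?RintegralZl//; exact: bounded_measurable_integrable (Z _ _ _).
Qed.

Lemma Rintegral_bounded nu f (D : set T) (M : R) : (nu D < +oo)%E -> measurable D ->
  measurable_fun D f -> (forall x, D x -> `|f x| <= M) ->
  `|\int[nu]_(x in D) f x| <= M * fine (nu D).
Proof.
move=> nuoo mD mf fM.
have bf : bounded_measurable D f by split=> //; exists M.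
have M0 : bounded_measurable D (fun=> M) by split; [exact: measurable_cst|exists `|M|].
have i1 := bounded_measurable_integrable nuoo mD bf.
apply: le_trans (le_normr_Rintegral mD i1) _.
apply: (@le_trans _ _ (\int[nu]_(x in D) M)); last by rewrite Rintegral_cst.
apply: le_Rintegral => //; first exact: (integrable_norm i1).
exact: bounded_measurable_integrable M0.
Qed.

Lemma bounded_convergence nu (f_ : nat -> T -> R) f (M : R) (D : set T) :
  (nu D < +oo)%E -> measurable D ->
  (forall k, measurable_fun D (f_ k)) -> (forall k x, D x -> `|f_ k x| <= M) ->
  (forall x, D x -> f_ k x @[k --> \oo] --> f x) ->
  (fun k => \int[nu]_(x in D) f_ k x) @ \oo --> \int[nu]_(x in D) f x.
Proof.
move=> Doo mD mf fM fl.
have mf0 : measurable_fun D f by exact: measurable_fun_cvg mf fl.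
have iM : nu.-integrable D (EFin \o cst M).
  by apply: measurable_bounded_integrable => //; exact: bounded_cst.
apply: fine_cvg; rewrite fineK; last first.
  apply: integrable_fin_num => //; apply: le_integrable iM => //; first exact/measurable_EFinP.
  move=> x Dx /=; rewrite lee_fin; apply: le_trans (ler_norm M).
  by apply: (cvgr_to_le (cvg_norm (fl x Dx))); apply: nearW => k; exact: fM.
apply: (@dominated_cvg _ _ _ nu _ mD (fun k x => (f_ k x)%:E) _ (EFin \o cst M)) => //.
- by move=> k; exact/measurable_EFinP.
- by move=> x Dx; apply: cvg_EFin; [exact: nearW|exact: fl].
Qed.

(** An induction principle: indicators give simple functions, and these increase to a nonnegative
    bounded function while keeping its bound. A general function is first raised by its bound. *)
Lemma bounded_measurable_ind (P : (T -> R) -> Prop) :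
  (forall A, measurable A -> P \1_A) ->
  (forall (a b : R) f g, P f -> P g -> P (fun x => a * f x + b * g x)) ->
  (forall (f_ : nat -> T -> R) f (M : R), (forall k, P (f_ k)) ->
    (forall k x, `|f_ k x| <= M) -> (forall x, f_ k x @[k --> \oo] --> f x) -> P f) ->
  forall f, bounded_measurable setT f -> P f.
Proof.
move=> P1 Plin Plim.
have P0 : P (fun=> 0).
  rewrite (_ : (fun=> 0) = fun x => 0 * \1_setT x + 0 * \1_setT x); first by apply: Plin; exact: P1.
  by apply/funext => x; ring.
have Psum (I : Type) (s : seq I) (c : I -> R) (F : I -> T -> R) : (forall i, P (F i)) ->
    P (fun x => \sum_(i <- s) c i * F i x).
  move=> PF; elim: s => [|i s IH]; first by under eq_fun do rewrite big_nil.
  rewrite (_ : (fun _ => _) = fun x => c i * F i x + 1 * \sum_(i <- s) c i * F i x).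
    exact: Plin.
  by apply/funext => x; rewrite big_cons mul1r.
have Psfun (g : {nnsfun T >-> R}) : P g.
  have [s gE] : exists s : seq R, forall x, g x = \sum_(y <- s) y * \1_(g @^-1` [set y]) x.
    by eexists => x; rewrite fimfunE fsbig_finite//; reflexivity.
  by rewrite (funext gE); apply: Psum => y; apply: P1.
have Ppos f : measurable_fun setT f -> (forall x, 0 <= f x) -> (exists M, forall x, f x <= M) -> P f.
  move=> mf f0 [M fM].
  have mEf : measurable_fun setT (EFin \o f) by exact/measurable_EFinP.
  pose g := nnsfun_approx measurableT mEf.
  have g_f x : (g k x)%:E @[k --> \oo] --> (f x)%:E.
    by apply: cvg_nnsfun_approx => // y _; rewrite lee_fin.
  have g_r x : g k x @[k --> \oo] --> f x by have /fine_cvgP[_] := g_f x.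
  apply: (Plim (fun k x => g k x) f M) => //.
  - move=> k x; rewrite ger0_norm//; apply: le_trans (fM x).
    rewrite -(cvg_lim _ (g_r x))//; apply: nondecreasing_cvgn_le; last by apply/cvg_ex; exists (f x).
    by move=> i j ij; move: x; apply/lefP/nd_nnsfun_approx.
move=> f [mf [M fM]].
rewrite (_ : f = fun x => 1 * (f x + M) + (- M) * \1_setT x).
  apply: Plin; last exact: P1.
  apply: Ppos => //; first exact: measurable_funD.
  - by move=> x; have := fM x I; rewrite ler_norml => /andP[h _]; rewrite -lerBlDr sub0r.
  - by exists (M + M) => x; rewrite lerD2r; exact: le_trans (ler_norm _) (fM x I).
by apply/funext => x; rewrite indicT/=; ring.
Qed.

End bounded_integration.

(** * Scalar measures and integrals of a cone-valued measure *)

Section scalar_measures.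
Import HBNNSimple.
Context {R : realType} {n : nat}.
Local Notation V := 'cV[R]_n.
Context {ip : {dot V for idfun}} {K : set V} {mu : set V -> V}.
Context (hmu : cone_valued_measure ip K mu).

(** Additivity on the constant sequence of empty sets makes the multiples of [mu set0] converge, so
    their increments, all equal to [mu set0], tend to 0. *)
Let mu_set0 : mu set0 = 0.
Proof.
have h := cvm_sigma_additive hmu (F := fun=> set0) (fun=> measurable0) (@trivIset_set0 _ _ _).
rewrite bigcup0// in h.
have h2 : (\sum_(0 <= i < k.+1) mu set0) @[k --> \oo] --> mu set0.
  by rewrite (cvg_shiftS (fun k => \sum_(0 <= i < k) mu set0)).
have h3 : (\sum_(0 <= i < k.+1) mu set0 - \sum_(0 <= i < k) mu set0) @[k --> \oo] --> mu set0 - mu set0.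
  exact: cvgB h2 h.
rewrite subrr in h3.
apply: (cvg_unique _ _ h3) => //; apply: cvg_near_cst.
by apply: nearW => k; rewrite big_nat_recr//= addrAC subrr add0r.
Qed.

(* Only the values of mu on measurable sets are constrained, whereas a library
   measure has to be nonnegative everywhere. *)
Definition scalar_measure x (Kx : K x) (A : set V) : \bar R :=
  let _ := hmu in if `[< measurable A >] then scalarize ip mu x A else 0%E.

Lemma scalar_measureE x (Kx : K x) A : measurable A ->
  scalar_measure Kx A = (ip x (mu A))%:E.
Proof. by move=> mA; rewrite /scalar_measure; case: asboolP. Qed.

Section instance.
Context x (Kx : K x).

Let scalar0 : scalar_measure Kx set0 = 0%E.
Proof. by rewrite scalar_measureE// mu_set0 linear0r. Qed.

Let scalar_ge0 A : (0 <= scalar_measure Kx A)%E.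
Proof.
rewrite /scalar_measure; case: asboolP => // mA.
by rewrite lee_fin ipC; exact: (cvm_dual hmu mA Kx).
Qed.

Let scalar_sigma_additive : semi_sigma_additive (scalar_measure Kx).
Proof.
move=> F mF tF mUF; rewrite scalar_measureE//.
under eq_fun do under eq_bigr do rewrite scalar_measureE//.
rewrite (_ : (fun _ => _) = EFin \o (fun k => ip x (\sum_(0 <= i < k) mu (F i)))); last first.
  by apply/funext => k; rewrite /= linear_sumr sumEFin.
apply: cvg_EFin; first exact: nearW.
by apply: cvg_ip; [exact: cvg_cst|exact: cvm_sigma_additive hmu _ mF tF].
Qed.

HB.instance Definition _ := isMeasure.Build _ _ _ (scalar_measure Kx)
  scalar0 scalar_ge0 scalar_sigma_additive.

End instance.

Lemma scalar_measure_lty x (Kx : K x) D : measurable D -> (scalar_measure Kx D < +oo)%E.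
Proof. by move=> mD; rewrite scalar_measureE// ltry. Qed.

(** An integral is built from the values of the measure on the level sets of simple functions. These
    are measurable, and there the two set functions agree. *)
Lemma integral_scalarizeE x (Kx : K x) (D : set V) (f : V -> \bar R) :
  (\int[scalarize ip mu x]_(y in D) f y = \int[scalar_measure Kx]_(y in D) f y)%E.
Proof.
have sE (h : {nnsfun V >-> R}) : sintegral (scalarize ip mu x) h = sintegral (scalar_measure Kx) h.
  by rewrite /sintegral; apply: eq_fsbigr => r _; rewrite scalar_measureE.
rewrite /integral; congr (_ - _)%E; congr (ereal_sup _);
  by apply/seteqP; split=> _ [h ? <-]; exists h; rewrite ?sE.
Qed.

(* The i-th basis vector is a i - b i, so that integrals against <x, mu>, which are
   defined for x in K only, become linear combinations of integrals. *)
Lemma integral_scalar_measure_lin (hK : generating_proper_cone K) :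
  exists a b : 'I_n -> V, exists (Ka : forall i, K (a i)) (Kb : forall i, K (b i)),
  forall (D : set V) f x (Kx : K x), measurable D -> bounded_measurable setT f ->
  \int[scalar_measure Kx]_(y in D) f y = \sum_i x i ord0 *
    (\int[scalar_measure (Ka i)]_(y in D) f y - \int[scalar_measure (Kb i)]_(y in D) f y).
Proof.
have [a_ aP] : exists p : 'I_n -> V * V, forall i,
    [/\ K (p i).1, K (p i).2 & delta_mx i ord0 = (p i).1 - (p i).2].
  have /choice[p pP] : forall i : 'I_n, exists p : V * V, [/\ K p.1, K p.2 & delta_mx i ord0 = p.1 - p.2].
    move=> i; by have [y [w ?]] := cone_generating hK (delta_mx i ord0); exists (y, w).
  by exists p.
exists (fun i => (a_ i).1), (fun i => (a_ i).2).
have Ka i : K (a_ i).1 by case: (aP i).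
have Kb i : K (a_ i).2 by case: (aP i).
exists Ka, Kb => D f x Kx mD bf.
suff [] : bounded_measurable setT f /\ \int[scalar_measure Kx]_(y in D) f y = \sum_i x i ord0 *
    (\int[scalar_measure (Ka i)]_(y in D) f y - \int[scalar_measure (Kb i)]_(y in D) f y) by [].
move: f bf; apply: bounded_measurable_ind => [A mA|c e f g [bf Hf] [bg Hg]|f_ f M Hf_ fM fl].
- split; first exact: bounded_measurable_indic.
  have intE y (Ky : K y) : \int[scalar_measure Ky]_(y in D) \1_A y = ip y (mu (A `&` D)).
    rewrite /Rintegral integral_indic//.
    by apply: (congr1 fine (scalar_measureE Ky _)); exact: measurableI.
  rewrite intE.
  transitivity (\sum_i x i ord0 * ip (delta_mx i ord0) (mu (A `&` D))).
    rewrite {1}[x]matrix_sum_delta linear_sumlz; apply: eq_bigr => i _.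
    by rewrite big_ord_recl big_ord0 addr0 linearZl_LR.
  apply: eq_bigr => i _; congr (_ * _); case: (aP i) => _ _ ->.
  by rewrite linearBl/= !intE.
- split; first exact: bounded_measurable_lin.
  have lin y (Ky : K y) : \int[scalar_measure Ky]_(y in D) (c * f y + e * g y) =
      c * (\int[scalar_measure Ky]_(y in D) f y) + e * (\int[scalar_measure Ky]_(y in D) g y).
    by apply: Rintegral_lin; rewrite ?scalar_measure_lty//; exact: bounded_measurable_funTS.
  rewrite lin Hf Hg 2!mulr_sumr -big_split/=.
  by apply: eq_bigr => i _; rewrite !lin; ring.
- have bf : bounded_measurable setT f.
    by apply: (@bounded_measurable_lim _ _ _ setT f_ f M) => // k; case: (Hf_ k).
  split=> //.
  have lim y (Ky : K y) : (fun k => \int[scalar_measure Ky]_(y in D) f_ k y) @ \oo -->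
      \int[scalar_measure Ky]_(y in D) f y.
    apply: bounded_convergence; rewrite ?scalar_measure_lty//.
    by move=> k; case: (Hf_ k) => -[mf _] _; exact: measurable_funTS.
  apply: (cvg_unique _ (lim x Kx)) => //.
  rewrite (_ : (fun k => _) = fun k => \sum_i x i ord0 *
      (\int[scalar_measure (Ka i)]_(y in D) f_ k y - \int[scalar_measure (Kb i)]_(y in D) f_ k y)).
    apply: cvg_sum_ord => i; apply: cvgM; first exact: cvg_cst.
    by apply: cvgB; exact: lim.
  by apply/funext => k; case: (Hf_ k).
Qed.

(** The scalar integrals depend linearly on [x], so they are represented by a row vector; the
    inverse Gram matrix turns it into a vector for [ip]. This shows that the choice made in
    [vintegral] is not the default one. *)
Lemma vintegralP (hK : generating_proper_cone K) (D : set V) f : measurable D ->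
  bounded_measurable setT f -> is_vintegral ip K mu D f (vintegral ip K mu D f).
Proof.
move=> mD bf; rewrite /vintegral; apply: (@xgetPex _ 0 (is_vintegral ip K mu D f)).
have [a [b [Ka [Kb H]]]] := integral_scalar_measure_lin hK.
pose c : 'rV[R]_n := \row_i (\int[scalar_measure (Ka i)]_(y in D) f y - \int[scalar_measure (Kb i)]_(y in D) f y).
exists (invmx (gram ip) *m c^T) => x Kx.
rewrite integral_scalarizeE -[RHS]fineK; last first.
  apply: integrable_fin_num => //.
  apply: (bounded_measurable_integrable (scalar_measure_lty Kx mD) mD).
  exact: bounded_measurable_funTS mD bf.
congr EFin; rewrite -/(Rintegral _ _ _) H// ip_gram -mulmxA (mulmxA (gram ip)) mulmxV ?gram_unit// mul1mx.
by rewrite mxE; apply: eq_bigr => i _; rewrite !mxE.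
Qed.

End scalar_measures.

(** * The flow between jumps *)

Section vector_derivatives.
Context {R : realType} {n : nat}.
Local Notation V := 'cV[R]_n.

Definition is_derive_cV (f : R -> V) (t : R) (df : V) :=
  forall i, is_derive t 1 (fun s => f s i ord0) (df i ord0).

Lemma is_derive_ip (ip : {dot V for idfun}) f g t df dg :
  is_derive_cV f t df -> is_derive_cV g t dg ->
  is_derive t 1 (fun s => ip (f s) (g s)) (ip df (g t) + ip (f t) dg).
Proof.
move=> fd gd.
have ipE x y : ip x y = \sum_i \sum_j gram ip i j * (x i ord0 * y j ord0).
  rewrite ip_gram -mulmxA mxE; apply: eq_bigr => i _; rewrite !mxE mulr_sumr.
  by apply: eq_bigr => j _; ring.
have -> : (fun s => ip (f s) (g s)) =
    fun s => \sum_i \sum_j gram ip i j * (f s i ord0 * g s j ord0).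
  by apply/funext => s; rewrite ipE.
rewrite !ipE -big_split/=; apply: is_derive_sum_ord => i.
rewrite -big_split/=; apply: is_derive_sum_ord => j.
rewrite -mulrDr; apply: is_deriveZ; exact: is_derive_mul.
Qed.

Lemma is_derive_cV_cst v t : is_derive_cV (fun=> v) t 0.
Proof. by move=> i; rewrite mxE; exact: is_derive_cst. Qed.

Lemma is_derive_cVB f g t df dg : is_derive_cV f t df -> is_derive_cV g t dg ->
  is_derive_cV (fun s => f s - g s) t (df - dg).
Proof.
move=> fd gd i; rewrite !mxE.
have -> : (fun s => (f s - g s) i ord0) = (fun s => f s i ord0) - (fun s => g s i ord0).
  by apply/funext => s; rewrite !mxE.
exact: is_deriveB.
Qed.

Lemma is_derive_cVD f g t df dg : is_derive_cV f t df -> is_derive_cV g t dg ->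
  is_derive_cV (fun s => f s + g s) t (df + dg).
Proof.
move=> fd gd i; rewrite !mxE.
have -> : (fun s => (f s + g s) i ord0) = (fun s => f s i ord0) + (fun s => g s i ord0).
  by apply/funext => s; rewrite !mxE.
exact: is_deriveD.
Qed.

Lemma is_derive_cVZ (h : R -> R) (dh : R) v (t : R) : is_derive t 1 h dh ->
  is_derive_cV (fun s => h s *: v) t (dh *: v).
Proof.
move=> hd i; rewrite mxE.
have -> : (fun s => (h s *: v) i ord0) = (fun s => h s * v i ord0).
  by apply/funext => s; rewrite !mxE.
exact: is_derive_mulr.
Qed.

Lemma is_derive_cV_mulmx (M : 'M[R]_n) f t df : is_derive_cV f t df ->
  is_derive_cV (fun s => M *m f s) t (M *m df).
Proof.
move=> fd i; rewrite mxE.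
have -> : (fun s => (M *m f s) i ord0) = fun s => \sum_l M i l * f s l ord0.
  by apply/funext => s; rewrite mxE.
by apply: is_derive_sum_ord => l; apply: is_deriveZ; exact: fd.
Qed.

Lemma is_derive_cV_expmx (B : 'M[R]_n) v t :
  is_derive_cV (fun s => expmx (s *: B) *m v) t (B *m expmx (t *: B) *m v).
Proof.
move=> i; rewrite mxE.
have -> : (fun s => (expmx (s *: B) *m v) i ord0) =
    fun s => \sum_l expmx (s *: B) i l * v l ord0.
  by apply/funext => s; rewrite mxE.
by apply: is_derive_sum_ord => l; apply: is_derive_mulr; exact: is_derive_expmx.
Qed.

Lemma is_derive_cV_cst_eq (f : R -> V) t : (forall s, is_derive_cV f s 0) -> f t = f 0.
Proof.
move=> fd; apply/colP => i; apply: (is_derive_0_is_cst (f := fun s => f s i ord0)) => s.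
by have := fd s i; rewrite mxE.
Qed.

(** Tested against an element of the dual cone, the increment is that of a nondecreasing real
    function; the bipolar theorem concludes. *)
Lemma cone_increment (ip : {dot V for idfun}) (K : set V) (hK : generating_proper_cone K)
    (f df : R -> V) (a b : R) : a <= b ->
  (forall t, a <= t <= b -> is_derive_cV f t (df t)) ->
  (forall t, a <= t <= b -> K (df t)) -> K (f b - f a).
Proof.
move=> ab fd Kdf; apply: (dual_cone_bipolar (ip := ip) hK) => u Ku.
rewrite linearBr/= subr_ge0 -lerN2.
apply: (nonincreasing_is_derive (f := fun s => - ip u (f s)) (df := fun s => - ip u (df s)) ab).
  move=> t tab; apply: is_deriveN.
  have := is_derive_ip ip (is_derive_cV_cst u t) (fd t tab).
  by rewrite linear0l add0r.
by move=> t tab; rewrite oppr_le0; exact: Ku (Kdf t tab).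
Qed.

End vector_derivatives.

Section affine_flow.
Context {R : realType} {n : nat}.
Local Notation V := 'cV[R]_n.
Context (ip : {dot V for idfun}) (K : set V) (hK : generating_proper_cone K).
Context (B : 'M[R]_n) (b : V) (Kb : K b).
Local Notation E t := (expmx (t *: B)).
Hypothesis h_flow : forall t : R, 0 <= t -> [set E t *m x | x in K°] = K°.
Hypothesis h_tau : tau B < 0.

(** In dimension 0 there is no eigenvalue and the supremum of the empty set is 0 by convention,
    which is not negative. *)
Lemma dim_gt0_of_tau : (0 < n)%N.
Proof.
rewrite lt0n; apply/negP => /eqP n0; move: h_tau; rewrite /tau.
rewrite (_ : [set _ | _ in _] = set0) ?sup0 ?ltxx//.
apply/seteqP; split=> // _ [z /= + _]; apply/negP; rewrite negbK.
by apply/eqP/matrixP => i; have := ltn_ord i; rewrite {2}n0.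
Qed.

Lemma expmx_cvg0 : E t @[t --> +oo] --> (0 : 'M[R]_n).
Proof. exact: expmx_vanishes dim_gt0_of_tau h_tau. Qed.

Lemma cvg_expmx_mul v : (E t *m v) @[t --> +oo] --> (0 : V).
Proof.
by rewrite -(mul0mx _ v); apply: cvg_mulmx; [exact: expmx_cvg0|exact: cvg_cst].
Qed.

(** A vector in the kernel of [B] is fixed by every [E t], yet its images tend to 0. *)
Lemma stable_unitmx : B \in unitmx.
Proof.
rewrite -row_full_unit -cokermx_eq0; apply/eqP/matrixP => i j; rewrite [RHS]mxE.
pose v := col j (cokermx B).
have Bv : B *m v = 0 by rewrite /v colE mulmxA mulmx_coker mul0mx.
have Ev t : E t *m v = v.
  have := @is_derive_cV_cst_eq R n (fun s => E s *m v) t.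
  rewrite scale0r; rewrite -[in X in _ -> _ = X *m _](scale0r B) expmx0 mul1mx; apply => s.
  by have := is_derive_cV_expmx B v s; rewrite expmx_comm -mulmxA Bv mulmx0.
have : v = 0.
  apply: (cvg_unique _ _ (cvg_expmx_mul v)) => //.
  by rewrite (_ : (fun _ => _) = cst v); [exact: cvg_cst|exact/funext].
by move=> /colP/(_ i); rewrite !mxE.
Qed.

Definition equilibrium : V := - (invmx B *m b).
Local Notation z := equilibrium.
Definition flow (t : R) (x : V) : V := z + E t *m (x - z).

Lemma mulmx_equilibrium : B *m z = - b.
Proof. by rewrite /z mulmxN mulmxA mulmxV ?stable_unitmx// mul1mx. Qed.

(** Negative times are included because [h_flow] is an equality of sets: [E (- t)] undoes [E t]
    within the interior. *)
Lemma expmx_interior t x : K° x -> K° (E t *m x).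
Proof.
have [t0|/ltW t0] := leP 0 t => Kx; first by rewrite -(h_flow t0); exists x.
rewrite -(@h_flow (- t)) ?oppr_ge0// in Kx; case: Kx => y Ky <-.
by rewrite mulmxA expmxKN mul1mx.
Qed.

(** Points of [K] are limits of interior points: [x + r *: e] is interior for every [r > 0], and [r]
    tends to 0 after applying [E t]. *)
Lemma expmx_cone t x : K x -> K (E t *m x).
Proof.
move=> Kx; have [e Ke] := cone_interior_neq0 hK.
apply: (cone_of_interior_shift hK (e := E t *m e)) => r r0.
have Kre : K° (r *: e + x) by apply: interior_coneD => //; exact: interior_coneZ.
rewrite scalemxAr -mulmxDr addrC; apply: interior_subset; exact: expmx_interior.
Qed.

Lemma is_derive_flow t x :
  is_derive_cV (fun s => flow s x) t (B *m flow t x + b).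
Proof.
have := is_derive_cVD (is_derive_cV_cst z t) (is_derive_cV_expmx B (x - z) t).
by rewrite /flow (mulmxDr B) mulmx_equilibrium mulmxA add0r addrAC (addNr b) add0r.
Qed.

Lemma flow0 x : flow 0 x = x.
Proof. by rewrite /flow expmx0 mul1mx addrC subrK. Qed.

Lemma flowD_jump s t x xi : flow t (flow s x + xi) = flow (s + t) x + E t *m xi.
Proof.
rewrite /flow; have -> : z + E s *m (x - z) + xi - z = E s *m (x - z) + xi.
  by rewrite -(addrA z) (addrC z) addrK.
by rewrite mulmxDr mulmxA -expmxD (addrC t s) addrA.
Qed.

(** The vector vanishes at time 0 and has derivative [E t *m b], an element of [K], because
    [B *m z = - b]. It is the position at time [t] of the flow started at 0. *)
Lemma equilibrium_sub_cone t : 0 <= t -> K (z - E t *m z).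
Proof.
move=> t0.
have := @cone_increment R n ip K hK (fun s => z - E s *m z) (fun s => E s *m b) 0 t t0.
rewrite expmx0 mul1mx subrr subr0; apply=> s _; last exact: expmx_cone.
have := is_derive_cVB (is_derive_cV_cst z s) (is_derive_cV_expmx B z s).
by rewrite expmx_comm -mulmxA mulmx_equilibrium mulmxN sub0r opprK.
Qed.

Lemma equilibrium_cone : K z.
Proof.
(* The absolute value makes [f t] an element of [K] for every real [t], as [cone_lim] demands. *)
pose f (t : R) := z - E `|t| *m z.
apply: (@cone_lim R n K hK R (pinfty_nbhs R) _ f).
  by move=> t; apply: equilibrium_sub_cone.
rewrite -[X in _ --> X]subr0; apply: cvgB; first exact: cvg_cst.
apply: cvg_trans (cvg_expmx_mul z); apply: near_eq_cvg.
by near=> t; rewrite ger0_norm.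
Unshelve. all: by end_near. Qed.

Lemma flowE t x : flow t x = (z - E t *m z) + E t *m x.
Proof. by rewrite /flow mulmxBr addrAC addrA. Qed.

Lemma flow_cone t x : 0 <= t -> K x -> K (flow t x).
Proof.
move=> t0 Kx; rewrite flowE; apply: coneD => //.
  exact: equilibrium_sub_cone.
exact: expmx_cone.
Qed.

Lemma flow_interior t x : 0 <= t -> K° x -> K° (flow t x).
Proof.
move=> t0 Kx; rewrite flowE addrC; apply: interior_coneD => //.
  exact: expmx_interior.
exact: equilibrium_sub_cone.
Qed.

Lemma continuous_flow x : continuous (fun t => flow t x).
Proof.
move=> t; apply: cvgD; first exact: cvg_cst.
by apply: cvg_mulmx; [exact: continuous_expmx|exact: cvg_cst].
Qed.

Lemma expmx_bounded (T : R) : 0 <= T -> exists2 C, 0 < C &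
  forall t, 0 <= t <= T -> `|E t| <= C.
Proof.
move=> T0.
have normE : {within `[0, T], continuous (fun t => `|E t|)}.
  apply: continuous_subspaceT => t.
  by apply: cvg_norm; exact: continuous_expmx.
have [c _ cP] := @EVT_max R (fun t => `|E t|) 0 T T0 normE.
exists (1 + `|E c|); first by rewrite ltr_pwDl.
move=> t tT; apply: le_trans (cP t _) _; first by rewrite in_itv.
by rewrite lerDr.
Qed.

Lemma flow_bounded (T M : R) : 0 <= T -> 0 <= M -> exists2 N, 0 <= N &
  forall t x, 0 <= t <= T -> `|x| <= M -> `|flow t x| <= N.
Proof.
move=> T0 M0; have [C C0 CP] := expmx_bounded T0.
exists (`|z| + n%:R * C * (M + `|z|)); first by rewrite addr_ge0// !mulr_ge0 ?addr_ge0// ltW.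
move=> t x tT xM; apply: le_trans (ler_normD _ _) _; rewrite lerD2l.
apply: le_trans (norm_mulmx _ _) _; apply: ler_pM => //.
  by rewrite ler_wpM2l// CP.
by apply: le_trans (ler_normB _ _) _; rewrite lerD2r.
Qed.

(** On a compact interval [E (- t) *m e] is bounded, so [e] exceeds a fixed small multiple of it in
    the cone order; applying [E t] gives the claim with a constant uniform in [t]. *)
Lemma expmx_cone_ge (T : R) e : 0 <= T -> K° e -> exists2 c, 0 < c &
  forall t, 0 <= t <= T -> K (E t *m e - c *: e).
Proof.
move=> T0 Ke; have [r r0 rP] := cvx_interior_ball Ke.
have cN : continuous (fun t : R => E (- t) *m e).
  move=> t; apply: cvg_mulmx; last exact: cvg_cst.
  have H := @continuous_expmx R n B (- t).
  have ct : (- s) @[s --> t] --> - t by apply: cvgN; exact: cvg_id.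
  exact: cvg_comp ct H.
have cn : {within `[0, T], continuous (fun t => `|E (- t) *m e|)}.
  by apply: continuous_subspaceT => t; apply: cvg_norm; exact: cN.
have [s _ sP] := EVT_max T0 cn.
pose C := `|E (- s) *m e| + 1; have C0 : 0 < C by rewrite ltr_wpDl.
exists (r / C); first by rewrite divr_gt0.
move=> t tT.
have -> : E t *m e - (r / C) *: e = E t *m (e + - ((r / C) *: (E (- t) *m e))).
  by rewrite mulmxDr mulmxN -scalemxAr mulmxA expmxKN mul1mx.
apply: expmx_cone; apply: rP; rewrite normrN normrZ gtr0_norm ?divr_gt0//.
rewrite mulrAC ler_pdivrMr// ler_wpM2l ?ltW// /C.
by apply: le_lt_trans (sP t _) _; rewrite ?in_itv// ltrDl.
Qed.

Lemma expmx_small (e : V) (M : R) : K° e -> exists2 T, 0 <= T &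
  forall t x, T <= t -> `|x| <= M -> K° (e - E t *m x).
Proof.
move=> Ke.
have [r r0 rP] := cvx_interior_ball Ke.
(* With [|E t| < q] the vector [E t *m x] has norm at most [r / 2]; the other half of the ball shows
   that the difference is interior. *)
pose q := r / 2 / (n%:R * (`|M| + 1) + 1).
have q0 : 0 < q by rewrite !divr_gt0// ltr_wpDl// mulr_ge0.
have /cvgr0Pnorm_lt/(_ _ q0)[T [_ TP]] := expmx_cvg0.
exists (`|T| + 1); first by rewrite addr_ge0.
move=> t x Tt xM.
have Et : `|E t *m x| <= r / 2.
  apply: le_trans (norm_mulmx _ _) _.
  have /TP/ltW tq : T < t.
    by apply: le_lt_trans (ler_norm T) _; apply: lt_le_trans Tt; rewrite ltrDl.
  apply: (@le_trans _ _ (n%:R * q * (`|M| + 1))).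
    apply: ler_pM => //; first by rewrite ler_wpM2l.
    by rewrite (le_trans xM)// (le_trans (ler_norm _))// lerDl.
  rewrite mulrAC /q mulrCA ger_pMr ?divr_gt0// ler_pdivrMr ?mul1r ?lerDl//.
apply: (@interiorP _ _ _ _ (r / 2)); first by rewrite divr_gt0.
move=> y yr; rewrite -addrA; apply: rP.
rewrite (le_trans (ler_normD _ _))// normrN [leRHS]splitr lerD//; exact: ltW.
Qed.

(** Near time 0, [E u *m b] exceeds half of [b] in the cone order because [b] is interior, so the
    drift accumulated up to a small [s] exceeds a positive multiple of [b]. The part accumulated
    after [s] adds an element of [K]. *)
Lemma flow_to_interior t x : 0 < t -> K° b -> K x -> K° (flow t x).
Proof.
move=> t0 Kb' Kx; rewrite flowE.
suff Kt : K° (z - E t *m z) by apply: interior_coneD => //; exact: expmx_cone.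
have Kb2 : K° ((2^-1 : R) *: b) by apply: interior_coneZ => //; rewrite invr_gt0.
have [r r0 rP] := cvx_interior_ball Kb2.
have cE : (E s *m b) @[s --> (0 : R)] --> E 0 *m b.
  by apply: cvg_mulmx; [exact: continuous_expmx|exact: cvg_cst].
have /cvgrPdist_le/(_ _ r0) := cE.
rewrite expmx0 mul1mx => /nbhs_ballP[dl /= dl0 dlP].
pose s := Num.min t (dl / 2).
have s0 : 0 < s by rewrite lt_min t0 divr_gt0.
have Ks : K° (z - E s *m z).
  suff Ks : K (z - E s *m z - s *: (2^-1 *: b)).
    rewrite -[X in _ X](subrK (s *: (2^-1 *: b))) addrC.
    by apply: (interior_coneD hK) Ks; apply: (interior_coneZ hK s0 Kb2).
  have := @cone_increment R n ip K hK (fun s => z - E s *m z - s *: (2^-1 *: b))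
    (fun s => E s *m b - 2^-1 *: b) 0 s (ltW s0).
  rewrite expmx0 mul1mx subrr scale0r !subr0; apply=> u /andP[u0 us].
    apply: is_derive_cVB; last first.
      by rewrite -[X in is_derive_cV _ _ X]scale1r; apply: is_derive_cVZ; exact: is_derive_id.
    have := is_derive_cVB (is_derive_cV_cst z u) (is_derive_cV_expmx B z u).
    by rewrite expmx_comm -mulmxA mulmx_equilibrium mulmxN sub0r opprK.
  have -> : E u *m b - 2^-1 *: b = 2^-1 *: b + (E u *m b - b).
    rewrite addrCA; congr (_ + _); rewrite -(scaleN1r b) -scalerDl -scaleNr.
    by congr (_ *: _); lra.
  apply: rP; rewrite distrC; apply: dlP; rewrite /ball/= sub0r normrN ger0_norm//.
  apply: le_lt_trans us _; rewrite gt_min; apply/orP; right.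
  by rewrite ltr_pdivrMr// ltr_pMr// ltr1n.
have -> : z - E t *m z = (z - E s *m z) + E s *m (z - E (t - s) *m z).
  by rewrite mulmxBr mulmxA -expmxD (addrC s) subrK addrA subrK.
apply: interior_coneD => //; apply: expmx_cone; apply: equilibrium_sub_cone.
by rewrite subr_ge0 ge_min lexx.
Qed.

End affine_flow.

(** * The decomposition at the first jump *)

Section time_derivatives.
Context {R : realType}.
Implicit Types (f : R -> R).

Lemma time_derivative_near f (t l : R) :
  time_derivative (f : R -> R^o) t l -> forall e, 0 < e -> exists2 d : R, 0 < d &
    forall s, 0 <= s -> s != t -> `|t - s| < d -> `|l - (f s - f t) / (s - t)| <= e.
Proof.
move=> /cvgrPdist_le H e e0; have /(_ _ e0) := H.
rewrite /prop_near1 /within/= => -[d /= d0 dP]; exists d => // s s0 st sd.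
by rewrite mulrC; exact: dP sd st s0.
Qed.

(** Freezing the function at its value at 0 for negative times turns one-sided information at 0 into
    continuity on the whole line. *)
Lemma time_derivative_continuous f (l : R -> R) :
  (forall t : R, 0 <= t -> time_derivative (f : R -> R^o) t (l t)) ->
  continuous (fun r : R => f (Num.max r 0)).
Proof.
move=> fl r; apply/cvgrPdist_le => e e0.
pose t : R := Num.max r 0.
have t0 : 0 <= t by rewrite le_max lexx orbT.
have [d d0 dP] := time_derivative_near (fl t t0) ltr01.
pose c := `|l t| + 1; have c0 : 0 < c by rewrite ltr_wpDl.
apply/nbhs_ballP; exists (Num.min d (e / c)); first by rewrite /= lt_min d0 divr_gt0.
move=> s; rewrite /ball/= lt_min => /andP[sd se].
have st : `|t - Num.max s 0| <= `|r - s|.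
  rewrite /t !maxEle; case: (lerP r 0) => r0; case: (lerP s 0) => s0; rewrite ?subrr ?normr0//.
  - by rewrite sub0r normrN gtr0_norm// ler_normr; apply/orP; right; lra.
  - by rewrite subr0 gtr0_norm// ler_normr; apply/orP; left; lra.
have [->|nst] := eqVneq (Num.max s 0) t; first by rewrite subrr normr0 ltW.
have /dP H : 0 <= Num.max s 0 by rewrite le_max lexx orbT.
have {}H := H nst (le_lt_trans st sd).
have st0 : Num.max s 0 - t != 0 by rewrite subr_eq0.
rewrite -/t distrC -[f _ - f t](divfK st0) normrM.
apply: (@le_trans _ _ (c * (e / c))); last by rewrite mulrC divfK// gt_eqF.
apply: ler_pM => //; last by rewrite distrC; exact: le_trans st (ltW se).
rewrite /c -lerBlDl; apply: le_trans H; rewrite lerBlDr addrC -lerBlDr.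
by rewrite distrC; exact: lerB_dist.
Qed.

Lemma time_derivative_is_derive f (t l : R) : 0 < t ->
  time_derivative (f : R -> R^o) t l -> is_derive t 1 (fun r : R => f (Num.max r 0)) l.
Proof.
move=> t0 fl; pose g (r : R) := f (Num.max r 0).
have H : h^-1 *: ((g \o shift t) (h *: (1 : R)) - g t) @[h --> 0^'] --> l.
  apply/cvgrPdist_le => e e0.
  have [d d0 dP] := time_derivative_near fl e0.
  near=> h.
  have h0 : h != 0 by near: h; exact: nbhs_dnbhs_neq.
  have ht : 0 <= h + t.
    have : `|h| < t by near: h; apply: dnbhs0_lt.
    by rewrite ltr_norml => /andP[h1 _]; rewrite -lerBlDr sub0r ltW.
  have := dP (h + t) ht; rewrite addrK opprD addrA (addrAC t) subrr add0r normrN => H.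
  rewrite /g /= [h *: 1]mulr1 (max_l ht) (max_l (ltW t0)) -[X in l - X]/(_ * _) mulrC; apply: H.
  - by rewrite -subr_eq0 addrK.
  - by near: h; apply: dnbhs0_lt.
have dv : derivable g t 1 by apply/cvg_ex; exists l.
by apply: (DeriveDef dv); rewrite /derive; exact: cvg_lim H.
Unshelve. all: by end_near. Qed.

Lemma continuous_itv_bounded f (t : R) : 0 <= t -> continuous f ->
  exists M, forall s, 0 <= s <= t -> `|f s| <= M.
Proof.
move=> t0 cf; have cn : {within `[0, t], continuous (fun s => `|f s|)}.
  by apply: continuous_subspaceT => s; apply: cvg_norm; exact: cf.
have [c _ cP] := EVT_max t0 cn.
by exists `|f c| => s st; apply: cP; rewrite in_itv.
Qed.

Lemma continuous_measurable_itv f (t : R) : continuous f -> measurable_fun `[0, t]%classic f.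
Proof.
by move=> cf; apply: measurable_funTS; exact: continuous_measurable_fun.
Qed.

Lemma Rintegral_is_derive (F f : R -> R) (t : R) : 0 < t -> continuous F -> continuous f ->
  (forall s, 0 < s < t -> is_derive s 1 F (f s)) ->
  \int[lebesgue_measure]_(s in `[0, t]) f s = F t - F 0.
Proof.
move=> t0 cF cf dF; rewrite /Rintegral (@continuous_FTC2 R f F 0 t t0)//.
- exact: continuous_subspaceT.
- split.
  + by move=> s; rewrite in_itv/= => st; have [] := dF s st.
  + by apply: cvg_at_right_filter; exact: cF.
  + by apply: cvg_at_left_filter; exact: cF.
- by move=> s; rewrite in_itv/= => st; rewrite derive1E; have [] := dF s st.
Qed.

Lemma Rintegral_is_deriveN (F f : R -> R) (t : R) : 0 < t -> continuous F -> continuous f ->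
  (forall s, 0 < s < t -> is_derive s 1 F (- f s)) ->
  F 0 = F t + \int[lebesgue_measure]_(s in `[0, t]) f s.
Proof.
move=> t0 cF cf dF.
have cNF : continuous (fun s => - F s) by move=> s; apply: cvgN; exact: cF.
have dNF s : 0 < s < t -> is_derive s 1 (fun s => - F s) (f s).
  by move=> /dF H; rewrite -[f s]opprK; exact: is_deriveN.
by rewrite (Rintegral_is_derive t0 cNF cf dNF) opprK addNKr.
Qed.

End time_derivatives.

Section jump_functionals.
Context {R : realType} {n : nat}.
Local Notation V := 'cV[R]_n.
Context (K : set V) (hK : generating_proper_cone K).

(* Finite signed measures on K, as functionals on bounded measurable functions. *)
Record jump_functional (I : (V -> R) -> R) : Prop := {
  jump_ext : forall f g : V -> R, (forall x, K x -> f x = g x) -> I f = I g;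
  jump_lin : forall (a b : R) (f g : V -> R), bounded_measurable setT f -> bounded_measurable setT g ->
    I (fun x => a * f x + b * g x) = a * I f + b * I g;
  jump_lim : forall (f_ : nat -> V -> R) (f : V -> R) (M : R), (forall k, measurable_fun setT (f_ k)) ->
    (forall k x, `|f_ k x| <= M) -> (forall x, f_ k x @[k --> \oo] --> f x) ->
    (fun k => I (f_ k)) @ \oo --> I f;
  jump_bound : exists C : R, 0 <= C /\ forall (f : V -> R) (M : R), measurable_fun setT f ->
    (forall x, `|f x| <= M) -> `|I f| <= M * C
}.

Let mK : measurable K.
Proof. exact: closed_measurable_mx (cone_closed hK). Qed.

Lemma jump_functional_integral (nu : {measure set V -> \bar R}) : (nu K < +oo)%E ->
  jump_functional (fun f => \int[nu]_(x in K) f x).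
Proof.
move=> nuoo; split.
- by move=> f g fg; apply: eq_Rintegral => x; rewrite inE; exact: fg.
- by move=> a b f g bf bg; apply: Rintegral_lin => //; exact: bounded_measurable_funTS.
- move=> f_ f M mf fM fl; apply: (bounded_convergence (M := M)) => // k.
  exact: measurable_funTS.
- exists (fine (nu K)); split; first exact: fine_ge0.
  by move=> f M mf fM; apply: Rintegral_bounded => //; exact: measurable_funTS.
Qed.

Lemma jump_functionalB I J : jump_functional I -> jump_functional J ->
  jump_functional (fun f => I f - J f).
Proof.
move=> hI hJ; split.
- by move=> f g fg; rewrite (jump_ext hI fg) (jump_ext hJ fg).
- by move=> a b f g bf bg; rewrite (jump_lin hI)// (jump_lin hJ)//; ring.
- move=> f_ f M mf fM fl; apply: cvgB; [exact: jump_lim hI _ _ M mf fM fl|].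
  exact: jump_lim hJ _ _ M mf fM fl.
- have [C [C0 CP]] := jump_bound hI; have [C' [C'0 C'P]] := jump_bound hJ.
  exists (C + C'); split; first by rewrite addr_ge0.
  move=> f M mf fM; rewrite mulrDr; apply: le_trans (ler_normB _ _) _.
  by rewrite lerD// ?CP// C'P.
Qed.

(** [I None] integrates against m and [I (Some i)] against the i-th coordinate of mu. The latter is
    only signed, since basis vectors need not lie in [K], but the sum weighted by the coordinates of
    a point of [K] is a positive measure. *)
Lemma affine_jump_functionals (ip : {dot V for idfun}) (m : {measure set V -> \bar R}) mu
    (hmu : cone_valued_measure ip K mu) : (m K < +oo)%E ->
  exists I : option 'I_n -> (V -> R) -> R, [/\ forall i, jump_functional (I i),
    forall f, I None f = \int[m]_(x in K) f x &
    forall f x (Kx : K x), bounded_measurable setT f ->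
      \sum_i x i ord0 * I (Some i) f = \int[scalar_measure hmu Kx]_(y in K) f y].
Proof.
move=> moo; have [a [b [Ka [Kb ab]]]] := integral_scalar_measure_lin hmu hK.
exists (fun i f => if i is Some j then \int[scalar_measure hmu (Ka j)]_(y in K) f y -
  \int[scalar_measure hmu (Kb j)]_(y in K) f y else \int[m]_(y in K) f y).
split=> [[j|]|//|f x Kx bf]; last by rewrite (ab K f x Kx).
  by apply: jump_functionalB; apply: jump_functional_integral; exact: scalar_measure_lty.
exact: jump_functional_integral.
Qed.

End jump_functionals.

Section affine_exponents.
Context {R : realType} {n : nat}.
Local Notation V := 'cV[R]_n.
Context (ip : {dot V for idfun}) (K : set V) (hK : generating_proper_cone K).
Context (b : V) (B : 'M[R]_n) (m : {measure set V -> \bar R}) (mu : set V -> V).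
Hypothesis hpar : affine_parameters ip K b B m mu.
Let hmu := param_mu hpar.
Context (I : option 'I_n -> (V -> R) -> R).
Hypothesis hI : forall i, jump_functional K (I i).
Hypothesis I_m : forall f, I None f = \int[m]_(x in K) f x.
Hypothesis I_mu : forall f x (Kx : K x), bounded_measurable setT f ->
  \sum_i x i ord0 * I (Some i) f = \int[scalar_measure hmu Kx]_(y in K) f y.

Let mK : measurable K.
Proof. exact: closed_measurable_mx (cone_closed hK). Qed.

(** For [v] in [K] this is the integral of [f] against m + <v, mu>, the intensity of the jumps from
    the state [v]; the formula is affine in [v] on the whole space. *)
Definition jump_rate (v : V) (f : V -> R) : R :=
  I None f + \sum_i v i ord0 * I (Some i) f.

Lemma jump_rate_lin v (a c : R) f g : bounded_measurable setT f -> bounded_measurable setT g ->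
  jump_rate v (fun x => a * f x + c * g x) = a * jump_rate v f + c * jump_rate v g.
Proof.
move=> bf bg; rewrite /jump_rate (jump_lin (hI _))// !mulrDr !mulr_sumr addrACA -big_split/=.
by congr (_ + _); apply: eq_bigr => i _; rewrite (jump_lin (hI _))//; ring.
Qed.

Lemma jump_rate_ge0 v f : K v -> bounded_measurable setT f -> (forall x, K x -> 0 <= f x) ->
  0 <= jump_rate v f.
Proof.
move=> Kv bf f0; rewrite /jump_rate I_m (I_mu Kv bf).
by apply: addr_ge0; apply: Rintegral_ge0.
Qed.

Lemma cone_exp_ge0 u x : 0 <= cone_exp ip K u x.
Proof. by rewrite mulr_ge0 ?expR_ge0. Qed.

Lemma cone_exp_le1 u x : dual_cone ip K u -> cone_exp ip K u x <= 1.
Proof.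
move=> Ku; rewrite /cone_exp indicE; case: (boolP (x \in K)) => xK; last by rewrite mul0r.
by rewrite mul1r -expR0 ler_expR oppr_le0 Ku//; exact: set_mem.
Qed.

Lemma bounded_measurable_cone_exp u : dual_cone ip K u ->
  bounded_measurable setT (cone_exp ip K u).
Proof.
move=> Ku; split; last by exists 1 => x _; rewrite ger0_norm ?cone_exp_ge0 ?cone_exp_le1.
apply: measurable_funM; first exact: measurable_indic.
apply: measurableT_comp => //; apply: measurableT_comp => //.
exact: (measurable_fun_ip ip (@measurable_cst _ _ _ _ _ u) (@measurable_id _ _ _)).
Qed.

Let bm1 : bounded_measurable setT (fun _ : V => 1 : R).
Proof. by split; [exact: measurable_cst|exists 1 => x _; rewrite normr1]. Qed.

(** Both sides are minus the generator applied to exp(-<u, .>) at [x], divided by that exponential.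
    The transpose becomes the drift [B *m x], and the compensation by 1 becomes the total jump
    rate. *)
Lemma exponentE u x : dual_cone ip K u -> K x ->
  F_exponent ip K b m u + ip x (R_exponent ip K B mu u) =
  ip (b + B *m x) u - (jump_rate x (cone_exp ip K u) - jump_rate x (fun=> 1)).
Proof.
move=> Ku Kx; pose g y := 1 * cone_exp ip K u y + (-1) * 1.
have bg : bounded_measurable setT g.
  by apply: bounded_measurable_lin => //; exact: bounded_measurable_cone_exp.
have gE y : K y -> expR (- ip u y) - 1 = g y.
  by move=> Ky; rewrite /g /cone_exp indicE mem_set// !mul1r mulN1r.
rewrite /F_exponent (_ : \int[m]_(xi in K) _ = I None g); last first.
  by rewrite I_m; apply: eq_Rintegral => y; rewrite inE; exact: gE.
have vE : vintegral ip K mu K (fun xi => expR (- ip u xi) - 1) = vintegral ip K mu K g.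
  rewrite /vintegral; congr (xget _ _); apply/seteqP.
  by split=> v H y Ky; rewrite (H y Ky) !(integral_scalarizeE hmu Ky); apply: eq_integral => w; rewrite inE => Kw; rewrite gE.
rewrite /R_exponent vE linearBr/= adjE.
have -> : ip x (vintegral ip K mu K g) = \sum_i x i ord0 * I (Some i) g.
  rewrite I_mu//; apply: EFin_inj.
  rewrite (vintegralP hmu hK mK bg Kx) (integral_scalarizeE hmu Kx) /Rintegral fineK//.
  apply: integrable_fin_num => //; apply: bounded_measurable_integrable => //.
    exact: scalar_measure_lty.
  exact: bounded_measurable_funTS.
have -> : I None g = jump_rate x g - \sum_i x i ord0 * I (Some i) g by rewrite /jump_rate addrK.
rewrite jump_rate_lin//; last exact: bounded_measurable_cone_exp.
rewrite linearDl/=; ring.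
Qed.

End affine_exponents.

Section semigroup.
Context {R : realType} {n : nat}.
Local Notation V := 'cV[R]_n.
Context (p : R -> R.-spker V ~> V).

Lemma spker_le1 (t : R) x : (p t x setT <= 1)%E.
Proof. by apply: le_trans (@sprob_kernel _ _ _ _ _ (p t)); apply: ereal_sup_ubound; exists x. Qed.

Lemma spker_lty (t : R) x A : measurable A -> (p t x A < +oo)%E.
Proof.
move=> mA; apply: (@le_lt_trans _ _ 1%E); last exact: ltry.
by apply: le_trans (spker_le1 t x); apply: le_measure; rewrite ?inE.
Qed.

Definition semigroup (t : R) (h : V -> R) (y : V) : R := \int[p t y]_w h w.

Lemma semigroup_bounded t (h : V -> R) (M : R) y : 0 <= M -> measurable_fun setT h ->
  (forall w, `|h w| <= M) -> `|semigroup t h y| <= M.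
Proof.
move=> M0 mh hM; apply: (@le_trans _ _ (M * fine (p t y setT))).
  by apply: Rintegral_bounded => //; exact: spker_lty.
rewrite ler_piMr// -[leRHS]/(fine 1%:E) fine_le ?spker_le1//.
by rewrite ge0_fin_numE// spker_lty.

Qed.

Lemma semigroup_lin t (a c : R) f g y : bounded_measurable setT f -> bounded_measurable setT g ->
  semigroup t (fun w => a * f w + c * g w) y = a * semigroup t f y + c * semigroup t g y.
Proof. by move=> bf bg; apply: Rintegral_lin => //; exact: spker_lty. Qed.

Lemma semigroup_lim t (f_ : nat -> V -> R) f (M : R) y : (forall k, measurable_fun setT (f_ k)) ->
  (forall k x, `|f_ k x| <= M) -> (forall x, f_ k x @[k --> \oo] --> f x) ->
  (fun k => semigroup t (f_ k) y) @ \oo --> semigroup t f y.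
Proof.
move=> mf fM fl; apply: (bounded_convergence (M := M)) => //; exact: spker_lty.
Qed.

Lemma semigroup_indic t A y : measurable A -> semigroup t \1_A y = fine (p t y A).
Proof. by move=> mA; rewrite /semigroup /Rintegral integral_indic// setIT. Qed.

Lemma measurable_semigroup t h : bounded_measurable setT h ->
  measurable_fun setT (semigroup t h).
Proof.
move=> bh; suff [] : bounded_measurable setT h /\ measurable_fun setT (semigroup t h) by [].
move: h bh; apply: bounded_measurable_ind => [A mA|a c f g [bf mf] [bg mg]|f_ f M H fM fl].
- split; first exact: bounded_measurable_indic.
  rewrite (_ : semigroup t _ = fun y => fine (p t y A)); last first.
    by apply/funext => y; exact: semigroup_indic.
  by apply: measurableT_comp => //; exact: measurable_kernel.
- split; first exact: bounded_measurable_lin.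
  rewrite (_ : semigroup t _ = fun y => a * semigroup t f y + c * semigroup t g y).
    by apply: measurable_funD; apply: measurable_funM.
  by apply/funext => y; exact: semigroup_lin.
- have bf : bounded_measurable setT f.
    by apply: (@bounded_measurable_lim _ _ _ setT f_ f M) => // k; case: (H k).
  split=> //; apply: (measurable_fun_cvg (h := fun k => semigroup t (f_ k))).
    by move=> k; case: (H k).
  by move=> y _; apply: (semigroup_lim (M := M)) => // k; case: (H k) => -[].
Qed.

End semigroup.

Section duhamel_class.
Context {R : realType} {n : nat}.
Local Notation V := 'cV[R]_n.
Context (K : set V) (p : R -> R.-spker V ~> V) (I : option 'I_n -> (V -> R) -> R).
Hypothesis hI : forall i, jump_functional K (I i).
Context (t : R) (t0 : 0 < t) (w : R -> R) (y : R -> V) (x : V).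
Hypothesis cw : continuous w.
Hypothesis cy : continuous y.
Local Notation semigroup := (semigroup p).
Local Notation rate := (jump_rate I).

(** The expectation of [h] at the final time [t] after a jump of size [xi] at time [s] from the path
    [y], as a function of the jump size. *)
Definition shifted (h : V -> R) (s : R) (xi : V) : R := semigroup (t - s) h (y s + xi).

(* The decomposition of the transition semigroup at the first jump: w s is the
   probability that no jump occurs before s, and y is the path followed until then. *)
Definition duhamel_class (h : V -> R) := [/\ bounded_measurable setT h,
  forall i, measurable_fun `[0, t]%classic (fun s => I i (shifted h s)) &
  semigroup t h x = w t * h (y t) +
    \int[lebesgue_measure]_(s in `[0, t]) (w s * rate (y s) (shifted h s))].

Lemma bounded_measurable_shifted h s : bounded_measurable setT h ->
  bounded_measurable setT (shifted h s).
Proof.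
move=> bh; split.
  apply: (measurableT_comp (measurable_semigroup p (t - s) bh)).
  by apply: measurable_cVD => //; exact: measurable_cst.
have [mh [M hM]] := bh.
exists `|M| => xi _; apply: semigroup_bounded => // v.
exact: le_trans (hM v Logic.I) (ler_norm M).
Qed.

Let rate_bounded : exists2 C : R, 0 <= C & forall s (f : V -> R) (M : R), 0 <= s <= t ->
  measurable_fun setT f -> (forall xi, `|f xi| <= M) ->
  `|w s * rate (y s) f| <= C * M.
Proof.
have [W WP] := continuous_itv_bounded (ltW t0) cw.
have cn : continuous (fun s => `|y s|).
  by move=> s; apply: cvg_norm; exact: cy.
have [N NP] := continuous_itv_bounded (ltW t0) cn.
have /choice[c cP] := fun i => jump_bound (hI i).
exists (`|W| * (c None + \sum_i `|N| * c (Some i))).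
  rewrite mulr_ge0// addr_ge0 ?sumr_ge0//; first by case: (cP None).
  by move=> i _; rewrite mulr_ge0//; case: (cP (Some i)).
move=> s f M st mf fM; rewrite normrM -mulrA; apply: ler_pM => //.
  exact: le_trans (WP s st) (ler_norm _).
rewrite mulrDl mulr_suml; apply: le_trans (ler_normD _ _) _; apply: lerD.
  by rewrite mulrC; case: (cP None) => _; apply.
apply: le_trans (ler_norm_sum _ _ _) _; apply: ler_sum => i _.
rewrite normrM -mulrA; apply: ler_pM => //; last by rewrite mulrC; case: (cP (Some i)) => _; apply.
apply: le_trans (coord_le_norm _ _ _) _; have := NP s st; rewrite normr_id => H.
exact: le_trans H (ler_norm _).
Qed.

Let measurable_rate h : duhamel_class h ->
  measurable_fun `[0, t]%classic (fun s => w s * rate (y s) (shifted h s)).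
Proof.
move=> [_ mI _]; apply: measurable_funM; first exact: continuous_measurable_itv.
apply: measurable_funD; first exact: mI.
apply: measurable_sum => i; apply: measurable_funM; last exact: mI.
apply: continuous_measurable_itv => s.
have H := @cy s.
by have /cvg_mxP/(_ i ord0) := H.
Qed.

Lemma bounded_measurable_rate h : duhamel_class h ->
  bounded_measurable `[0, t]%classic (fun s => w s * rate (y s) (shifted h s)).
Proof.
move=> Dh; split; first exact: measurable_rate.
have [C C0 CP] := rate_bounded; have [[mh [M hM]] _ _] := Dh.
exists (C * `|M|) => s; rewrite /= in_itv/= => st.
have [mhs _] := bounded_measurable_shifted s (conj mh (ex_intro _ M hM)).
apply: CP => // xi; apply: semigroup_bounded => // v.
exact: le_trans (hM v Logic.I) (ler_norm M).
Qed.

Let lebesgue_itv_lty : (lebesgue_measure `[0%R, t]%classic < +oo)%E.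
Proof. by rewrite lebesgue_measure_itv/=; case: ifPn => _; rewrite ltry. Qed.

Lemma duhamel_lin (a c : R) f g : duhamel_class f -> duhamel_class g ->
  duhamel_class (fun v => a * f v + c * g v).
Proof.
move=> Df Dg; have [bf mf If] := Df; have [bg mg Ig] := Dg.
have sE s : shifted (fun v => a * f v + c * g v) s = fun xi => a * shifted f s xi + c * shifted g s xi.
  by apply/funext => xi; exact: semigroup_lin.
split=> [|i|]; first exact: bounded_measurable_lin.
  apply: (eq_measurable_fun (fun s => a * I i (shifted f s) + c * I i (shifted g s))).
    move=> s; rewrite inE/= in_itv/= => st; rewrite sE (jump_lin (hI i))//;
      exact: bounded_measurable_shifted.
  by apply: measurable_funD; apply: measurable_funM.
rewrite (semigroup_lin p t a c x bf bg) If Ig.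
have -> : \int[lebesgue_measure]_(s in `[0, t])
    (w s * rate (y s) (shifted (fun v => a * f v + c * g v) s)) =
  \int[lebesgue_measure]_(s in `[0, t]) (a * (w s * rate (y s) (shifted f s)) +
    c * (w s * rate (y s) (shifted g s))).
  apply: eq_Rintegral => s; rewrite inE/= in_itv/= => st.
  rewrite sE (jump_rate_lin hI)//; try exact: bounded_measurable_shifted.
  by rewrite mulrDr !(mulrCA (w s)).
rewrite (Rintegral_lin a c lebesgue_itv_lty (measurable_itv _)
  (bounded_measurable_rate Df) (bounded_measurable_rate Dg)).
by rewrite !mulrDr addrACA !(mulrCA (w t)).
Qed.

(** Bounded convergence on three levels: in the transition kernel, in the jump functionals, and in
    the integral over the time of the jump, where [rate_bounded] provides a uniform bound. *)
Lemma duhamel_lim (f_ : nat -> V -> R) f (M : R) : (forall k, duhamel_class (f_ k)) ->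
  (forall k v, `|f_ k v| <= M) -> (forall v, f_ k v @[k --> \oo] --> f v) -> duhamel_class f.
Proof.
move=> Df fM fl.
have M0 : 0 <= M by exact: le_trans (normr_ge0 _) (fM 0%N 0).
have mf_ k : measurable_fun setT (f_ k) by case: (Df k) => -[].
have bf : bounded_measurable setT f.
  by apply: (@bounded_measurable_lim _ _ _ setT f_ f M) => // k; case: (Df k).
have sl s xi : shifted (f_ k) s xi @[k --> \oo] --> shifted f s xi.
  by apply: (semigroup_lim (M := M)).
have sM s k xi : `|shifted (f_ k) s xi| <= M by exact: semigroup_bounded.
have ms k s : 0 <= s <= t -> measurable_fun setT (shifted (f_ k) s).
  by move=> st; have [] := @bounded_measurable_shifted (f_ k) s; first by case: (Df k).
have Il i s : 0 <= s <= t -> (fun k => I i (shifted (f_ k) s)) @ \oo --> I i (shifted f s).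
  by move=> st; apply: (jump_lim (hI i) (M := M)) => // k; exact: ms.
split=> // [i|].
  apply: (measurable_fun_cvg (h := fun k s => I i (shifted (f_ k) s))).
    by move=> k; case: (Df k).
  by move=> s; rewrite /= in_itv/=; exact: Il.
have l1 : (fun k => semigroup t (f_ k) x) @ \oo --> semigroup t f x.
  by apply: (semigroup_lim (M := M)).
have [C C0 CP] := rate_bounded.
have l2 : (fun k => w t * f_ k (y t) +
    \int[lebesgue_measure]_(s in `[0, t]) (w s * rate (y s) (shifted (f_ k) s))) @ \oo -->
  w t * f (y t) +
    \int[lebesgue_measure]_(s in `[0, t]) (w s * rate (y s) (shifted f s)).
  apply: cvgD; first by apply: cvgM; [exact: cvg_cst|exact: fl].
  apply: (bounded_convergence (M := C * M)) => //.
  - by move=> k; exact: measurable_rate.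
  - by move=> k s; rewrite /= in_itv/= => st; apply: CP => //; exact: ms.
  - move=> s; rewrite /= in_itv/= => st; apply: cvgM; first exact: cvg_cst.
    apply: cvgD; first exact: Il.
    by apply: cvg_sum_ord => i; apply: cvgM; [exact: cvg_cst|exact: Il].
apply: (cvg_unique _ l1) => //.
by rewrite (_ : (fun k => _) = fun k => semigroup t (f_ k) x) in l2 *; last by apply/funext => k; case: (Df k).
Qed.

End duhamel_class.

Section duhamel.
Context {R : realType} {n : nat}.
Local Notation V := 'cV[R]_n.
Context (ip : {dot V for idfun}) (K : set V) (hK : generating_proper_cone K).
Context (b : V) (B : 'M[R]_n) (m : {measure set V -> \bar R}) (mu : set V -> V).
Context (p : R -> R.-spker V ~> V) (phi : R -> V -> R) (psi : R -> V -> V).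
Hypothesis hpar : affine_parameters ip K b B m mu.
Hypothesis hker : affine_kernels ip K p phi psi.
Hypothesis hric : riccati ip K b B m mu phi psi.
Hypothesis h_flow : forall t : R, 0 <= t -> [set expmx (t *: B) *m x | x in K°] = K°.
Hypothesis h_tau : tau B < 0.
Let hmu := param_mu hpar.
Context (I : option 'I_n -> (V -> R) -> R).
Hypothesis hI : forall i, jump_functional K (I i).
Hypothesis I_m : forall f, I None f = \int[m]_(x in K) f x.
Hypothesis I_mu : forall f x (Kx : K x), bounded_measurable setT f ->
  \sum_i x i ord0 * I (Some i) f = \int[scalar_measure hmu Kx]_(y in K) f y.
Local Notation E t := (expmx (t *: B)).
Local Notation z := (equilibrium B b).
Local Notation Phi := (flow B b).
Local Notation rate := (jump_rate I).
Local Notation semigroup := (semigroup p).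

Let mK : measurable K.
Proof. exact: closed_measurable_mx (cone_closed hK). Qed.

Let Phi_cone (t : R) x : 0 <= t -> K x -> K (Phi t x).
Proof. exact: (flow_cone ip hK (param_b hpar) h_flow h_tau). Qed.

Lemma semigroup_cone_exp (t : R) u x : 0 <= t -> dual_cone ip K u -> K x ->
  semigroup t (cone_exp ip K u) x = expR (- phi t u - ip (psi t u) x).
Proof.
move=> t0 Ku Kx; rewrite /semigroup.
have -> : cone_exp ip K u = (fun w => expR (- ip u w)) \_ K.
  apply/funext => w; rewrite /cone_exp indicE patchE.
  by case: ifP => _; rewrite ?mul1r ?mul0r.
by rewrite -Rintegral_mkcond /Rintegral (kernels_affine hker).
Qed.

(** The expectation of an exponential bounded by 1 is at most 1, also from the starting points
    [r *: x]; so [phi t u + r * ip (psi t u) x] is nonnegative for all [r >= 0], which forces the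
    slope to be nonnegative. *)
Lemma psi_dual (t : R) u : 0 <= t -> dual_cone ip K u -> dual_cone ip K (psi t u).
Proof.
move=> t0 Ku x Kx.
have H (r : R) : 0 <= r -> 0 <= phi t u + r * ip (psi t u) x.
  move=> r0; have Krx : K (r *: x) by exact: coneZ hK _ _ r0 Kx.
  have := semigroup_cone_exp t0 Ku Krx.
  have : `|semigroup t (cone_exp ip K u) (r *: x)| <= 1.
    apply: semigroup_bounded => //; first by case: (bounded_measurable_cone_exp hK Ku).
    by move=> w; rewrite ger0_norm ?cone_exp_ge0 ?cone_exp_le1.
  move=> /[swap] ->; rewrite ger0_norm ?expR_ge0// -expR0 ler_expR linearZr_LR/=.
  by rewrite -opprD oppr_le0.
rewrite leNgt; apply/negP => neg.
(* With a negative slope, this value of [r] would bring the affine function down to -1. *)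
pose r := (phi t u + 1) / - ip (psi t u) x.
have p0 := kernels_phi_ge0 hker t0 Ku.
have r0 : 0 <= r by rewrite divr_ge0 ?oppr_ge0 ?(ltW neg)// addr_ge0.
have := H r r0.
rewrite /r invrN mulrN mulNr divfK ?lt_eqF//; lra.
Qed.

Let psi_ (u : V) (r : R) : V := psi (Num.max r 0) u.
Let phi_ (u : V) (r : R) : R := phi (Num.max r 0) u.

Let psi_dual_ u r : dual_cone ip K u -> dual_cone ip K (psi_ u r).
Proof. by move=> Ku; apply: psi_dual => //; rewrite le_max lexx orbT. Qed.

Let psi_coord u i (t : R) : 0 <= t -> dual_cone ip K u ->
  time_derivative (fun s => psi s u i ord0 : R^o) t (R_exponent ip K B mu (psi t u) i ord0).
Proof.
move=> t0 Ku; have /cvg_mxP/(_ i ord0) := riccati_psi hric t0 Ku.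
by apply: cvg_trans; apply: near_eq_cvg; apply: nearW => s; rewrite !mxE.
Qed.

Let continuous_psi u : dual_cone ip K u -> continuous (psi_ u).
Proof.
move=> Ku r; apply/cvg_mxP => i j; rewrite (ord1 j).
have H := time_derivative_continuous (f := fun s => psi s u i ord0)
  (l := fun t => R_exponent ip K B mu (psi t u) i ord0) (fun t t0 => @psi_coord u i t t0 Ku).
by have H' := H r; apply: H'.
Qed.

Let continuous_phi u : dual_cone ip K u -> continuous (phi_ u).
Proof. by move=> Ku; apply: (time_derivative_continuous (fun t t0 => riccati_phi hric t0 Ku)). Qed.

Let continuous_cone_exp i u : dual_cone ip K u ->
  continuous (fun r => I i (cone_exp ip K (psi_ u r))).
Proof.
move=> Ku r; apply/(@cvg_nbhsP R R^o) => a ar.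
apply: (jump_lim (hI i) (M := 1)) => [k|k x|x].
- by case: (bounded_measurable_cone_exp hK (psi_dual_ (a k) Ku)).
- by rewrite ger0_norm ?cone_exp_ge0 ?cone_exp_le1//; exact: psi_dual_.
- apply: cvgM; first exact: cvg_cst.
  apply: continuous_cvg; [exact: continuous_expR|apply: cvgN].
  apply: cvg_ip; last exact: cvg_cst.
  by have H := @continuous_psi u Ku r; apply: cvg_comp ar H.
Qed.

(** For exponentials the affine formula is explicit and continuous in time, and the monotone class
    carries joint measurability to indicators. The absolute value and the indicator of [K] make the
    function total on the product. *)
Lemma measurable_transition A : measurable A ->
  measurable_fun setT (fun q : R * V => \1_K q.2 * semigroup `|q.1| \1_(A `&` K) q.2).
Proof.
pose D (h : V -> R) := bounded_measurable setT h /\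
  measurable_fun setT (fun q : R * V => \1_K q.2 * semigroup `|q.1| h q.2).
suff H : forall A, measurable A -> D \1_(A `&` K) by move=> /H[].
have m1 (f : R -> R) : continuous f -> measurable_fun setT (fun q : R * V => f `|q.1|).
  move=> cf; have cn : continuous (fun r : R => f `|r|).
    by move=> r; apply: continuous_comp; [exact: norm_continuous|exact: cf].
  exact: (measurableT_comp (continuous_measurable_fun cn) (@measurable_fst _ _ _ _)).
have mK2 : measurable_fun setT (fun q : R * V => \1_K q.2 : R).
  have m1K : measurable_fun setT (\1_K : V -> R) by exact: measurable_indic.
  exact: (measurableT_comp m1K (@measurable_snd _ _ _ _)).
apply: (laplace_class_indic (ip := ip)) => // [u Ku|a c f g [bf mf] [bg mg]|f_ f M H fM fl].
- split; first exact: bounded_measurable_cone_exp.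
  rewrite (_ : (fun q => _) = fun q : R * V => \1_K q.2 *
      expR (- (phi_ u `|q.1| + ip (psi_ u `|q.1|) q.2))).
    apply: measurable_funM => //; apply: measurableT_comp => //.
    apply: measurableT_comp => //; apply: measurable_funD; first exact: m1 (continuous_phi Ku).
    apply: measurable_fun_ip => //; apply/measurable_cVP => i; apply: (m1 (fun r => psi_ u r i ord0)) => r.
    by have /cvg_mxP/(_ i ord0) := @continuous_psi u Ku r.
  apply/funext => q; rewrite indicE; case: (boolP (q.2 \in K)) => [/set_mem Kq|_]; last by rewrite !mul0r.
  by rewrite semigroup_cone_exp// /phi_ /psi_ max_l// opprD.
- split; first exact: bounded_measurable_lin.
  rewrite (_ : (fun q => _) = fun q : R * V => a * (\1_K q.2 * semigroup `|q.1| f q.2) +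
      c * (\1_K q.2 * semigroup `|q.1| g q.2)).
    by apply: measurable_funD; apply: measurable_funM.
  by apply/funext => q; rewrite semigroup_lin// mulrDr !(mulrCA (\1_K q.2)).
- split.
    by apply: (@bounded_measurable_lim _ _ _ setT f_ f M) => // k; case: (H k).
  apply: (measurable_fun_cvg (h := fun k (q : R * V) => \1_K q.2 * semigroup `|q.1| (f_ k) q.2)).
    by move=> k; case: (H k).
  move=> q _; apply: cvgM; first exact: cvg_cst.
  by apply: (semigroup_lim (M := M)) => // k; case: (H k) => -[].
Qed.

(** By the initial conditions of the Riccati equations the law at time 0 has the Laplace transform
    of the Dirac mass at [x]. *)
Lemma semigroup0 A x : measurable A -> K x -> semigroup 0 \1_(A `&` K) x = \1_(A `&` K) x.
Proof.
pose D (h : V -> R) := bounded_measurable setT h /\ (K x -> semigroup 0 h x = h x).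
suff H : forall A, measurable A -> D \1_(A `&` K) by move=> /H[].
apply: (laplace_class_indic (ip := ip)) => // [u Ku|a c f g [bf If] [bg Ig]|f_ f M H fM fl].
- split; first exact: bounded_measurable_cone_exp.
  move=> Kx; rewrite semigroup_cone_exp// (riccati_phi0 hric)// (riccati_psi0 hric)// oppr0 add0r.
  by rewrite /cone_exp indicE mem_set// mul1r.
- split; first exact: bounded_measurable_lin.
  by move=> Kx; rewrite semigroup_lin// If// Ig.
- split.
    by apply: (@bounded_measurable_lim _ _ _ setT f_ f M) => // k; case: (H k).
  move=> Kx; apply: (cvg_unique _ _ (fl x)) => //.
  rewrite (_ : (fun k => f_ k x) = fun k => semigroup 0 (f_ k) x).
    by apply: (semigroup_lim (M := M)) => // k; case: (H k) => -[].
  by apply/funext => k; case: (H k) => _ ->.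
Qed.

(** The integral over [0, s] of the total jump rate along the flow, in closed form: the integral of
    [Phi r x] over that interval is [s *: z + invmx B *m (E s *m (x - z)) - invmx B *m (x - z)]. *)
Definition hazard (x : V) (s : R) : R := s * I None (fun=> 1) +
  \sum_i (s *: z + invmx B *m (E s *m (x - z)) - invmx B *m (x - z)) i ord0 * I (Some i) (fun=> 1).

Lemma hazard0 x : hazard x 0 = 0.
Proof.
rewrite /hazard mul0r add0r big1// => i _.
by rewrite expmx0 mul1mx scale0r add0r subrr mxE mul0r.
Qed.

Lemma is_derive_hazard x (s : R) : is_derive s 1 (hazard x) (rate (Phi s x) (fun=> 1)).
Proof.
apply: is_deriveD.
  by rewrite -[X in is_derive _ _ _ X]mul1r; apply: is_derive_mulr; exact: is_derive_id.
apply: is_derive_sum_ord => i.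
pose Y s := s *: z + invmx B *m (E s *m (x - z)) - invmx B *m (x - z).
have Yd : is_derive_cV Y s (Phi s x).
  rewrite -[Phi s x]subr0; apply: is_derive_cVB; last exact: is_derive_cV_cst.
  apply: is_derive_cVD.
    by rewrite -[X in is_derive_cV _ _ X]scale1r; apply: is_derive_cVZ; exact: is_derive_id.
  rewrite -[X in is_derive_cV _ _ X](mulKmx (stable_unitmx h_tau)) (mulmxA B).
  by apply: is_derive_cV_mulmx; exact: is_derive_cV_expmx.
exact: is_derive_mulr (Yd i).
Qed.

Definition survival (x : V) (s : R) : R := expR (- hazard x s).

Section fixed.
Context (x : V) (Kx : K x) (t : R) (t0 : 0 < t).

(** Survival up to [s] times the Laplace transform for the remaining time [t - s] from the drifted
    point. At [s = 0] it is the full transform from [x]; at [s = t] it is the contribution of the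
    paths without jump. *)
Let G u (s : R) := expR (- (hazard x s + phi_ u (t - s) + ip (psi_ u (t - s)) (Phi s x))).

(** The hazard contributes the total jump rate, the Riccati equations contribute minus the
    expression in [exponentE], and the moving point contributes the drift. The drift and the total
    rate cancel, leaving the jump term. *)
Let is_derive_G u s : dual_cone ip K u -> 0 < s < t ->
  is_derive s 1 (G u) (- (G u s * rate (Phi s x) (cone_exp ip K (psi_ u (t - s))))).
Proof.
move=> Ku /andP[s0 st]; have ts0 : 0 < t - s by rewrite subr_gt0.
have tsE : Num.max (t - s) 0 = t - s by rewrite max_l// ltW.
have dts : is_derive s 1 (fun r : R => t - r) (-1).
  by have := is_deriveD (is_derive_cst t s 1) (is_deriveN (is_derive_id s 1)); rewrite add0r.
have dphi : is_derive s 1 (fun r => phi_ u (t - r)) (- F_exponent ip K b m (psi_ u (t - s))).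
  have H := time_derivative_is_derive ts0 (riccati_phi hric (ltW ts0) Ku).
  by have := is_derive1_comp (f := phi_ u) (g := fun r => t - r) H dts; rewrite mulrN1 /psi_ tsE.
have dpsi : is_derive_cV (fun r => psi_ u (t - r)) s (- R_exponent ip K B mu (psi_ u (t - s))).
  move=> i; rewrite mxE.
  have H := time_derivative_is_derive ts0 (@psi_coord u i _ (ltW ts0) Ku).
  by have := is_derive1_comp (g := fun r => t - r) H dts; rewrite mulrN1 /psi_ tsE.
have dx : is_derive_cV (fun r => Phi r x) s (B *m Phi s x + b) by exact: is_derive_flow.
have dip := is_derive_ip ip dpsi dx.
have dG := is_deriveN (is_deriveD (is_deriveD (is_derive_hazard x s) dphi) dip).
have := is_derive1_comp (is_derive_expR _) dG; rewrite -/(G u s).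
congr (is_derive _ _ _ _); rewrite -mulrN; congr (_ * _).
have := exponentE hK hI I_m I_mu (psi_dual_ (t - s) Ku) (Phi_cone (ltW s0) Kx).
rewrite linearNl/= (ipC ip (psi_ u (t - s))) (addrC (B *m _)) (ipC _ (R_exponent _ _ _ _ _)) => H.
by rewrite -(addrK (F_exponent ip K b m (psi_ u (t - s))) (ip _ (R_exponent _ _ _ _ _))) (addrC _ (F_exponent _ _ _ _ _)) H; ring.
Qed.

Let continuous_G u : dual_cone ip K u -> continuous (G u).
Proof.
move=> Ku s.
have ct : (t - r) @[r --> s] --> t - s by apply: cvgB; [exact: cvg_cst|exact: cvg_id].
apply: continuous_cvg; [exact: continuous_expR|apply: cvgN; apply: cvgD; [apply: cvgD|]].
- by apply: differentiable_continuous; apply/derivable1_diffP; have [] := is_derive_hazard x s.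
- by have H := @continuous_phi u Ku (t - s); apply: cvg_comp ct H.
- apply: cvg_ip; last exact: continuous_flow.
  by have H := @continuous_psi u Ku (t - s); apply: cvg_comp ct H.
Qed.

Let continuous_jump u i : dual_cone ip K u ->
  continuous (fun s => I i (cone_exp ip K (psi_ u (t - s)))).
Proof.
move=> Ku s.
have ct : (t - r) @[r --> s] --> t - s by apply: cvgB; [exact: cvg_cst|exact: cvg_id].
by have H := @continuous_cone_exp i u Ku (t - s); apply: cvg_comp ct H.
Qed.

Let continuous_rate u : dual_cone ip K u ->
  continuous (fun s => rate (Phi s x) (cone_exp ip K (psi_ u (t - s)))).
Proof.
move=> Ku s; apply: cvgD; first exact: continuous_jump.
apply: cvg_sum_ord => i; apply: cvgM; last exact: continuous_jump.
have H := @continuous_flow R n B b x s.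
by have /cvg_mxP/(_ i ord0) := H.
Qed.

Let G_integral u : dual_cone ip K u ->
  G u 0 = G u t + \int[lebesgue_measure]_(s in `[0, t])
    (G u s * rate (Phi s x) (cone_exp ip K (psi_ u (t - s)))).
Proof.
move=> Ku; apply: (Rintegral_is_deriveN t0 (continuous_G Ku)) => [s|s st].
  by apply: cvgM; [exact: continuous_G|exact: continuous_rate].
exact: is_derive_G.
Qed.

Lemma continuous_survival : continuous (survival x).
Proof.
move=> s; apply: continuous_cvg; [exact: continuous_expR|apply: cvgN].
by apply: differentiable_continuous; apply/derivable1_diffP; have [] := is_derive_hazard x s.
Qed.

Local Notation shifted := (shifted p t (fun s => Phi s x)).
Local Notation duhamel_class := (duhamel_class p I t (survival x) (fun s => Phi s x) x).

(** An exponential of a linear form is multiplicative in the starting point, so the jump size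
    separates from the position before the jump. *)
Let shifted_cone_exp u s xi : dual_cone ip K u -> 0 <= s <= t -> K xi ->
  shifted (cone_exp ip K u) s xi =
  expR (- (phi_ u (t - s) + ip (psi_ u (t - s)) (Phi s x))) * cone_exp ip K (psi_ u (t - s)) xi.
Proof.
move=> Ku /andP[s0 st] Kxi; have ts0 : 0 <= t - s by rewrite subr_ge0.
have KPx : K (Phi s x + xi) by apply: (coneD hK) => //; exact: Phi_cone.
rewrite /shifted semigroup_cone_exp// /phi_ /psi_ max_l// /cone_exp indicE mem_set// mul1r -expRD.
by congr expR; rewrite linearDr/=; ring.
Qed.

Let duhamel_exp u : dual_cone ip K u -> duhamel_class (cone_exp ip K u).
Proof.
move=> Ku; have bu := bounded_measurable_cone_exp hK Ku.
pose e s := expR (- (phi_ u (t - s) + ip (psi_ u (t - s)) (Phi s x))).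
have IE i s : 0 <= s <= t -> I i (shifted (cone_exp ip K u) s) =
    e s * I i (cone_exp ip K (psi_ u (t - s))).
  move=> st; have bc := bounded_measurable_cone_exp hK (psi_dual_ (t - s) Ku).
  rewrite -[RHS]addr0 -(mul0r (I i (cone_exp ip K (psi_ u (t - s))))) -(jump_lin (hI i))//.
  by apply: (jump_ext (hI i)) => xi Kxi; rewrite shifted_cone_exp// mul0r addr0.
split=> // [i|].
  apply: (eq_measurable_fun (fun s => e s * I i (cone_exp ip K (psi_ u (t - s))))).
    by move=> s; rewrite inE/= in_itv/= => st; rewrite IE.
  apply: continuous_measurable_itv => s; apply: cvgM; last exact: continuous_jump.
  have ct : (t - r) @[r --> s] --> t - s by apply: cvgB; [exact: cvg_cst|exact: cvg_id].
  apply: continuous_cvg; [exact: continuous_expR|apply: cvgN; apply: cvgD].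
  - by have H := @continuous_phi u Ku (t - s); apply: cvg_comp ct H.
  - apply: cvg_ip; last exact: continuous_flow.
    by have H := @continuous_psi u Ku (t - s); apply: cvg_comp ct H.
have := G_integral Ku; rewrite /G hazard0 subrr subr0 add0r flow0.
rewrite {1}/phi_ {1}/psi_ max_l ?(ltW t0)// opprD => E1.
rewrite semigroup_cone_exp ?(ltW t0)// E1; congr (_ + _).
  rewrite /survival /cone_exp indicE mem_set; last exact: Phi_cone (ltW t0) Kx.
  rewrite mul1r -expRD /phi_ /psi_ max_l// (riccati_phi0 hric)// (riccati_psi0 hric)//.
  by congr expR; rewrite addr0 opprD.
apply: eq_Rintegral => s; rewrite inE/= in_itv/= => st.
have -> : rate (Phi s x) (shifted (cone_exp ip K u) s) =
    e s * rate (Phi s x) (cone_exp ip K (psi_ u (t - s))).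
  rewrite /jump_rate IE// mulrDr mulr_sumr; congr (_ + _).
  by apply: eq_bigr => i _; rewrite IE// mulrCA.
by rewrite mulrA /survival /e -expRD -addrA opprD.
Qed.

Lemma duhamel A : measurable A -> duhamel_class \1_(A `&` K).
Proof.
have cP : continuous (fun s => Phi s x) by exact: continuous_flow.
apply: (laplace_class_indic hK duhamel_exp) => [a c f g|f_ f M].
  exact: (duhamel_lin hI t0 continuous_survival cP).
exact: (duhamel_lim hI t0 continuous_survival cP).
Qed.

End fixed.

End duhamel.

(** * Minorization by one jump *)

Section positivity.
Context {R : realType} {d : measure_display} {T : measurableType d}.
Context (nu : {measure set T -> \bar R}).

Lemma measure_bigcup_gt0 (F : (set T)^nat) : (forall k, measurable (F k)) ->
  (0 < nu (\bigcup_k F k))%E -> exists k, (0 < nu (F k))%E.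
Proof.
move=> mF F0; apply: contrapT => nF.
have : nu.-negligible (\bigcup_k F k).
  apply: negligible_bigcup => k; apply/negligibleP => //.
  by apply/eqP; rewrite eq_le measure_ge0 leNgt andbT; apply/negP => H; apply: nF; exists k.
move=> /negligibleP F00; move: F0; rewrite F00 ?ltxx//.
exact: bigcup_measurable.
Qed.

Lemma integral_gt0 (D S : set T) (f : T -> \bar R) :
  measurable D -> measurable S -> S `<=` D -> measurable_fun D f ->
  (forall x, D x -> (0 <= f x)%E) -> (forall x, S x -> (0 < f x)%E) ->
  (0 < nu S)%E -> (0 < \int[nu]_(x in D) f x)%E.
Proof.
move=> mD mS SD mf f0 fS nuS; rewrite lt0e integral_ge0// andbT.
apply/eqP => int0.
have E0 : (\int[nu]_(x in D) `|f x| = 0)%E.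
  by rewrite -int0; apply: eq_integral => x; rewrite inE => Dx; rewrite gee0_abs// f0.
have [N [mN N0 DN]] := (ae_eq_integral_abs nu mD mf).1 E0.
suff : (nu S <= nu N)%E by rewrite N0 leNgt nuS.
apply: le_measure; rewrite ?inE// => x Sx; apply: DN => /= /(_ (SD x Sx)) fx0.
by have := fS x Sx; rewrite fx0 ltxx.
Qed.

Lemma integral_gt0_level (f : T -> \bar R) : measurable_fun setT f ->
  (forall x, (0 <= f x)%E) -> (0 < \int[nu]_x f x)%E ->
  exists2 e : R, 0 < e & (0 < nu [set x | (e%:E <= f x)%E])%E.
Proof.
move=> mf f0 If.
have mL (e : R) : measurable [set x | (e%:E <= f x)%E].
  by rewrite -[X in measurable X]setTI; exact: emeasurable_fun_c_infty.
suff [k kf] : exists k, (0 < nu [set x | ((k.+1%:R^-1 : R)%:E <= f x)%E])%E.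
  by exists k.+1%:R^-1 => //; rewrite invr_gt0.
apply: measure_bigcup_gt0 => //.
rewrite lt0e measure_ge0 andbT; apply/eqP => U0.
suff : (\int[nu]_x f x = 0)%E by move=> I0; rewrite I0 ltxx in If.
rewrite (@ae_eq_integral _ _ _ nu setT (cst 0%E) f)//; first by rewrite integral0.
exists (\bigcup_k [set x | ((k.+1%:R^-1 : R)%:E <= f x)%E]); split=> //.
  exact: bigcup_measurable.
move=> x /= /not_implyP[_ fx].
have fx0 : (0 < f x)%E by rewrite lt0e f0 andbT; exact/eqP.
case fE : (f x) fx0 => [r| |]//; last by exists 0%N => //=; rewrite fE leey.
rewrite lte_fin => r0.
have [k _ kr] := near_infty_natSinv_lt (PosNum r0).
by exists k => //=; rewrite fE lee_fin ltW//; exact: kr (leqnn k).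
Qed.

Lemma Rintegral_gt0 (D S : set T) (f : T -> R) :
  (nu D < +oo)%E -> measurable D -> measurable S -> S `<=` D ->
  bounded_measurable D f -> (forall x, D x -> 0 <= f x) -> (forall x, S x -> 0 < f x) ->
  (0 < nu S)%E -> 0 < \int[nu]_(x in D) f x.
Proof.
move=> nuoo mD mS SD bf f0 fS nuS; have intf := bounded_measurable_integrable nuoo mD bf.
rewrite -lte_fin /Rintegral fineK; last exact: integrable_fin_num.
by apply: (integral_gt0 mD mS SD) => //; apply/measurable_EFinP; case: bf.
Qed.

End positivity.

Section first_jump.
Context {R : realType} {n : nat}.
Local Notation V := 'cV[R]_n.
Context (ip : {dot V for idfun}) (K : set V) (hK : generating_proper_cone K).
Context (b : V) (B : 'M[R]_n) (m : {measure set V -> \bar R}) (mu : set V -> V).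
Context (p : R -> R.-spker V ~> V) (phi : R -> V -> R) (psi : R -> V -> V).
Hypothesis hpar : affine_parameters ip K b B m mu.
Hypothesis hker : affine_kernels ip K p phi psi.
Hypothesis hric : riccati ip K b B m mu phi psi.
Hypothesis h_flow : forall t : R, 0 <= t -> [set expmx (t *: B) *m x | x in K°] = K°.
Hypothesis h_tau : tau B < 0.
Hypothesis m_finite : (m K < +oo)%E.
Let hmu := param_mu hpar.
Context (I : option 'I_n -> (V -> R) -> R).
Hypothesis hI : forall i, jump_functional K (I i).
Hypothesis I_m : forall f, I None f = \int[m]_(x in K) f x.
Hypothesis I_mu : forall f x (Kx : K x), bounded_measurable setT f ->
  \sum_i x i ord0 * I (Some i) f = \int[scalar_measure hmu Kx]_(y in K) f y.
Local Notation E t := (expmx (t *: B)).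
Local Notation z := (equilibrium B b).
Local Notation Phi := (flow B b).
Local Notation rate := (jump_rate I).
Local Notation survival := (survival b B I).
Local Notation leb := (@lebesgue_cV R n).

Let mK : measurable K.
Proof. exact: closed_measurable_mx (cone_closed hK). Qed.

Let Phi_cone (t : R) x : 0 <= t -> K x -> K (Phi t x).
Proof. exact: (flow_cone ip hK (param_b hpar) h_flow h_tau). Qed.

Lemma jump_rate_le v f g : K v -> bounded_measurable setT f -> bounded_measurable setT g ->
  (forall x, K x -> f x <= g x) -> rate v f <= rate v g.
Proof.
move=> Kv bf bg fg.
have := jump_rate_lin hI v 1 (-1) bg bf; rewrite mul1r mulN1r => E1.
rewrite -subr_ge0 -E1; apply: (jump_rate_ge0 I_m I_mu) => //.
  exact: bounded_measurable_lin.
by move=> x Kx; rewrite mul1r mulN1r subr_ge0 fg.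
Qed.

(** A real-valued form of the kernel, with the indicator of [A] cut to [K], the shape delivered by
    the monotone class; [spker_transition] identifies it with the kernel at states in [K]. *)
Definition transition (t : R) (A : set V) (y : V) : R := semigroup p t \1_(A `&` K) y.

Lemma transitionE t A y : measurable A -> transition t A y = fine (p t y (A `&` K)).
Proof. by move=> mA; rewrite /transition semigroup_indic//; exact: measurableI. Qed.

Lemma transition_ge0 t A y : measurable A -> 0 <= transition t A y.
Proof. by move=> mA; rewrite transitionE// fine_ge0. Qed.

Lemma spker_transition t A y : 0 <= t -> K y -> measurable A -> p t y A = (transition t A y)%:E.
Proof.
move=> t0 Ky mA; rewrite transitionE// fineK; last first.
  by rewrite ge0_fin_numE// spker_lty//; exact: measurableI.
apply/eqP; rewrite eq_le; apply/andP; split; last first.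
  by apply: le_measure; rewrite ?inE//; exact: measurableI.
rewrite -[leRHS]adde0 -(kernels_carrier hker t0 Ky).
apply: le_trans (measureU2 _ _ _); [|exact: measurableI|exact: measurableC].
apply: le_measure; rewrite ?inE//.
  by apply: measurableU; [exact: measurableI|exact: measurableC].
by move=> x Ax; have [Kx|nKx] := pselect (K x); [left|right].
Qed.

Section at_time.
Context (x : V) (Kx : K x) (t : R) (t0 : 0 < t) (A : set V) (mA : measurable A).

(** The density in [s] of the event that the first jump occurs at time [s] and the process is in [A]
    at time [t]. *)
Definition jump_flux (s : R) : R :=
  survival x s * rate (Phi s x) (fun xi => transition (t - s) A (Phi s x + xi)).

Lemma transition_first_jump : transition t A x = survival x t * \1_(A `&` K) (Phi t x) +
  \int[lebesgue_measure]_(s in `[0, t]) jump_flux s.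
Proof. by rewrite /transition; have [_ _ ->] := duhamel hK hker hric h_flow h_tau hI I_m I_mu Kx t0 mA. Qed.

Lemma bounded_measurable_after s : bounded_measurable setT (fun xi => transition (t - s) A (Phi s x + xi)).
Proof.
apply: (@bounded_measurable_shifted _ _ p t (fun s => Phi s x) (\1_(A `&` K)) s).
by apply: bounded_measurable_indic; exact: measurableI.
Qed.

Lemma bounded_measurable_jump_flux : bounded_measurable `[0, t]%classic jump_flux.
Proof.
have cP : continuous (fun s => Phi s x) by exact: continuous_flow.
have cs : continuous (survival x) by exact: continuous_survival.
have D := duhamel hK hker hric h_flow h_tau hI I_m I_mu Kx t0 mA.
exact: (bounded_measurable_rate hI t0 cs cP D).
Qed.

Lemma jump_flux_ge0 s : 0 <= s <= t -> 0 <= jump_flux s.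
Proof.
move=> /andP[s0 st]; rewrite mulr_ge0 ?expR_ge0//.
apply: (jump_rate_ge0 I_m I_mu) => //; [exact: Phi_cone|exact: bounded_measurable_after|].
by move=> xi _; exact: transition_ge0.
Qed.

End at_time.

Lemma survival_gt0 x s : 0 < survival x s.
Proof. exact: expR_gt0. Qed.

Lemma survival0 x : survival x 0 = 1.
Proof. by rewrite /survival hazard0 oppr0 expR0. Qed.

Lemma no_jump_le x (t : R) A : K x -> 0 <= t -> measurable A -> A (Phi t x) ->
  survival x t <= transition t A x.
Proof.
move=> Kx; rewrite le_eqVlt => /predU1P[<-|t0] mA; rewrite ?flow0 => APx.
  by rewrite survival0 /transition (semigroup0 hK hker hric mA Kx) indicE mem_set.
rewrite transition_first_jump// indicE mem_set ?mulr1; last by split=> //; exact: Phi_cone (ltW t0) Kx.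
rewrite lerDl; apply: Rintegral_ge0 => s; rewrite /= in_itv/=; exact: jump_flux_ge0.
Qed.

(** The sizes of a jump at time [r] before the end that bring the path into [A] if no other jump
    occurs, [v] being the end point without the jump: the flow is affine, so a jump [xi] displaces
    the end point by [E r *m xi]. *)
Definition landing (v : V) (r : R) (A : set V) : set V := [set xi | A (v + E r *m xi)].

Lemma no_jump_after x s t xi A : K x -> 0 <= s <= t -> K xi -> measurable A ->
  survival (Phi s x + xi) (t - s) * \1_(landing (Phi t x) (t - s) A) xi <=
  transition (t - s) A (Phi s x + xi).
Proof.
move=> Kx /andP[s0 st] Kxi mA; rewrite indicE.
case: (boolP (xi \in _)) => [/set_mem/= Axi|_]; last by rewrite mulr0 transition_ge0.
rewrite mulr1; apply: no_jump_le => //; last by rewrite flowD_jump (addrC s) subrK.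
  by apply: (coneD hK) => //; exact: Phi_cone.
by rewrite subr_ge0.
Qed.

Lemma measurable_landing (A : set V) v r : measurable A -> measurable (landing v r A).
Proof.
move=> mA; apply: (measurable_preimageT (f := fun xi : V => v + E r *m xi)) => //.
apply: measurable_cVD; [exact: measurable_cst|exact: measurable_mulmx_cst].
Qed.

Lemma measurable_landing_mass (D A : set V) v (t : R) : measurable D -> measurable A ->
  measurable_fun setT (fun s : R => leb (D `&` landing v (t - s)%R A)).
Proof.
move=> mD mA; pose T := [set q : R * V | D q.2 /\ A (v + E (t - q.1) *m q.2)].
rewrite (_ : (fun s => _) = fun s => leb (xsection T s)); last first.
  apply/funext => s; congr (leb _); apply/seteqP; split=> [xi [Dxi Axi]|xi].
    by rewrite /xsection/= inE.
  by rewrite /xsection/= inE.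
apply: measurable_fun_xsection.
rewrite (_ : T = (fun q => q.2) @^-1` D `&` (fun q => v + E (t - q.1) *m q.2) @^-1` A)//.
apply: measurableI; rewrite -[X in measurable X]setTI.
  exact: (@measurable_snd _ _ _ _).
have mPE : measurable_fun setT (fun q : R * V => v + E (t - q.1) *m q.2).
  apply: measurable_cVD; first exact: measurable_cst.
  apply: measurable_fun_mulmx => [i j|]; last exact: measurable_snd.
  have cE : continuous (fun r : R => E (t - r) i j).
    move=> r; have ct : (t - r') @[r' --> r] --> t - r by apply: cvgB; [exact: cvg_cst|exact: cvg_id].
    have /cvg_mxP/(_ i j) H := @continuous_expmx R n B (t - r).
    by apply: cvg_comp ct H.
  exact: (measurableT_comp (continuous_measurable_fun cE) (@measurable_fst _ _ _ _)).
exact: mPE.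
Qed.

(** Only the paths with exactly one jump are kept: survival before it, a jump that lands in [A],
    survival after it. Which of the two jump measures charges the landing set may depend on the time
    [s] of the jump. *)
Lemma one_jump_gt0 x (t : R) A : K x -> 0 < t -> measurable A ->
  (forall s, 0 < s < t -> (0 < m (K `&` landing (Phi t x) (t - s)%R A))%E \/
    (0 < scalarize ip mu (Phi s x) (K `&` landing (Phi t x) (t - s)%R A))%E) ->
  0 < transition t A x.
Proof.
move=> Kx t0 mA Ajump; rewrite transition_first_jump//.
have Jpos s : 0 < s < t -> 0 < jump_flux x t A s.
  move=> /andP[s0 st]; have KPs := Phi_cone (ltW s0) Kx.
  have mS : measurable (K `&` landing (Phi t x) (t - s)%R A).
    by apply: measurableI => //; exact: measurable_landing.
  have bm := bounded_measurable_after x t mA s.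
  have f0 xi : 0 <= transition (t - s) A (Phi s x + xi) by exact: transition_ge0.
  have fS xi : (K `&` landing (Phi t x) (t - s) A) xi ->
      0 < transition (t - s) A (Phi s x + xi).
    move=> [Kxi Axi]; have := no_jump_after (s := s) (t := t) Kx _ Kxi mA.
    rewrite (ltW s0) (ltW st) indicE mem_set// mulr1 => /(_ isT); apply: lt_le_trans.
    exact: survival_gt0.
  rewrite mulr_gt0 ?survival_gt0// /jump_rate I_m (I_mu KPs bm).
  have [mS0|muS0] := Ajump s (introT andP (conj s0 st)).
  - apply: ltr_pwDl; last by apply: Rintegral_ge0.
    exact: (Rintegral_gt0 m_finite mK mS _ (bounded_measurable_funTS mK bm) _ fS mS0).
  - apply: ltr_wpDl; first by apply: Rintegral_ge0.
    apply: (Rintegral_gt0 _ mK mS _ (bounded_measurable_funTS mK bm) _ fS) => //.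
      exact: scalar_measure_lty.
    by move: muS0; rewrite /scalarize -(scalar_measureE hmu KPs mS).
rewrite ltr_wpDl//; first by rewrite mulr_ge0 ?expR_ge0.
apply: (@Rintegral_gt0 _ _ _ lebesgue_measure _ `]0, t[%classic) => //.
- by rewrite /= lebesgue_measure_itv/=; case: ifPn => _; rewrite ltry.
- by apply: subset_itv; rewrite bnd_simp.
- exact: bounded_measurable_jump_flux.
- by move=> s; rewrite /= in_itv/=; exact: jump_flux_ge0.
- by rewrite /= lebesgue_measure_itv/= lte_fin t0 oppr0 adde0 lte_fin.
Qed.

Lemma jump_rate_indicE v S (Kv : K v) : measurable S -> S `<=` K ->
  rate v \1_S = fine (m S) + ip v (mu S).
Proof.
move=> mS SK; have bS : bounded_measurable setT (\1_S : V -> R) by exact: bounded_measurable_indic.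
rewrite /jump_rate I_m (I_mu Kv bS) /Rintegral !integral_indic// (setIidl SK).
by congr (_ + _); apply: (congr1 fine (scalar_measureE hmu Kv mS)).
Qed.

Lemma one_jump_ge x (t w c : R) (D A : set V) : K x -> 0 < t -> measurable A ->
  measurable D -> D `<=` K -> (leb D < +oo)%E -> 0 < w -> 0 <= c ->
  (forall s, 0 <= s <= t -> w <= survival x s) ->
  (forall s xi, 0 <= s <= t -> D xi -> w <= survival (Phi s x + xi) (t - s)) ->
  (forall s S, 0 <= s <= t -> measurable S -> S `<=` D -> c * fine (leb S) <= rate (Phi s x) \1_S) ->
  ((w * (w * c))%:E * \int[lebesgue_measure]_(s in `[0%R, t])
    leb (D `&` landing (Phi t x) (t - s)%R A) <= (transition t A x)%:E)%E.
Proof.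
move=> Kx t0 mA mD DK Doo w0 c0 wx wxi cS.
have mS s : measurable (D `&` landing (Phi t x) (t - s) A).
  by apply: measurableI => //; exact: measurable_landing.
have lS s : (leb (D `&` landing (Phi t x) (t - s)%R A) < +oo)%E.
  by apply: le_lt_trans Doo; apply: le_measure; rewrite ?inE//; exact: subIsetl.
have fluxS s : 0 <= s <= t ->
    w * (w * c) * fine (leb (D `&` landing (Phi t x) (t - s) A)) <= jump_flux x t A s.
  move=> st; have /andP[s0 _] := st; have KPs := Phi_cone s0 Kx.
  set S := D `&` _; have mSs : measurable S by exact: mS.
  rewrite -mulrA; apply: ler_pM; [exact: ltW| |exact: wx|].
    by rewrite !mulr_ge0 ?fine_ge0// ltW.
  have bS : bounded_measurable setT (\1_S : V -> R) by exact: bounded_measurable_indic.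
  have bm := bounded_measurable_after x t mA s.
  (* The padding by a zero multiple gives the shape of a linear combination on which [jump_rate_lin]
     acts. *)
  apply: (@le_trans _ _ (rate (Phi s x) (fun xi => w * \1_S xi + 0 * \1_S xi))).
    rewrite (jump_rate_lin hI)// mul0r addr0 -mulrA ler_wpM2l//; first exact: ltW.
    by apply: cS => //; exact: subIsetl.
  apply: jump_rate_le => //; first exact: bounded_measurable_lin.
  move=> xi Kxi; rewrite mul0r addr0 indicE.
  case: (boolP (xi \in S)) => [/set_mem[Dxi Axi]|_]; last by rewrite mulr0 transition_ge0.
  have := no_jump_after Kx st Kxi mA; rewrite indicE mem_set// !mulr1.
  by apply: le_trans; exact: wxi.
rewrite transition_first_jump//.
have bJ := bounded_measurable_jump_flux Kx t0 mA.
have tlty : (lebesgue_measure `[0%R, t]%classic < +oo)%E.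
  by rewrite lebesgue_measure_itv/=; case: ifPn => _; rewrite ltry.
have intJ := bounded_measurable_integrable tlty (measurable_itv _) bJ.
rewrite EFinD -[leLHS]add0e; apply: leeD; first by rewrite lee_fin mulr_ge0 ?expR_ge0.
rewrite /Rintegral fineK; last exact: integrable_fin_num.
have mL : measurable_fun `[0%R, t]%classic (fun s => leb (D `&` landing (Phi t x) (t - s)%R A)).
  by apply: measurable_funTS; exact: measurable_landing_mass.
rewrite -ge0_integralZl//; last by rewrite lee_fin !mulr_ge0// ltW.
apply: ge0_le_integral => //.
- by move=> s _; rewrite mule_ge0// lee_fin !mulr_ge0// ltW.
- exact: measurable_funeM.
- by apply/measurable_EFinP; case: bJ.
- move=> s; rewrite /= in_itv/= => st.
  rewrite -[X in (_ * X)%E]fineK ?ge0_fin_numE//.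
  by rewrite -EFinM lee_fin; exact: fluxS.
Qed.

End first_jump.

Section ac_component.
Context {R : realType} {n : nat}.
Local Notation V := 'cV[R]_n.
Local Notation leb := (@lebesgue_cV R n).

(** The sets bound the density from below by [k.+1%:R^-1] and the norm from above by [k]; strict
    positivity makes them exhaust [U], and the remaining component only adds mass. *)
Lemma ac_component_lower (nu : set V -> \bar R) (U : set V) : open U ->
  has_positive_ac_component nu U -> exists D : (set V)^nat,
  [/\ forall k, measurable (D k), forall k x, D k x -> U x /\ `|x| <= k%:R, \bigcup_k D k = U &
    forall k S, measurable S -> ((k.+1%:R^-1 : R)%:E * leb (S `&` D k) <= nu S)%E].
Proof.
move=> oU [f [s [mf f0 fU _ nuE]]].
have mU : measurable U by exact: open_measurable_mx.
exists (fun k => U `&` [set x | (k.+1%:R^-1 : R) <= f x] `&` [set x | `|x| <= k%:R]).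
have mD k : measurable (U `&` [set x | (k.+1%:R^-1 : R) <= f x] `&` [set x | `|x| <= k%:R]).
  apply: measurableI; first apply: measurableI => //.
    rewrite -[X in measurable X]setTI (_ : [set x | _] = f @^-1` `[(k.+1%:R^-1 : R), +oo[%classic).
      exact: mf.
    by apply/seteqP; split=> x /=; rewrite in_itv/= andbT.
  rewrite -[X in measurable X]setTI (_ : [set x : V | _] = (fun x : V => `|x|) @^-1` `]-oo, (k%:R : R)]%classic).
    exact: measurable_norm_cV.
  by apply/seteqP; split=> x /=; rewrite in_itv.
split=> //.
- by move=> k x [[Ux _] xk].
- apply/seteqP; split=> [x [k _ [[]]]//|x Ux].
  have [k1 _ k1P] := near_infty_natSinv_lt (PosNum (fU x Ux)).
  pose k := maxn k1 (Num.bound `|x|).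
  exists k => //; split; first split=> //=.
    by apply/ltW/k1P => /=; rewrite leq_maxl.
  by rewrite /= (le_trans (ltW (archi_boundP (normr_ge0 x))))// ler_nat leq_maxr.
- move=> k S mS; rewrite nuE// -[leLHS]adde0; apply: leeD => //.
  set D := (X in S `&` X).
  have mDk : measurable D by exact: mD.
  have mSD : measurable (S `&` D) by exact: measurableI.
  have mEf : measurable_fun S (EFin \o f) by apply/measurable_EFinP; exact: measurable_funTS.
  apply: (@le_trans _ _ (\int[leb]_(y in S `&` D) (f y)%:E)%E); last first.
    by apply: ge0_subset_integral => // y _; rewrite lee_fin.
  rewrite -integral_cst//; apply: ge0_le_integral => //.
  - by move=> y _; rewrite lee_fin.
  - by apply: measurable_funS mEf => //; exact: subIsetl.
  - by move=> y [_ [[_ fy] _]]; rewrite lee_fin.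
Qed.

Lemma ac_component_gt0 (nu : set V -> \bar R) (U S : set V) : open U ->
  has_positive_ac_component nu U -> measurable S -> (0 < leb (S `&` U))%E -> (0 < nu S)%E.
Proof.
move=> oU /(ac_component_lower oU)[D [mD _ DU Dnu]] mS; rewrite -DU setI_bigcupr => S0.
have [k kS] : exists k, (0 < leb (S `&` D k))%E.
  by apply: measure_bigcup_gt0 S0 => k; exact: measurableI.
by apply: lt_le_trans (Dnu k S mS); rewrite mule_gt0// lte_fin invr_gt0.
Qed.

End ac_component.

Section minorization.
Context {R : realType} {n : nat}.
Local Notation V := 'cV[R]_n.
Context (ip : {dot V for idfun}) (K : set V) (hK : generating_proper_cone K).
Context (b : V) (B : 'M[R]_n) (m : {measure set V -> \bar R}) (mu : set V -> V).
Context (p : R -> R.-spker V ~> V) (phi : R -> V -> R) (psi : R -> V -> V).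
Hypothesis hpar : affine_parameters ip K b B m mu.
Hypothesis hker : affine_kernels ip K p phi psi.
Hypothesis hric : riccati ip K b B m mu phi psi.
Hypothesis h_flow : forall t : R, 0 <= t -> [set expmx (t *: B) *m x | x in K°] = K°.
Hypothesis h_tau : tau B < 0.
Hypothesis m_finite : (m K < +oo)%E.
Let hmu := param_mu hpar.
Context (I : option 'I_n -> (V -> R) -> R).
Hypothesis hI : forall i, jump_functional K (I i).
Hypothesis I_m : forall f, I None f = \int[m]_(x in K) f x.
Hypothesis I_mu : forall f x (Kx : K x), bounded_measurable setT f ->
  \sum_i x i ord0 * I (Some i) f = \int[scalar_measure hmu Kx]_(y in K) f y.
Hypothesis h_density : has_positive_ac_component m K° \/
  exists2 eta, K° eta & has_positive_ac_component (scalarize ip mu eta) K°.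
Local Notation E t := (expmx (t *: B)).
Local Notation z := (equilibrium B b).
Local Notation Phi := (flow B b).
Local Notation rate := (jump_rate I).
Local Notation survival := (survival b B I).
Local Notation leb := (@lebesgue_cV R n).
Local Notation transition := (transition K p).
Context (e : V) (Ke : K° e).

Let mK : measurable K.
Proof. exact: closed_measurable_mx (cone_closed hK). Qed.

Let mE t : measurable_fun setT (fun x : V => E t *m x).
Proof. exact: measurable_mulmx_cst. Qed.

(** The factor by which [E r] changes volumes is read off a single set: a ball of radius [s] is
    mapped into the unit ball by every [E r] with [r] in [0, T], which bounds the factor below by a
    ratio of two volumes. *)
Lemma lebesgue_expmx_ge (T : R) : 0 <= T -> exists2 c : R, 0 < c & forall r A,
  0 <= r <= T -> measurable A -> (c%:E * leb A <= leb (mulmx (E r) @^-1` A))%E.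
Proof.
move=> T0; have [C C0 CP] := expmx_bounded B T0.
pose Q (r : R) : set V := [set x | `|x| <= r].
have mQ r : measurable (Q r).
  rewrite -[X in measurable X]setTI (_ : Q r = (fun x : V => `|x|) @^-1` `]-oo, r]%classic).
    exact: measurable_norm_cV.
  by apply/seteqP; split=> x /=; rewrite in_itv.
have Qoo r : (leb (Q r) < +oo)%E by exact: (@lebesgue_bounded_lty _ _ _ r).
have Qgt0 r : 0 < r -> (0 < leb (Q r))%E.
  move=> r0; apply: (@lt_le_trans _ _ (leb (ball (0 : V) r))).
    by apply: lebesgue_open_gt0; [exact: ball_open|exists 0; exact: ballxx].
  apply: le_measure; rewrite ?inE//; first by apply: open_measurable_mx; exact: ball_open.
  by move=> x; rewrite mx_norm_ball /ball_/= sub0r normrN => /ltW.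
pose s := (n%:R * C + 1)^-1; have s0 : 0 < s by rewrite invr_gt0 ltr_wpDl// mulr_ge0// ltW.
have fQ r : leb (Q r) = (fine (leb (Q r)))%:E by rewrite fineK// ge0_fin_numE.
exists (fine (leb (Q s)) / fine (leb (Q 1))).
  by rewrite divr_gt0// fine_gt0// Qgt0 ?ltr01 ?Qoo.
move=> r A rT mA; have [c c0 cP] := lebesgue_preimage_mulmx (expmx_unit B r).
rewrite cP// lee_pmul//; first by rewrite lee_fin divr_ge0 ?fine_ge0.
rewrite lee_fin ler_pdivrMr ?fine_gt0 ?Qgt0 ?ltr01 ?Qoo//.
rewrite -lee_fin EFinM -!fQ -cP//; apply: le_measure; rewrite ?inE//.
  exact: (measurable_preimageT (mE r)).
move=> x /= xs; apply: le_trans (norm_mulmx _ _) _.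
apply: (@le_trans _ _ (n%:R * C * s)).
  by rewrite -!mulrA ler_wpM2l// ler_pM// CP.
by rewrite ler_pdivrMr ?mul1r ?lerDl// ltr_wpDl// mulr_ge0// ltW.
Qed.

Lemma survival_ge (T M : R) : 0 <= T -> 0 <= M -> exists2 w, 0 < w &
  forall x s, `|x| <= M -> 0 <= s <= T -> w <= survival x s.
Proof.
move=> T0 M0; have [N N0 NP] := flow_bounded B b T0 M0.
pose L := n%:R * `|invmx B|.
(* A term by term bound of the vector in [hazard]; [N] bounds the flow on [0, T] and [M] the
   starting point. *)
pose Q := T * `|z| + L * (N + `|z|) + L * (M + `|z|).
pose H := T * `|I None (fun=> 1)| + \sum_i Q * `|I (Some i) (fun=> 1)|.
exists (expR (- H)); first exact: expR_gt0.
move=> x s xM sT; rewrite ler_expR lerN2; apply: le_trans (ler_norm _) _.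
have /andP[s0 sT'] := sT.
apply: le_trans (ler_normD _ _) _; apply: lerD.
  by rewrite normrM ler_wpM2r// ger0_norm.
apply: le_trans (ler_norm_sum _ _ _) _; apply: ler_sum => i _.
rewrite normrM ler_wpM2r//; apply: le_trans (coord_le_norm _ _ _) _.
apply: le_trans (ler_normB _ _) _; apply: lerD; first apply: le_trans (ler_normD _ _) _.
  apply: lerD; first by rewrite normrZ ler_wpM2r// ger0_norm.
  apply: le_trans (norm_mulmx _ _) _; rewrite ler_wpM2l ?mulr_ge0//.
  have -> : E s *m (x - z) = Phi s x - z by rewrite /flow (addrC z) addrK.
  by apply: le_trans (ler_normB _ _) _; rewrite lerD2r NP.
apply: le_trans (norm_mulmx _ _) _; rewrite ler_wpM2l ?mulr_ge0//.
by apply: le_trans (ler_normB _ _) _; rewrite lerD2r.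
Qed.

(** If m has the density, the constant does not depend on [v]. Otherwise [v] exceeds [c0 *: e],
    hence a multiple of [eta], in the cone order, so <v, mu> exceeds the same multiple of <eta, mu>.
    The set [D] serves all values of [c0]. *)
Lemma rate_ge_lebesgue : exists (D : set V) (N : R),
  [/\ measurable D, forall x, D x -> K x /\ `|x| <= N, (0 < leb D)%E &
   forall c0 : R, 0 < c0 -> exists2 c : R, 0 < c & forall v S, K (v - c0 *: e) ->
     measurable S -> S `<=` D -> c * fine (leb S) <= rate v \1_S].
Proof.
have oK : open (K° : set V) by exact: open_interior.
have K0 : (0 < leb K°)%E by apply: lebesgue_open_gt0 => //; exists e.
have Kv v c0 : 0 < c0 -> K (v - c0 *: e) -> K v.
  move=> c00 Kvc; rewrite -[v](subrK (c0 *: e)); apply: (coneD hK) => //.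
  by apply: (coneZ hK); [exact: ltW|exact: interior_subset].
have lower (nu : set V -> \bar R) : has_positive_ac_component nu K° -> exists (D : set V) (N : R) (dl : R),
    [/\ measurable D, forall x, D x -> K x /\ `|x| <= N, (0 < leb D)%E, 0 < dl &
     forall S, measurable S -> S `<=` D -> (dl%:E * leb S <= nu S)%E].
  move=> /(ac_component_lower oK)[D [mD DK DU Dnu]].
  have [k Dk] : exists k, (0 < leb (D k))%E by apply: measure_bigcup_gt0 => //; rewrite DU.
  exists (D k), k%:R, k.+1%:R^-1; split=> //.
  - by move=> x /DK[Kx xk]; split=> //; exact: interior_subset.
  - by move=> S mS SD; have := Dnu k S mS; rewrite setIidl.
case: h_density => [/lower|[eta Keta /lower]] [D [N [dl [mD DK D0 dl0 Dnu]]]]; exists D, N; split=> //.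
- move=> c0 c00; exists dl => // v S Kvc mS SD.
  have SK : S `<=` K by move=> x /SD/DK[].
  have Kv' := Kv v c0 c00 Kvc; have Soo : (leb S < +oo)%E.
    by apply: (@lebesgue_bounded_lty _ _ _ N mS) => x /SD/DK[].
  rewrite (jump_rate_indicE hK I_m I_mu Kv' mS SK).
  apply: ler_wpDr; first by rewrite ipC; exact: (cvm_dual hmu mS Kv').
  rewrite -lee_fin EFinM !fineK ?ge0_fin_numE//; first exact: Dnu.
  by apply: le_lt_trans m_finite; apply: le_measure; rewrite ?inE.
- move=> c0 c00; have [k k0 Kek] := interior_cone_scale eta Ke.
  exists (c0 * k * dl); first by rewrite !mulr_gt0.
  move=> v S Kvc mS SD; have SK : S `<=` K by move=> x /SD/DK[].
  have Kv' := Kv v c0 c00 Kvc; have Soo : (leb S < +oo)%E.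
    by apply: (@lebesgue_bounded_lty _ _ _ N mS) => x /SD/DK[].
  rewrite (jump_rate_indicE hK I_m I_mu Kv' mS SK).
  apply: ler_wpDl; first by rewrite fine_ge0.
  have Kd : K (v - (c0 * k) *: eta).
    have -> : v - (c0 * k) *: eta = (v - c0 *: e) + c0 *: (e - k *: eta).
      by rewrite scalerBr scalerA addrA subrK.
    by apply: (coneD hK) => //; apply: (coneZ hK) => //; exact: ltW.
  have := cvm_dual hmu mS Kd; rewrite ipC linearBl/= subr_ge0 linearZl_LR/=; apply: le_trans.
  rewrite -mulrA ler_wpM2l//; first by rewrite mulr_ge0// ltW.
  by have := Dnu S mS SD; rewrite -[leb S]fineK ?ge0_fin_numE// -EFinM lee_fin.
Qed.

End minorization.

Section one_step.
Context {R : realType} {n : nat}.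
Local Notation V := 'cV[R]_n.
Context (ip : {dot V for idfun}) (K : set V) (hK : generating_proper_cone K).
Context (b : V) (B : 'M[R]_n) (m : {measure set V -> \bar R}) (mu : set V -> V).
Context (p : R -> R.-spker V ~> V) (phi : R -> V -> R) (psi : R -> V -> V).
Hypothesis hpar : affine_parameters ip K b B m mu.
Hypothesis hker : affine_kernels ip K p phi psi.
Hypothesis hric : riccati ip K b B m mu phi psi.
Hypothesis h_flow : forall t : R, 0 <= t -> [set expmx (t *: B) *m x | x in K°] = K°.
Hypothesis h_tau : tau B < 0.
Hypothesis m_finite : (m K < +oo)%E.
Let hmu := param_mu hpar.
Context (I : option 'I_n -> (V -> R) -> R).
Hypothesis hI : forall i, jump_functional K (I i).
Hypothesis I_m : forall f, I None f = \int[m]_(x in K) f x.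
Hypothesis I_mu : forall f x (Kx : K x), bounded_measurable setT f ->
  \sum_i x i ord0 * I (Some i) f = \int[scalar_measure hmu Kx]_(y in K) f y.
Hypothesis h_density : has_positive_ac_component m K° \/
  exists2 eta, K° eta & has_positive_ac_component (scalarize ip mu eta) K°.
Local Notation E t := (expmx (t *: B)).
Local Notation z := (equilibrium B b).
Local Notation Phi := (flow B b).
Local Notation rate := (jump_rate I).
Local Notation survival := (survival b B I).
Local Notation leb := (@lebesgue_cV R n).
Local Notation transition := (transition K p).
Context (e : V) (Ke : K° e).

Let mK : measurable K.
Proof. exact: closed_measurable_mx (cone_closed hK). Qed.

Let mE t : measurable_fun setT (fun x : V => E t *m x).
Proof. exact: measurable_mulmx_cst. Qed.

Let K_E t x : K x -> K (E t *m x).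
Proof. exact: (expmx_cone hK h_flow). Qed.

(** The pairs (s, y) for which [y] is the displacement at time 1 caused by a jump at time [s] of
    size in [D]. *)
Let return_times (D : set V) : set (R * V) :=
  [set q | 0 <= q.1 <= 1 /\ D (E (- (1 - q.1)) *m q.2)].

Let measurable_return_times D : measurable D -> measurable (return_times D).
Proof.
move=> mD.
rewrite (_ : return_times D = (fun q : R * V => q.1) @^-1` `[0, 1]%classic `&`
    (fun q : R * V => E (- (1 - q.1)) *m q.2) @^-1` D); last first.
  by apply/seteqP; split=> q /=; rewrite in_itv.
apply: measurableI; rewrite -[X in measurable X]setTI.
  exact: (@measurable_fst _ _ _ _).
have mPE : measurable_fun setT (fun q : R * V => E (- (1 - q.1)) *m q.2).
  apply: measurable_fun_mulmx => [i j|]; last exact: measurable_snd.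
  have cE : continuous (fun r : R => E (- (1 - r)) i j).
    move=> r; have ct : (- (1 - r')) @[r' --> r] --> - (1 - r).
      by apply: cvgN; apply: cvgB; [exact: cvg_cst|exact: cvg_id].
    have /cvg_mxP/(_ i j) H := @continuous_expmx R n B (- (1 - r)).
    by apply: cvg_comp ct H.
  exact: (measurableT_comp (continuous_measurable_fun cE) (@measurable_fst _ _ _ _)).
exact: mPE.
Qed.

(* Averaging the jump over its time s: the density at y is the amount of time s for
   which y has been carried from D by the flow. *)
Lemma transition_ge_lebesgue : exists (W : set V) (N : R),
  [/\ measurable W, forall y, W y -> K y /\ `|y| <= N, (0 < leb W)%E &
   forall M c0 : R, 0 <= M -> 0 < c0 -> exists2 c : R, 0 < c & forall x A,
     `|x| <= M -> K (x - c0 *: e) -> measurable A ->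
     (c%:E * leb (W `&` [set y | A (Phi 1 x + y)%R]) <= (transition 1 A x)%:E)%E].
Proof.
have [D [N [mD DK D0 rateD]]] := rate_ge_lebesgue hK m_finite I_m I_mu h_density Ke.
have [c1 c10 c1P] := lebesgue_expmx_ge B ler01.
have mT0 := measurable_return_times mD; set T0 := return_times D in mT0.
pose g0 y := lebesgue_measure (ysection T0 y).
have mg0 : measurable_fun setT g0 by exact: measurable_fun_ysection.
have xT0 s : 0 <= s <= 1 -> xsection T0 s = mulmx (E (- (1 - s))) @^-1` D.
  by move=> s01; apply/seteqP; split=> y /=; rewrite /xsection/= inE => //; case.
(* By Tonelli the integral of [g0] is that of the volume of the image of [D] under [E (1 - s)] over
   [s] in [0, 1]. It is positive, so some superlevel set of [g0] has positive measure. *)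
have [dl dl0 Wdl] : exists2 dl : R, 0 < dl & (0 < leb [set y | (dl%:E <= g0 y)%E])%E.
  apply: integral_gt0_level => //.
  rewrite -(tonelli_sections lebesgue_measure leb mT0).
  apply: (@integral_gt0 _ _ _ lebesgue_measure setT `[0%R, 1%R]%classic) => //.
  - exact: measurable_fun_xsection.
  - move=> s; rewrite /= in_itv/= => s01; rewrite xT0//.
    have [c c0 ->//] := lebesgue_preimage_mulmx (expmx_unit B (- (1 - s))).
    by rewrite mule_gt0.
  - by rewrite /= lebesgue_measure_itv/= lte_fin ltr01 oppr0 adde0 lte_fin.
have [C C0 CP] := expmx_bounded B ler01.
pose W := [set y | (dl%:E <= g0 y)%E].
have mW : measurable W by rewrite -[W]setTI; exact: emeasurable_fun_c_infty.
exists W, (n%:R * C * N); split=> //.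
  move=> y Wy; have [s [s01 Dy]] : exists s, 0 <= s <= 1 /\ D (E (- (1 - s)) *m y).
    apply: contrapT => nex; move: Wy; rewrite /W/= /g0 (_ : ysection T0 y = set0).
      by rewrite measure0 lee_fin leNgt dl0.
    apply/seteqP; split=> // s; rewrite /ysection/= inE => -[s01 Ds].
    by apply: nex; exists s.
  have [KDy DN] := DK _ Dy.
  have yE : y = E (1 - s) *m (E (- (1 - s)) *m y) by rewrite mulmxA expmxKN mul1mx.
  have s1 : 0 <= 1 - s <= 1 by case/andP: s01 => ? ?; apply/andP; split; lra.
  split; first by rewrite yE; exact: K_E.
  rewrite yE; apply: le_trans (norm_mulmx _ _) _; apply: ler_pM => //.
  by rewrite ler_wpM2l// CP.
move=> M c0 M0 c00.
have [N' N'0 N'P] := flow_bounded B b ler01 M0.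
have D_N : 0 <= `|N| by [].
have [w1 w10 w1P] := survival_ge b B I ler01 M0.
have [w2 w20 w2P] := survival_ge b B I ler01 (addr_ge0 N'0 D_N).
pose w := Num.min w1 w2; have w0 : 0 < w by rewrite lt_min w10 w20.
have [k k0 kP] := expmx_cone_ge hK h_flow ler01 Ke.
have [c cc0 cP] := rateD (c0 * k) (mulr_gt0 c00 k0).
(* Two factors [w] for survival before and after the jump, [c] for the jump density on [D], [c1] for
   the change of variables by the flow, and [dl] for the amount of jump times leading to a point of
   [W]. *)
exists (w * (w * c) * (c1 * dl)); first by rewrite !mulr_gt0.
move=> x A xM Kxc mA.
have Kx : K x.
  rewrite -[x](subrK (c0 *: e)); apply: (coneD hK) => //.
  by apply: (coneZ hK); [exact: ltW|exact: interior_subset].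
have KPhi s : 0 <= s <= 1 -> K (Phi s x - (c0 * k) *: e).
  move=> s01; have /andP[s0 _] := s01.
  have -> : Phi s x - (c0 * k) *: e =
      (z - E s *m z) + (E s *m (x - c0 *: e) + c0 *: (E s *m e - k *: e)).
    by rewrite flowE mulmxBr -scalemxAr scalerBr scalerA !addrA subrK.
  apply: (coneD hK); first exact: (equilibrium_sub_cone ip hK (param_b hpar) h_flow h_tau).
  by apply: (coneD hK); [exact: K_E|apply: (coneZ hK); [exact: ltW|exact: kP]].
have Doo : (leb D < +oo)%E by apply: (@lebesgue_bounded_lty _ _ _ N) => // y /DK[].
have DKK : D `<=` K by move=> y /DK[].
have ge1 := @one_jump_ge _ _ _ _ hK _ _ _ _ _ _ _ hpar hker hric h_flow h_tau _ hI I_m I_mu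
  x 1 w c D A Kx ltr01 mA mD DKK Doo w0 (ltW cc0).
apply: le_trans (ge1 _ _ _); last first.
- by move=> s S s01 mS SD; apply: cP => //; exact: KPhi.
- move=> s xi s01 Dxi; rewrite ge_min; apply/orP; right; apply: w2P.
    apply: le_trans (ler_normD _ _) _; apply: lerD; first exact: N'P.
    by case: (DK _ Dxi) => _ /le_trans; apply; exact: ler_norm.
  by case/andP: s01 => ? ?; apply/andP; split; lra.
- by move=> s s01; rewrite ge_min; apply/orP; left; exact: w1P.
rewrite EFinM -muleA lee_pmul2l// ?lte_fin ?mulr_gt0//.
set v := Phi 1 x.
pose T1 := T0 `&` [set q | A (v + q.2)].
have mT1 : measurable T1.
  apply: measurableI => //; rewrite -[X in measurable X]setTI.
  have mv : measurable_fun setT (fun q : R * V => v + q.2).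
    by apply: measurable_cVD; [exact: measurable_cst|exact: measurable_snd].
  exact: mv.
apply: (@le_trans _ _ (c1%:E * \int[lebesgue_measure]_s leb (xsection T1 s))%E).
  rewrite (tonelli_sections lebesgue_measure leb mT1) EFinM -muleA lee_pmul2l//.
  have mS : measurable (W `&` [set y | A (v + y)]).
    apply: measurableI => //; apply: (measurable_preimageT (f := fun y => v + y)) => //.
    by apply: measurable_cVD => //; exact: measurable_cst.
  rewrite -integral_cst// integral_mkcond; apply: ge0_le_integral => //.
  - by move=> y _; rewrite erestrict_ge0// => ? _; rewrite lee_fin ltW.
  - exact: (measurable_restrictT _ _).1.
  - exact: measurable_fun_ysection.
  - move=> y _; rewrite patchE; case: ifPn => [/set_mem[Wy Ay]|_]; last exact: measure_ge0.
    apply: le_trans Wy _; rewrite /g0; apply: le_measure; rewrite ?inE.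
    + exact: measurable_ysection.
    + exact: measurable_ysection.
    + by move=> s; rewrite /ysection/= !inE => T0s; split.
rewrite -ge0_integralZl//; [|exact: measurable_fun_xsection|by rewrite lee_fin ltW].
rewrite [leRHS]integral_mkcond; apply: ge0_le_integral => //.
- by move=> s _; rewrite mule_ge0// lee_fin ltW.
- by apply: measurable_funeM; exact: measurable_fun_xsection.
- have mL : measurable_fun `[(0 : R), 1]%classic (fun s : R => leb (D `&` landing B v (1 - s)%R A)).
    by apply: measurable_funTS; exact: measurable_landing_mass.
  exact: (measurable_restrictT _ _).1 mL.
move=> s _; rewrite patchE; case: ifPn => [|ns].
  rewrite inE/= in_itv/= => s01.
  have r01 : 0 <= 1 - s <= 1 by case/andP: s01 => ? ?; apply/andP; split; lra.
  have -> : D `&` landing B v (1 - s)%R A = mulmx (E (1 - s)) @^-1` xsection T1 s.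
    apply/seteqP; split=> xi /=; rewrite /xsection/= inE.
      by move=> [Dxi Axi]; split=> //; split=> //=; rewrite mulmxA expmxNK mul1mx.
    by move=> [[_ /=]]; rewrite mulmxA expmxNK mul1mx.
  by apply: c1P => //; exact: measurable_xsection.
rewrite (_ : xsection T1 s = set0) ?measure0 ?mule0//.
apply/seteqP; split=> // y; rewrite /xsection/= inE => -[[/= s01 _] _].
by move/negP: ns; apply; rewrite inE/= in_itv.
Qed.

End one_step.

(** * Laws and occupation times of the process *)

Section process_law.
Context {R : realType} {n : nat} {d : measure_display} {Omega : measurableType d}.
Local Notation V := 'cV[R]_n.
Context (ip : {dot V for idfun}) (K : set V) (hK : generating_proper_cone K).
Context (p : R -> R.-spker V ~> V) (phi : R -> V -> R) (psi : R -> V -> V).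
Hypothesis hker : affine_kernels ip K p phi psi.
Context (P : V -> probability Omega R) (X : R -> Omega -> one_point_compactification V).
Hypothesis hX : cadlag_markov_process K p P X.
Local Notation transition := (transition K p).
Local Notation semigroup := (semigroup p).

Let mK : measurable K.
Proof. exact: closed_measurable_mx (cone_closed hK). Qed.

(** The Markov property at time 0, restricted to the event that the process starts at [x], which has
    probability 1. *)
Lemma process_law x (t : R) A : K x -> 0 <= t -> measurable A ->
  P x (in_state X t A) = (transition t A x)%:E.
Proof.
move=> Kx t0 mA; rewrite -(spker_transition hK hker t0 Kx mA).
have mx : measurable [set x].
  apply: closed_measurable_mx; exact: (accessible_closed_set1 (hausdorff_accessible (@norm_hausdorff R V))).
pose G := in_state X 0 [set x].
have mG : measurable G by exact: (process_measurable hX).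
have PG : P x G = 1%E by exact: (process_start hX).
have mI : measurable (in_state X t A) by exact: (process_measurable hX).
have pG : past X 0 G.
  by apply: sub_sigma_algebra; exists 0, [set x]; split=> //; rewrite lexx.
have := process_markov hX Kx (lexx 0) t0 pG mA; rewrite add0r => E1.
have -> : P x (in_state X t A) = P x (G `&` in_state X t A).
  apply/eqP; rewrite eq_le; apply/andP; split; last first.
    by apply: le_measure; rewrite ?inE//; exact: measurableI.
  have PGC : P x (~` G) = 0%E by rewrite probability_setC// PG subee.
  rewrite -[leRHS]adde0 -PGC; apply: le_trans (measureU2 _ _ _); rewrite ?inE//.
  - apply: le_measure; rewrite ?inE//; first by apply: measurableU; [exact: measurableI|exact: measurableC].
    by move=> w Xw; have [Gw|nGw] := pselect (G w); [left|right].
  - exact: measurableI.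
  - exact: measurableC.
rewrite E1 (eq_integral (fun=> p t x A)); last first.
  by move=> w; rewrite inE => -[y -> ->].
rewrite (spker_transition hK hker t0 Kx mA) (integral_cst _ mG).
transitivity ((transition t A x)%:E * 1)%E; last exact: mule1.
by congr (_ * _)%E; exact: PG.
Qed.

Lemma measurable_in_state_fun (s : R) h : 0 <= s -> bounded_measurable setT h ->
  forall x, K x ->
  measurable_fun setT (fun w => if X s w is Some y then h y else 0 : R) /\
  \int[P x]_w (if X s w is Some y then h y else 0) = semigroup s h x.
Proof.
move=> s0 bh x Kx.
pose ev (h : V -> R) w : R := if X s w is Some y then h y else 0.
have Poo : (P x setT < +oo)%E by rewrite probability_setT ltry.
suff [] : bounded_measurable setT h /\ (measurable_fun setT (ev h) /\
  \int[P x]_w ev h w = semigroup s h x) by [].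
move: h bh; apply: bounded_measurable_ind => [A mA|a c f g [bf [mf If]] [bg [mg Ig]]|f_ f M H fM fl].
- split; first exact: bounded_measurable_indic.
  have mI : measurable (in_state X s A) by exact: (process_measurable hX).
  have -> : ev \1_A = \1_(in_state X s A).
    apply/funext => w; rewrite /ev !indicE; case E: (X s w) => [y|].
      rewrite indicE; suff -> : (y \in A) = (w \in in_state X s A) by [].
      apply/idP/idP => [/set_mem Ay|/set_mem[y' Ay']]; first by apply/mem_set; exists y.
      by rewrite E => -[->]; exact: mem_set.
    by rewrite memNset// => -[y _]; rewrite E.
  split; first exact: measurable_indic.
  rewrite /Rintegral integral_indic// setIT.
  transitivity (fine (P x (in_state X s A))); first by [].
  rewrite process_law// /=.
  by rewrite semigroup_indic// (spker_transition hK hker s0 Kx mA).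
- split; first exact: bounded_measurable_lin.
  have bev f' : bounded_measurable setT f' -> measurable_fun setT (ev f') ->
      bounded_measurable setT (ev f').
    move=> [_ [M fM]] mev; split=> //; exists `|M| => w _; rewrite /ev.
    by case: (X s w) => [y|]; rewrite ?normr0//; exact: le_trans (fM y Logic.I) (ler_norm _).
  have evE : ev (fun y => a * f y + c * g y) = fun w => a * ev f w + c * ev g w.
    by apply/funext => w; rewrite /ev; case: (X s w) => //; rewrite !mulr0 addr0.
  rewrite evE; split; first by apply: measurable_funD; apply: measurable_funM.
  rewrite (Rintegral_lin a c Poo measurableT (bev f bf mf) (bev g bg mg)) If Ig.
  by rewrite -(semigroup_lin p s a c x bf bg).
- have mf_ k : measurable_fun setT (f_ k) by case: (H k) => -[].
  have M0 : 0 <= M by exact: le_trans (normr_ge0 _) (fM 0%N 0).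
  have el w : ev (f_ k) w @[k --> \oo] --> ev f w.
    by rewrite /ev; case: (X s w) => [y|]; [exact: fl|exact: cvg_cst].
  split.
    by apply: (@bounded_measurable_lim _ _ _ setT f_ f M) => // k; case: (H k).
  split.
    apply: (measurable_fun_cvg (h := fun k => ev (f_ k))) => [k|w _]; last exact: el.
    by case: (H k) => _ [].
  have l1 : (fun k => \int[P x]_w ev (f_ k) w) @ \oo --> \int[P x]_w ev f w.
    apply: (bounded_convergence (M := M)) => //; first by move=> k; case: (H k) => _ [].
    by move=> k w _; rewrite /ev; case: (X s w) => [y|]; rewrite ?normr0.
  have l2 : (fun k => semigroup s (f_ k) x) @ \oo --> semigroup s f x.
    by apply: (semigroup_lim (M := M)).
  apply: (cvg_unique _ l1) => //.
  rewrite (_ : (fun k => _) = fun k => semigroup s (f_ k) x)//.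
  by apply/funext => k; case: (H k) => _ [].
Qed.

Lemma bounded_measurable_transition (t : R) A : measurable A ->
  bounded_measurable setT (transition t A).
Proof.
move=> mA; have bi : bounded_measurable setT (\1_(A `&` K) : V -> R).
  by apply: bounded_measurable_indic; exact: measurableI.
split; first exact: measurable_semigroup.
exists 1 => y _; apply: semigroup_bounded => //; first by case: bi.
by move=> w; rewrite indicE; case: (_ \in _); rewrite ?normr1 ?normr0.
Qed.

Lemma chapman_kolmogorov x (s t : R) A : K x -> 0 <= s -> 0 <= t -> measurable A ->
  transition (s + t) A x = semigroup s (transition t A) x.
Proof.
move=> Kx s0 t0 mA; have st0 : 0 <= s + t by rewrite addr_ge0.
have [_ <-] := measurable_in_state_fun s0 (bounded_measurable_transition t mA) Kx.
have pT : past X s setT.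
  have [p0 pC _] : sigma_algebra setT (past X s) by exact: smallest_sigma_algebra.
  by rewrite -[setT]setD0; exact: pC.
have Poo : (P x setT < +oo)%E by rewrite probability_setT ltry.
have [mev _] := measurable_in_state_fun s0 (bounded_measurable_transition t mA) Kx.
have [_ [M tM]] := bounded_measurable_transition t mA.
have iev : (P x).-integrable setT
    (EFin \o (fun w => if X s w is Some y then transition t A y else 0)).
  apply: (bounded_measurable_integrable Poo) => //; split=> //.
  exists `|M| => w _; case: (X s w) => [y|]; last by rewrite normr0.
  exact: le_trans (tM y Logic.I) (ler_norm _).
have := process_markov hX Kx s0 t0 pT mA.
rewrite setTI process_law// => E1; apply: EFin_inj; rewrite E1 /Rintegral fineK; last exact: integrable_fin_num.
apply: eq_integral => w _; case E: (X s w) => [y|]//.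
by rewrite (spker_transition hK hker t0 _ mA)//; exact: (process_state hX s0 E).
Qed.

End process_law.

Section exhaustion.
Context {R : realType} {n : nat}.
Local Notation V := 'cV[R]_n.
Context (U : set V) (oU : open U).

(** Compact sets whose interiors exhaust [U]. Compactness matters at the cemetery: the complement of
    a compact set is one of its neighbourhoods in the one-point compactification. *)
Definition exhaustion (k : nat) : set V :=
  [set y | `|y| <= k%:R] `&` \bigcap_(z in ~` U) [set y | (k.+1%:R^-1 : R) <= `|y - z|].

Lemma closed_exhaustion k : closed (exhaustion k).
Proof.
apply: closedI.
  rewrite (_ : [set y | _] = (fun y : V => `|y|) @^-1` [set r | r <= k%:R])//.
  by apply: preimage_closed; [move=> y _; exact: norm_continuous|exact: closed_le].
apply: closed_bigI => z _.
rewrite (_ : [set y | _] = (fun y : V => `|y - z|) @^-1` [set r | (k.+1%:R^-1 : R) <= r])//.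
apply: preimage_closed; last exact: closed_ge.
move=> y _; have H : (v - z) @[v --> y] --> y - z.
  by apply: (@cvgB R V _ (nbhs y) _ id (cst z)); [exact: cvg_id|exact: cvg_cst].
exact: cvg_norm H.
Qed.

Lemma compact_exhaustion k : compact (exhaustion k).
Proof.
apply: compact_cV; last exact: closed_exhaustion.
exists k%:R; split; first exact: num_real.
by move=> M kM y [yk _]; apply: le_trans yk (ltW kM).
Qed.

Lemma exhaustion_sub k : exhaustion k `<=` U.
Proof.
move=> y [_ yU]; apply: contrapT => nUy.
by have := yU y nUy; rewrite /= subrr normr0 leNgt invr_gt0 ltr0n.
Qed.

Lemma exhaustion_nbhs y : U y -> exists k, nbhs y (exhaustion k).
Proof.
move=> Uy; have /nbhs_ballP[r /= r0 rU] : nbhs y U by exact: open_nbhs_nbhs.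
have r20 : 0 < r / 2 by rewrite divr_gt0.
have [k1 _ k1P] := near_infty_natSinv_lt (PosNum r20).
pose k := maxn k1 (Num.bound (`|y| + r / 2)); exists k.
apply/nbhs_ballP; exists (r / 2) => // x; rewrite mx_norm_ball /ball_/= => yx; split.
  rewrite /= -[x](subrK y) (le_trans (ler_normD _ _))// addrC.
  apply: (@le_trans _ _ (`|y| + r / 2)); first by rewrite lerD2l distrC ltW.
  rewrite (le_trans (ltW (archi_boundP _)))//; first by rewrite addr_ge0// ltW.
  by rewrite ler_nat leq_maxr.
move=> z nUz /=; rewrite leNgt; apply/negP => xz; apply: nUz; apply: rU.
rewrite mx_norm_ball /ball_/= -(subrK x y) -addrA (le_lt_trans (ler_normD _ _))//.
rewrite [ltRHS]splitr ltrD//; apply: lt_trans xz _.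
by apply: k1P => /=; rewrite leq_maxl.
Qed.

End exhaustion.

Section joint_measurability.
Context {R : realType} {n : nat} {d : measure_display} {Omega : measurableType d}.
Local Notation V := 'cV[R]_n.
Context (K : set V) (p : R -> R.-spker V ~> V).
Context (P : V -> probability Omega R) (X : R -> Omega -> one_point_compactification V).
Hypothesis hX : cadlag_markov_process K p P X.

Definition visits (A : set V) : set (R * Omega) := [set q | 0 <= q.1 /\ in_state X q.1 A q.2].

Let right_near w (t : R) (O : set (one_point_compactification V)) : 0 <= t ->
  nbhs (X t w) O -> exists2 dl : R, 0 < dl & forall s, t < s -> s < t + dl -> O (X s w).
Proof.
move=> t0 XO; have : \forall s \near t^'+, O (X s w) by exact: (process_right_continuous hX t0) XO.
move=> /nbhs_ballP[dl /= dl0 dlP]; exists dl => // s ts sd; apply: dlP => //.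
by rewrite /ball/= distrC gtr0_norm ?subr_gt0// ltrBlDl.
Qed.

Let nbhs_setC_some (F : set V) (x : one_point_compactification V) : compact F -> closed F ->
  ~ (Some @` F : set (one_point_compactification V)) x ->
  nbhs x (~` (Some @` F : set (one_point_compactification V))).
Proof.
move=> cF clF; case: x => [y|] nF; last first.
  exists F => //= u [[v nFv <-]|->]; last by move=> [].
  by move=> [v' Fv' [vv']]; apply: nFv; rewrite -vv'.
have nFy : ~ F y by move=> Fy; apply: nF; exists y.
have nO : nbhs y (~` F) by apply: open_nbhs_nbhs; split => //; exact: closed_openC.
apply: filterS nO => v nFv /= [v' Fv' [vv']].
by apply: nFv; rewrite -vv'.
Qed.

Let tick (m j : nat) : R := j%:R / m.+1%:R.

Let tickS m j : tick m j.+1 = tick m j + m.+1%:R^-1.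
Proof. by rewrite /tick -natr1 mulrDl mul1r. Qed.

Let ticks (t : R) m : 0 <= t -> exists j, tick m j <= t < tick m j.+1.
Proof.
move=> t0; exists (Num.truncn (t * m.+1%:R)).
rewrite /tick ler_pdivrMr// ltr_pdivlMr//; apply: truncn_itv.
by rewrite mulr_ge0.
Qed.

(** By right continuity, [X t w] is in [U] if and only if, for some [k], on all sufficiently fine
    grids the value at the first grid point strictly after [t] lies in [exhaustion U k]. This is a
    countable combination of measurable rectangles. *)
Let measurable_visits_open U : open U -> measurable (visits U).
Proof.
move=> oU; pose F := exhaustion U.
pose S m j k : set (R * Omega) :=
  `[tick m j, tick m j.+1[%classic `*` in_state X (tick m j.+1) (F k).
have -> : visits U = \bigcup_k \bigcup_N \bigcap_(m in [set m | (N <= m)%N]) \bigcup_j S m j k.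
  apply/seteqP; split=> [[t w] [/= t0 [y Uy Xt]]|[t w] [k _ [N _ SN]]].
    have [k kP] := exhaustion_nbhs oU Uy.
    have [dl dl0 dlP] : exists2 dl : R, 0 < dl & forall s, t < s -> s < t + dl ->
        (Some @` F k : set (one_point_compactification V)) (X s w).
      apply: right_near => //; rewrite Xt.
      exact: one_point_compactification_some_nbhs.
    have [N _ NP] := near_infty_natSinv_lt (PosNum dl0).
    exists k => //; exists N => // m /= Nm.
    have [j /andP[jt tj]] := ticks m t0; exists j => //; split; first by rewrite /= in_itv/= jt.
    have [|y' Fy' /= Xy'] := dlP (tick m j.+1) tj; last by exists y'.
    by rewrite tickS; apply: ler_ltD => //; exact: NP.
  have [j0 _ [/= t0 _]] := SN N (leqnn N); rewrite in_itv/= in t0; case/andP: t0 => t0 _.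
  have {}t0 : 0 <= t by apply: le_trans t0; rewrite /tick divr_ge0.
  split=> //=; apply: contrapT => nXU.
  have [dl dl0 dlP] : exists2 dl : R, 0 < dl & forall s, t < s -> s < t + dl ->
      (~` (Some @` F k : set (one_point_compactification V))) (X s w).
    apply: right_near => //; apply: nbhs_setC_some.
    - exact: compact_exhaustion.
    - exact: closed_exhaustion.
    - by move=> [y Fy Xy]; apply: nXU; exists y => //; exact: exhaustion_sub Fy.
  have [M _ MP] := near_infty_natSinv_lt (PosNum dl0).
  have [j _ [/= tj [y Fy Xy]]] := SN (maxn N M) (leq_maxl N M).
  move: tj; rewrite in_itv/= => /andP[jt tj].
  apply: (dlP _ tj); last by exists y.
  by rewrite tickS; apply: ler_ltD => //; apply: MP; rewrite /= leq_maxr.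
apply: bigcup_measurable => k _; apply: bigcup_measurable => N _.
apply: bigcap_measurable => [|m _]; first by exists N => /=.
apply: bigcup_measurable => j _; apply: measurableX => //.
apply: (process_measurable hX); first by rewrite divr_ge0.
by apply: closed_measurable_mx; exact: closed_exhaustion.
Qed.

Lemma measurable_visits A : measurable A -> measurable (visits A).
Proof.
move=> mA; suff H : @measurable _ V `<=` [set A | measurable (visits A)] by exact: H.
apply: smallest_sub; last by move=> U oU; exact: measurable_visits_open.
have v0 : visits set0 = set0 by apply/seteqP; split=> // q [_ []].
split=> [|B mB|F mF] /=.
- by rewrite v0.
- have -> : visits (setT `\` B) = visits setT `\` visits B.
    apply/seteqP; split=> [[t w] [/= t0 [y [_ nBy] Xt]]|[t w] [[/= t0 [y _ Xt]] nv]].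
      by split; [split=> //; exists y|move=> [_ [y' By']]; rewrite /= Xt => -[yy']; rewrite yy' in nBy].
    by split=> //; exists y => //; split=> // By; apply: nv; split=> //; exists y.
  by apply: measurableD => //; apply: measurable_visits_open; exact: openT.
- have -> : visits (\bigcup_i F i) = \bigcup_i visits (F i).
    apply/seteqP; split=> [[t w] [/= t0 [y [i _ Fy] Xt]]|[t w] [i _ [/= t0 [y Fy Xt]]]].
      by exists i => //; split=> //; exists y.
    by split=> //; exists y => //; exists i.
  by apply: bigcup_measurable => i _; exact: mF.
Qed.

End joint_measurability.

Section occupation.
Context {R : realType} {n : nat} {d : measure_display} {Omega : measurableType d}.
Local Notation V := 'cV[R]_n.
Context (ip : {dot V for idfun}) (K : set V) (hK : generating_proper_cone K).
Context (p : R -> R.-spker V ~> V) (phi : R -> V -> R) (psi : R -> V -> V).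
Hypothesis hker : affine_kernels ip K p phi psi.
Context (P : V -> probability Omega R) (X : R -> Omega -> one_point_compactification V).
Hypothesis hX : cadlag_markov_process K p P X.

Lemma expected_occupation x A : K x -> measurable A ->
  (\int[P x]_w occupation_time X A w =
   \int[lebesgue_measure]_(t in `[0%R, +oo[) (transition K p t A x)%:E)%E.
Proof.
move=> Kx mA; have mS := measurable_visits hX mA; set S := visits X A in mS.
have mS2 w : measurable (ysection S w) by exact: measurable_ysection.
transitivity (\int[P x]_w lebesgue_measure (ysection S w))%E.
  apply: eq_integral => w _; rewrite /occupation_time.
  transitivity (\int[lebesgue_measure]_(t in `[0%R, +oo[) (\1_(ysection S w) t)%:E)%E.
    apply: eq_integral => t; rewrite inE/= in_itv/= andbT => t0; congr EFin; rewrite !indicE; congr (_%:R).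
    suff -> : (w \in in_state X t A) = (t \in ysection S w) by [].
    rewrite /ysection; apply/idP/idP => [/set_mem wA|].
      by rewrite inE/= inE.
    by move=> /set_mem/= /set_mem[_ wA]; exact: mem_set.
  transitivity (lebesgue_measure (ysection S w `&` `[0%R, +oo[%classic)).
    by apply: integral_indic; [exact: measurable_itv|exact: mS2].
  congr (lebesgue_measure _).
  apply: setIidl.
  by move=> t; rewrite /ysection/= inE => -[/= t0 _]; rewrite in_itv/= t0.
rewrite -(tonelli_sections lebesgue_measure (P x) mS) [RHS]integral_mkcond.
apply: eq_integral => t _; rewrite patchE; case: ifPn => [|nt].
  rewrite inE/= in_itv/= andbT => t0; rewrite -(process_law hK hker hX Kx t0 mA).
  congr (P x _); apply/seteqP; split=> w; rewrite /xsection/= inE; first by case.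
  by move=> Xt; split.
rewrite (_ : xsection S t = set0) ?measure0//.
apply/seteqP; split=> // w; rewrite /xsection/= inE => -[/= t0 _].
by move/negP: nt; apply; rewrite inE/= in_itv/= t0.
Qed.

End occupation.

(** * Reachability and two jumps *)

Section reachability.
Context {R : realType} {n : nat}.
Local Notation V := 'cV[R]_n.
Context (ip : {dot V for idfun}) (K : set V) (hK : generating_proper_cone K).
Context (b : V) (B : 'M[R]_n) (m : {measure set V -> \bar R}) (mu : set V -> V).
Context (p : R -> R.-spker V ~> V) (phi : R -> V -> R) (psi : R -> V -> V).
Hypothesis hpar : affine_parameters ip K b B m mu.
Hypothesis hker : affine_kernels ip K p phi psi.
Hypothesis hric : riccati ip K b B m mu phi psi.
Hypothesis h_flow : forall t : R, 0 <= t -> [set expmx (t *: B) *m x | x in K°] = K°.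
Hypothesis h_tau : tau B < 0.
Hypothesis m_finite : (m K < +oo)%E.
Let hmu := param_mu hpar.
Hypothesis h_density : has_positive_ac_component m K° \/
  exists2 eta, K° eta & has_positive_ac_component (scalarize ip mu eta) K°.
Hypothesis h_start : ~ has_positive_ac_component m K° -> (0 < m K°)%E \/ K° b.
Local Notation E t := (expmx (t *: B)).
Local Notation z := (equilibrium B b).
Local Notation Phi := (flow B b).
Local Notation leb := (@lebesgue_cV R n).
Local Notation transition := (transition K p).

Let mK : measurable K.
Proof. exact: closed_measurable_mx (cone_closed hK). Qed.

Let oK : open (K° : set V).
Proof. exact: open_interior. Qed.

Let mKo : measurable (K° : set V).
Proof. exact: open_measurable_mx. Qed.

Let K_E t x : K x -> K (E t *m x).
Proof. exact: (expmx_cone hK h_flow). Qed.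

Lemma flow_reach x (t : R) A : K x -> 0 <= t -> measurable A -> A (Phi t x) ->
  0 < transition t A x.
Proof.
move=> Kx t0 mA APx; have [I [hI I_m I_mu]] := affine_jump_functionals hK hmu m_finite.
apply: lt_le_trans (no_jump_le hK hker hric h_flow h_tau hI I_m I_mu Kx t0 mA APx).
exact: survival_gt0.
Qed.

Lemma jump_reach x (t : R) A : K x -> 0 < t -> measurable A ->
  (forall s, 0 < s < t -> (0 < m (K `&` landing B (Phi t x) (t - s)%R A))%E \/
    (0 < scalarize ip mu (Phi s x) (K `&` landing B (Phi t x) (t - s)%R A))%E) ->
  0 < transition t A x.
Proof.
move=> Kx t0 mA H; have [I [hI I_m I_mu]] := affine_jump_functionals hK hmu m_finite.
exact: (one_jump_gt0 hK hker hric h_flow h_tau m_finite hI I_m I_mu Kx t0 mA H).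
Qed.

Lemma jump_ge_lebesgue e : K° e -> exists (W : set V) (N : R),
  [/\ measurable W, forall y, W y -> K y /\ `|y| <= N, (0 < leb W)%E &
   forall M c0 : R, 0 <= M -> 0 < c0 -> exists2 c : R, 0 < c & forall x A,
     `|x| <= M -> K (x - c0 *: e) -> measurable A ->
     (c%:E * leb (W `&` [set y | A (Phi 1 x + y)%R]) <= (transition 1 A x)%:E)%E].
Proof.
move=> Ke; have [I [hI I_m I_mu]] := affine_jump_functionals hK hmu m_finite.
exact: (transition_ge_lebesgue hK hker hric h_flow h_tau m_finite hI I_m I_mu h_density Ke).
Qed.

Lemma reach_lebesgue e (M : R) : K° e -> exists2 T : R, 0 < T & forall t x A, T <= t ->
  K° x -> `|x| <= M -> measurable A ->
  (0 < leb (A `&` [set y | K° (y - z - e)%R]))%E -> 0 < transition t A x.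
Proof.
move=> Ke; have [T T0 TP] := expmx_small h_tau (M + `|z|) Ke.
exists (T + 1); first by rewrite ltr_wpDl.
move=> t x A Tt Kx xM mA A0; have Kx' : K x by exact: interior_subset.
have t0 : 0 < t by apply: lt_le_trans Tt; rewrite ltr_wpDl.
have Ket : K° (e - E t *m (x - z)).
  apply: TP; first by apply: le_trans Tt; rewrite lerDl.
  by apply: le_trans (ler_normB _ _) _; rewrite lerD2r.
apply: jump_reach => // s /andP[s0 st].
set S := K `&` _.
have mS : measurable S by apply: measurableI => //; exact: measurable_landing.
have S0 : (0 < leb (S `&` K°))%E.
  pose A' := A `&` [set y | K° (y - z - e)].
  have mA' : measurable A'.
    apply: measurableI => //.
    apply: (measurable_preimageT (f := fun y : V => y - z - e)) => //.
    rewrite (_ : (fun y => _) = fun y => y + (- z - e)); last by apply/funext => y; rewrite addrA.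
    exact: measurable_shift.
  have [c c0 cP] := lebesgue_preimage_mulmx (expmx_unit B (t - s)).
  pose A2 := (fun y => y + Phi t x) @^-1` A'.
  have mA2 : measurable A2 by apply: (measurable_preimageT (measurable_shift _)).
  have A20 : (0 < leb (mulmx (E (t - s)) @^-1` A2))%E.
    rewrite (cP _ mA2); apply: mule_gt0; first by rewrite lte_fin.
    by rewrite /A2 (lebesgue_shift (Phi t x) mA').
  apply: lt_le_trans A20 _; apply: le_measure; rewrite ?inE.
  - exact: (measurable_preimageT (measurable_mulmx_cst (E (t - s)))).
  - exact: measurableI.
  - move=> xi /= [Axi Kxi].
    suff Kxi' : K° xi by split=> //; split; [exact: interior_subset|rewrite /landing/= addrC].
    have -> : xi = E (- (t - s)) *m (E (t - s) *m xi) by rewrite mulmxA expmxNK mul1mx.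
    apply: (expmx_interior h_flow).
    (* The first summand is interior by the choice of the target, the second by the choice of [T];
       [E (- (t - s))] then preserves the interior. *)
    have -> : E (t - s) *m xi = (E (t - s) *m xi + Phi t x - z - e) + (e - E t *m (x - z)).
      by rewrite addrA subrK /flow (addrC z) addrA addrK addrK.
    by apply: (interior_coneD hK); [exact: Kxi|exact: (interior_subset Ket)].
case: h_density => [mac|[eta Keta muac]]; [left|right].
  exact: (ac_component_gt0 oK mac mS S0).
have eta0 := ac_component_gt0 oK muac mS S0.
(* The path up to the jump stays in the interior, so it exceeds a multiple of [eta]; this is where
   [K° x] is used. *)
have [k k0 kP] := interior_cone_scale eta (flow_interior ip hK (param_b hpar) h_flow h_tau (ltW s0) Kx).
have := cvm_dual hmu mS kP; rewrite ipC linearBl/= subr_ge0 linearZl_LR/= => H.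
rewrite /scalarize lte_fin; apply: lt_le_trans H.
by rewrite mulr_gt0//; move: eta0; rewrite /scalarize lte_fin.
Qed.

Lemma reach_interior x : K x -> 0 < transition 1 K° x.
Proof.
move=> Kx.
have [Kb|nKb] := pselect (K° b).
  apply: flow_reach => //.
  exact: (flow_to_interior ip hK (param_b hpar) h_flow h_tau).
have mK0 : (0 < m K°)%E.
  have [mac|nmac] := pselect (has_positive_ac_component m K°); last by case: (h_start nmac).
  apply: (ac_component_gt0 oK mac mKo); rewrite setIid.
  by apply: lebesgue_open_gt0 => //; exact: (cone_interior_neq0 hK).
apply: jump_reach => // s /andP[s0 s1]; left.
apply: lt_le_trans mK0 _; apply: le_measure; rewrite ?inE//.
  by apply: measurableI => //; exact: measurable_landing.
move=> xi Kxi; split; first exact: interior_subset.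
rewrite /landing/= addrC; apply: (interior_coneD hK); first exact: (expmx_interior h_flow).
exact: (flow_cone ip hK (param_b hpar) h_flow h_tau).
Qed.

Context (d : measure_display) (Omega : measurableType d).
Context (P : V -> probability Omega R) (X : R -> Omega -> one_point_compactification V).
Hypothesis hX : cadlag_markov_process K p P X.

Lemma transition_compose_gt0 x (s t : R) S A : K x -> 0 <= s -> 0 <= t -> measurable S ->
  measurable A -> 0 < transition s S x -> (forall y, S y -> K y -> 0 < transition t A y) ->
  0 < transition (s + t) A x.
Proof.
move=> Kx s0 t0 mS mA S0 SA; rewrite (chapman_kolmogorov hK hker hX Kx s0 t0 mA).
have mSK : measurable (S `&` K) by exact: measurableI.
apply: (Rintegral_gt0 (S := S `&` K)) => //.
- exact: spker_lty.
- exact: (bounded_measurable_transition hK).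
- by move=> y _; exact: (transition_ge0 hK).
- by move=> y [Sy Ky]; exact: SA.
- rewrite lt0e measure_ge0 andbT; apply/eqP => p0.
  by move: S0; rewrite (transitionE hK)// p0 ltxx.
Qed.

Lemma reach_all x e A : K x -> K° e -> measurable A ->
  (0 < leb (A `&` [set y | K° (y - z - e)%R]))%E ->
  exists2 T : R, 0 <= T & forall t, T <= t -> 0 < transition t A x.
Proof.
move=> Kx Ke mA A0.
pose F k : set V := K° `&` [set y | `|y| <= k%:R].
have mF k : measurable (F k).
  apply: measurableI => //.
  rewrite -[X in measurable X]setTI (_ : [set y | _] = (fun y : V => `|y|) @^-1` `]-oo, (k%:R : R)]%classic).
    exact: measurable_norm_cV.
  by apply/seteqP; split=> y /=; rewrite in_itv.
have FU : \bigcup_k F k = K°.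
  apply/seteqP; split=> [y [k _ []]//|y Ky].
  exists (Num.bound `|y|) => //; split=> //=; exact/ltW/archi_boundP.
have [k kF] : exists k, (0 < p 1 x (F k))%E.
  apply: measure_bigcup_gt0 => //; rewrite FU.
  by rewrite (spker_transition hK hker ler01 Kx mKo) lte_fin reach_interior.
have [T T0 TP] := reach_lebesgue k%:R Ke.
exists (1 + T); first by rewrite addr_ge0// ltW.
move=> t Tt; rewrite -(subrK 1 t) addrC.
apply: (transition_compose_gt0 (S := F k)) => //.
- by rewrite subr_ge0; apply: le_trans Tt; rewrite lerDl ltW.
- by move: kF; rewrite (spker_transition hK hker ler01 Kx (mF k)) lte_fin.
- by move=> y [Kyo yk] _; apply: TP => //; rewrite lerBrDl.
Qed.

End reachability.

Section finite_tonelli.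
Context {R : realType} {d1 d2 : measure_display}.
Context {T1 : measurableType d1} {T2 : measurableType d2}.

Section as_finite.
Context (nu : {measure set T1 -> \bar R}) (nuoo : (nu setT < +oo)%E).

(** A copy of [nu] whose term carries the proof of finiteness, from which the sigma-finite structure
    is inferred. *)
Definition as_finite : set T1 -> \bar R := let _ := nuoo in nu.

HB.instance Definition _ := isMeasure.Build _ _ _ as_finite
  (measure0 nu) (measure_ge0 nu) (@measure_semi_sigma_additive _ _ _ nu).

Let as_finite_sigma_finite : sigma_finite setT as_finite.
Proof.
by exists (fun=> setT) => [|i]; [rewrite bigcup_const//; exists 0%N|split].
Qed.

HB.instance Definition _ := Measure_isSigmaFinite.Build _ _ _ as_finite as_finite_sigma_finite.

End as_finite.

Lemma tonelli_finite_sections (nu : {measure set T1 -> \bar R})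
    (m2 : {sigma_finite_measure set T2 -> \bar R}) (S : set (T1 * T2)) :
  (nu setT < +oo)%E -> measurable S ->
  (\int[nu]_x m2 (xsection S x) = \int[m2]_y nu (ysection S y))%E.
Proof. by move=> nuoo mS; exact: (tonelli_sections (as_finite nuoo) m2 mS). Qed.

Lemma measurable_fun_finite_ysection (nu : {measure set T1 -> \bar R}) (S : set (T1 * T2)) :
  (nu setT < +oo)%E -> measurable S -> measurable_fun setT (fun y => nu (ysection S y)).
Proof. by move=> nuoo mS; exact: (measurable_fun_ysection (as_finite nuoo) mS). Qed.

End finite_tonelli.

Section two_jumps.
Context {R : realType} {n : nat}.
Local Notation V := 'cV[R]_n.
Context (ip : {dot V for idfun}) (K : set V) (hK : generating_proper_cone K).
Context (b : V) (B : 'M[R]_n) (m : {measure set V -> \bar R}) (mu : set V -> V).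
Context (p : R -> R.-spker V ~> V) (phi : R -> V -> R) (psi : R -> V -> V).
Hypothesis hpar : affine_parameters ip K b B m mu.
Hypothesis hker : affine_kernels ip K p phi psi.
Hypothesis hric : riccati ip K b B m mu phi psi.
Hypothesis h_flow : forall t : R, 0 <= t -> [set expmx (t *: B) *m x | x in K°] = K°.
Hypothesis h_tau : tau B < 0.
Hypothesis m_finite : (m K < +oo)%E.
Let hmu := param_mu hpar.
Hypothesis h_density : has_positive_ac_component m K° \/
  exists2 eta, K° eta & has_positive_ac_component (scalarize ip mu eta) K°.
Hypothesis h_start : ~ has_positive_ac_component m K° -> (0 < m K°)%E \/ K° b.
Local Notation E t := (expmx (t *: B)).
Local Notation z := (equilibrium B b).
Local Notation Phi := (flow B b).
Local Notation leb := (@lebesgue_cV R n).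
Local Notation transition := (transition K p).

Let mK : measurable K.
Proof. exact: closed_measurable_mx (cone_closed hK). Qed.

Context (d : measure_display) (Omega : measurableType d).
Context (P : V -> probability Omega R) (X : R -> Omega -> one_point_compactification V).
Hypothesis hX : cadlag_markov_process K p P X.

Let K_E t x : K x -> K (E t *m x).
Proof. exact: (expmx_cone hK h_flow). Qed.

(* The right-hand side is the density at v of the sum of two independent jumps, the
   first one carried by the flow; it is bounded below by Steinhaus' theorem. *)
Lemma lebesgue_convolution_ge (W : set V) (N : R) : measurable W ->
  (forall y, W y -> `|y| <= N) -> (0 < leb W)%E ->
  exists (v0 : V) (r c : R), [/\ 0 < r, 0 < c &
    forall v, `|v - v0| < r -> (c%:E <= leb (W `&` [set w | W (v - E 1 *m w)%R]))%E].
Proof.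
move=> mW WN W0; pose S : set (V * V) := [set q | W q.1 /\ W (q.2 - E 1 *m q.1)].
have mS : measurable S.
  rewrite (_ : S = (fun q => q.1) @^-1` W `&` (fun q => q.2 - E 1 *m q.1) @^-1` W)//.
  apply: measurableI; rewrite -[X in measurable X]setTI; first exact: (@measurable_fst _ _ _ _).
  have mf : measurable_fun setT (fun q : V * V => q.2 - E 1 *m q.1).
    apply: measurable_cVB; first exact: measurable_snd.
    exact: (measurableT_comp (measurable_mulmx_cst (E 1)) (@measurable_fst _ _ _ _)).
  exact: mf.
(* By Tonelli the integral of the density over all [v] is that of the volume of [W] over [W], so the
   density is positive somewhere. *)
have [v0 v00] : exists v0, (0 < leb (ysection S v0))%E.
  apply: contrapT => nv0.
  have : (0 < \int[leb]_w leb (xsection S w))%E.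
    apply: (@integral_gt0 _ _ _ leb setT W) => //; first exact: measurable_fun_xsection.
    move=> w Ww; have -> : xsection S w = (fun v => v + (- (E 1 *m w))) @^-1` W.
      by apply/seteqP; split=> v /=; rewrite /xsection/= inE => //; case.
    by rewrite (lebesgue_shift (- (E 1 *m w)) mW).
  rewrite (tonelli_sections leb leb mS) (_ : (fun _ => _) = cst 0%E) ?integral0 ?ltxx//.
  apply/funext => v; apply/eqP; rewrite eq_le measure_ge0 andbT leNgt.
  by apply/negP => H; apply: nv0; exists v.
set W' := ysection S v0 in v00.
have mW' : measurable W' by exact: measurable_ysection.
have W'E w : W' w <-> W w /\ W (v0 - E 1 *m w) by rewrite /W' /ysection/= inE.
have W'N w : W' w -> `|w| <= N by move=> /W'E[/WN].
have [dl dl0 [c c0 cP]] := lebesgue_setI_shift mW' W'N v00.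
pose L := n%:R * `|E (- 1)| + 1; have L0 : 0 < L by rewrite ltr_wpDl// mulr_ge0.
exists v0, (dl / L), c; split=> //; first by rewrite divr_gt0.
(* Moving the target from [v0] to [v] amounts to translating [w] by [u], since
   [v - E 1 *m w = v0 - E 1 *m (w - u)]. *)
move=> v vv0; pose u := E (- 1) *m (v - v0).
have udl : `|u| < dl.
  apply: le_lt_trans (norm_mulmx _ _) _; apply: (@le_lt_trans _ _ (L * `|v - v0|)).
    by rewrite ler_wpM2r// lerDl.
  by rewrite mulrC -ltr_pdivlMr.
apply: le_trans (cP u udl) _; apply: le_measure; rewrite ?inE.
- apply: measurableI => //; exact: (measurable_preimageT (measurable_shift (- u))).
- apply: measurableI => //; apply: (measurable_preimageT (f := fun w : V => v - E 1 *m w)) => //.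
  apply: measurable_cVB; [exact: measurable_cst|exact: measurable_mulmx_cst].
- move=> w [/W'E[Ww _] /= /W'E[_ Wu]]; split=> //=.
  suff <- : v0 - E 1 *m (w - u) = v - E 1 *m w by [].
  by rewrite mulmxBr mulmxA expmxKN mul1mx opprB addrA (addrC v0) subrK.
Qed.

(** Chapman-Kolmogorov at time 1, with the one-jump bound used for the second unit of time and then,
    after Tonelli, for the first. The density obtained at the displacement [v] is the one bounded by
    [lebesgue_convolution_ge]. *)
Lemma two_jumps_ge e : K° e -> exists (v0 : V) (r : R), 0 < r /\
  forall M c0 : R, 0 <= M -> 0 < c0 -> exists2 c : R, 0 < c & forall x A,
    `|x| <= M -> K (x - c0 *: e) -> measurable A ->
    (c%:E * leb (A `&` [set y | (`|y - Phi (1 + 1) x - v0| < r)%R]) <=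
     (transition (1 + 1) A x)%:E)%E.
Proof.
move=> Ke.
have [W [N [mW WK W0 jump]]] := jump_ge_lebesgue hK hpar hker hric h_flow h_tau m_finite h_density Ke.
have WN y : W y -> `|y| <= N by move=> /WK[].
have [v0 [r [c3 [r0 c30 convW]]]] := lebesgue_convolution_ge mW WN W0.
exists v0, r; split=> // M c0 M0 c00.
have [N' N'0 N'P] := flow_bounded B b ler01 M0.
have [k k0 kP] := expmx_cone_ge hK h_flow ler01 Ke.
have [c1 c10 jump1] := jump M c0 M0 c00.
have [c2 c20 jump2] := jump (N' + `|N|) (c0 * k) (addr_ge0 N'0 (normr_ge0 N)) (mulr_gt0 c00 k0).
exists (c2 * (c1 * c3)); first by rewrite !mulr_gt0.
move=> x A xM Kxc mA.
have Kx : K x.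
  rewrite -[x](subrK (c0 *: e)); apply: (coneD hK) => //.
  by apply: (coneZ hK); [exact: ltW|exact: interior_subset].
have KPhi : K (Phi 1 x - (c0 * k) *: e).
  have -> : Phi 1 x - (c0 * k) *: e =
      (z - E 1 *m z) + (E 1 *m (x - c0 *: e) + c0 *: (E 1 *m e - k *: e)).
    by rewrite flowE mulmxBr -scalemxAr scalerBr scalerA !addrA subrK.
  apply: (coneD hK); first exact: (equilibrium_sub_cone ip hK (param_b hpar) h_flow h_tau).
  by apply: (coneD hK); [exact: K_E|apply: (coneZ hK); [exact: ltW|apply: kP; rewrite ler01 lexx]].
(* The positions at time 1 for which the constant [c2] is valid; they contain every position reached
   by a first displacement in [W]. *)
pose Y : set V := [set y | `|y| <= N' + `|N|] `&` [set y | K (y - (c0 * k) *: e)].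
have mY : measurable Y.
  apply: measurableI.
    rewrite -[X in measurable X]setTI
      (_ : [set y | _] = (fun y : V => `|y|) @^-1` `]-oo, (N' + `|N|)]%classic).
      exact: measurable_norm_cV.
    by apply/seteqP; split=> y /=; rewrite in_itv.
  exact: (measurable_preimageT (measurable_shift (- ((c0 * k) *: e)))).
have YW w : W w -> Y (Phi 1 x + w).
  move=> Ww; have [Kw wN] := WK w Ww; split=> /=.
    apply: le_trans (ler_normD _ _) _; apply: lerD; first by apply: N'P; rewrite ?ler01 ?lexx.
    exact: le_trans wN (ler_norm _).
  by rewrite addrAC; exact: (coneD hK).
have YK y : Y y -> K y.
  move=> [_ /= Kyc]; rewrite -[y](subrK ((c0 * k) *: e)); apply: (coneD hK) => //.
  by apply: (coneZ hK); [rewrite mulr_ge0// ltW|exact: interior_subset].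
set q := Phi (1 + 1) x.
(* The first component is the position at time 1, the second the displacement at time 2 from the
   jump-free end point [q]; the second jump must contribute a displacement in [W]. *)
pose S : set (V * V) := [set u | Y u.1 /\ (W (q + u.2 - Phi 1 u.1) /\ A (q + u.2))].
have mPhi : measurable_fun setT (fun y : V => Phi 1 y).
  apply: measurable_cVD; first exact: measurable_cst.
  apply: measurable_fun_mulmx => [i j|]; first exact: measurable_cst.
  exact: measurable_shift.
have mq : measurable_fun setT (fun u : V * V => q + u.2).
  by apply: measurable_cVD; [exact: measurable_cst|exact: measurable_snd].
have mS : measurable S.
  rewrite (_ : S = (fun u => u.1) @^-1` Y `&` ((fun u => q + u.2 - Phi 1 u.1) @^-1` W `&`
    (fun u => q + u.2) @^-1` A))//.
  apply: measurableI; first by rewrite -[X in measurable X]setTI; exact: (@measurable_fst _ _ _ _).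
  apply: measurableI; last by rewrite -[X in measurable X]setTI; exact: mq.
  have mf : measurable_fun setT (fun u : V * V => q + u.2 - Phi 1 u.1).
    apply: measurable_cVB => //.
    exact: (measurableT_comp mPhi (@measurable_fst _ _ _ _)).
  by rewrite -[X in measurable X]setTI; exact: mf.
have poo := spker_lty p 1 x (@measurableT _ V).
have bT := bounded_measurable_transition hK p 1 mA.
have iT := bounded_measurable_integrable poo measurableT bT.
rewrite (chapman_kolmogorov hK hker hX Kx ler01 ler01 mA) /semigroup /Rintegral.
rewrite fineK; last exact: integrable_fin_num.
apply: (@le_trans _ _ (\int[p 1 x]_y (c2%:E * leb (xsection S y)))%E); last first.
  apply: ge0_le_integral => //.
  - by move=> y _; rewrite mule_ge0// lee_fin ltW.
  - by apply: measurable_funeM; exact: measurable_fun_xsection.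
  - by apply/measurable_EFinP; case: bT.
  - move=> y _; have [Yy|nYy] := pselect (Y y); last first.
      rewrite (_ : xsection S y = set0) ?measure0 ?mule0 ?lee_fin.
        exact: (transition_ge0 hK).
      by apply/seteqP; split=> // v; rewrite /xsection/= inE => -[].
    apply: le_trans (jump2 y A _ _ mA); [|by case: Yy..].
    have mWA : measurable (W `&` [set w | A (Phi 1 y + w)]).
      apply: measurableI => //; apply: (measurable_preimageT (f := fun w : V => Phi 1 y + w)) => //.
      by apply: measurable_cVD => //; exact: measurable_cst.
    rewrite -(lebesgue_shift (q - Phi 1 y) mWA) lee_pmul2l// ?lte_fin//.
    apply: le_measure; rewrite ?inE.
    + exact: measurable_xsection.
    + exact: (measurable_preimageT (measurable_shift _)).
    + move=> v; rewrite /xsection/= inE => -[/= _ [Wv Av]]; split=> /=.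
        by rewrite addrA (addrC v).
      by rewrite addrCA (addrC (Phi 1 y)) subrK addrC.
rewrite ge0_integralZl//; [|exact: measurable_fun_xsection|by rewrite lee_fin ltW].
rewrite (tonelli_finite_sections leb poo mS) EFinM -muleA lee_pmul2l ?lte_fin//.
set T := A `&` _.
have mT : measurable T.
  apply: measurableI => //.
  rewrite -[X in measurable X]setTI
    (_ : [set y | _] = (fun y : V => `|y - q - v0|) @^-1` `]-oo, r[%classic).
    have mf : measurable_fun setT (fun y : V => `|y - q - v0|).
      apply: (measurableT_comp measurable_norm_cV).
      rewrite (_ : (fun y => _) = fun y => y + (- q - v0)); first exact: measurable_shift.
      by apply/funext => y; rewrite addrA.
    exact: mf.
  by apply/seteqP; split=> y /=; rewrite in_itv.
rewrite -(lebesgue_shift q mT).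
have mT' := measurable_preimageT (measurable_shift q) mT.
rewrite -integral_cst// integral_mkcond; apply: ge0_le_integral => //.
- by move=> v _; rewrite erestrict_ge0// => ? _; rewrite lee_fin mulr_ge0// ltW.
- exact: (measurable_restrictT _ _).1.
- exact: measurable_fun_finite_ysection.
- move=> v _; rewrite patchE; case: ifPn => [/set_mem[/= Av vr]|_]; last exact: measure_ge0.
  have mSv : measurable (ysection S v) by exact: measurable_ysection.
  rewrite (spker_transition hK hker ler01 Kx mSv).
  apply: le_trans (jump1 x _ xM Kxc mSv); rewrite EFinM lee_pmul2l ?lte_fin//.
  have vv0 : `|v - v0| < r by move: vr; rewrite addrK.
  apply: le_trans (convW v vv0) _; apply: le_measure; rewrite ?inE.
  + apply: measurableI => //; apply: (measurable_preimageT (f := fun w : V => v - E 1 *m w)) => //.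
    apply: measurable_cVB; [exact: measurable_cst|exact: measurable_mulmx_cst].
  + apply: measurableI => //; apply: (measurable_preimageT (f := fun w : V => Phi 1 x + w)) => //.
    by apply: measurable_cVD => //; exact: measurable_cst.
  + move=> w [Ww /= Wv]; split=> //=; rewrite /ysection/= inE; split=> /=; first exact: YW.
    split; last by rewrite addrC.
    by rewrite flowD_jump -/q opprD addrACA subrr add0r.
Qed.

End two_jumps.

(** * Irreducibility and aperiodicity *)

Section discounted_occupation.
Context {R : realType} {n : nat}.
Local Notation V := 'cV[R]_n.
Context (ip : {dot V for idfun}) (K : set V) (hK : generating_proper_cone K).
Context (b : V) (B : 'M[R]_n) (m : {measure set V -> \bar R}) (mu : set V -> V).
Context (p : R -> R.-spker V ~> V) (phi : R -> V -> R) (psi : R -> V -> V).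
Hypothesis hker : affine_kernels ip K p phi psi.
Hypothesis hric : riccati ip K b B m mu phi psi.
Local Notation leb := (@lebesgue_cV R n).
Local Notation transition := (transition K p).
Local Notation Q := (lebesgue_measure \x leb)%E.
Context (C : set V).
Hypothesis mC : measurable C.
Hypothesis CK : C `<=` K.

Let weight (q : R * V) : R := exponential_pdf 1 q.1 * \1_C q.2.
(** The exponential density vanishes at negative times, so the absolute value keeps the kernel at
    times where it is controlled without changing the integral over nonnegative times. *)
Let dens (A : set V) (q : R * V) : \bar R := ((weight q)%:E * p `|q.1| q.2 A)%E.

Let weight_ge0 q : 0 <= weight q.
Proof. by rewrite mulr_ge0// exponential_pdf_ge0. Qed.

Let dens_ge0 A q : (0 <= dens A q)%E.
Proof. by rewrite mule_ge0// lee_fin. Qed.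

Let measurable_weight : measurable_fun setT weight.
Proof.
apply: measurable_funM.
  exact: (measurableT_comp (measurable_exponential_pdf _) (@measurable_fst _ _ _ _)).
have m1C : measurable_fun setT (\1_C : V -> R) by exact: measurable_indic.
exact: (measurableT_comp m1C (@measurable_snd _ _ _ _)).
Qed.

Let densE A q : measurable A -> dens A q =
  (weight q * (\1_K q.2 * semigroup p `|q.1| \1_(A `&` K) q.2))%:E.
Proof.
move=> mA; rewrite /dens /weight; have [Cq|nCq] := pselect (C q.2); last first.
  by rewrite [\1_C _]indicE memNset// mulr0 !mul0r mul0e.
rewrite [\1_K _]indicE (mem_set (CK Cq)) mul1r [RHS]EFinM; congr (_ * _)%E.
exact: (spker_transition hK hker (normr_ge0 _) (CK Cq) mA).
Qed.

Let measurable_dens A : measurable A -> measurable_fun setT (dens A).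
Proof.
move=> mA; rewrite (_ : dens A = EFin \o (fun q =>
  weight q * (\1_K q.2 * semigroup p `|q.1| \1_(A `&` K) q.2))).
  apply/measurable_EFinP; apply: measurable_funM => //.
  exact: (measurable_transition hK hker hric).
by apply/funext => q; exact: densE.
Qed.

Let occ (A : set V) : \bar R := (\int[Q]_q dens A q)%E.

Let occ0 : occ set0 = 0%E.
Proof. by rewrite /occ; apply: integral0_eq => q _; rewrite /dens measure0 mule0. Qed.

Let occ_ge0 A : (0 <= occ A)%E.
Proof. exact: integral_ge0. Qed.

Let occ_sigma_additive : semi_sigma_additive occ.
Proof.
move=> F mF tF mU.
have -> : occ (\bigcup_i F i) = (\sum_(0 <= i <oo) occ (F i))%E.
  rewrite /occ -integral_nneseries//; last by move=> k; exact: measurable_dens.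
  apply: eq_integral => q _; rewrite /dens nneseriesZl//; congr (_ * _)%E.
  exact: measure_semi_bigcup.
exact: is_cvg_nneseries.
Qed.

Let occ_lty : (leb C < +oo)%E -> (occ setT < +oo)%E.
Proof.
move=> Coo; apply: (@le_lt_trans _ _ (leb C)) => //.
have mw : measurable_fun setT (fun q : R * V => (weight q)%:E) by apply/measurable_EFinP.
apply: (@le_trans _ _ (\int[Q]_q (weight q)%:E)%E).
  apply: (@ge0_le_integral _ _ _ Q setT measurableT (dens setT) (fun q => (weight q)%:E)) => //.
  - exact: measurable_dens.
  - by move=> q _; rewrite /dens -[leRHS]mule1 lee_wpmul2l ?lee_fin// spker_le1.
have w0 (q : R * V) : (0 <= (weight q)%:E)%E by rewrite lee_fin.
rewrite (@fubini_tonelli1 _ _ _ _ R lebesgue_measure leb _ mw w0) /fubini_F.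
rewrite (_ : (\int[_]_x _)%E = (\int[lebesgue_measure]_t ((exponential_pdf 1 t)%:E * leb C))%E).
  rewrite ge0_integralZr//; last 2 first.
  - by apply/measurable_EFinP; exact: measurable_exponential_pdf.
  - by move=> t _; rewrite lee_fin exponential_pdf_ge0.
  by rewrite integral_exponential_pdf// mul1e.
apply: eq_integral => t _; rewrite /weight/=.
under eq_integral do rewrite EFinM.
rewrite ge0_integralZl//.
- by rewrite integral_indic// setIT.
- by apply/measurable_EFinP.
- by rewrite lee_fin exponential_pdf_ge0.
Qed.

Lemma measurable_transition_time A y : measurable A -> K y ->
  measurable_fun setT (fun t : R => transition `|t| A y).
Proof.
move=> mA Ky; have mT := measurable_transition hK hker hric mA.
have mp : measurable_fun setT (fun t : R => (t, y)).
  exact: measurable_fun_pair.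
have := measurableT_comp mT mp; apply: eq_measurable_fun => t _.
by rewrite /= indicE (mem_set Ky) mul1r.
Qed.

(* The measure is, up to a constant, the law of the process started uniformly in C and
   stopped at an independent exponential time. *)
Lemma discounted_occupation : (leb C < +oo)%E -> exists nu : {measure set V -> \bar R},
  [/\ (nu setT < +oo)%E,
   forall A, measurable A -> (0 < nu A)%E -> exists2 t : R, 0 <= t &
     exists e : R, 0 < e /\ (0 < leb (C `&` [set y | (e <= transition t A y)%R]))%E &
   forall A, measurable A -> (0 < leb C)%E ->
     (forall y, C y -> (0 < \int[lebesgue_measure]_(t in `[0%R, +oo[) (transition t A y)%:E)%E) ->
     (0 < nu A)%E].
Proof.
move=> Coo.
pose nu : {measure set V -> \bar R} := HB.pack occ
  (isMeasure.Build _ _ _ occ occ0 occ_ge0 occ_sigma_additive).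
exists nu; split; first exact: occ_lty.
- move=> A mA nuA.
  have occA : (0 < \int[Q]_q dens A q)%E := nuA.
  (* A positive integral yields a level set of positive product measure, and one of its time slices
     has positive volume. *)
  have [e e0 eP] := @integral_gt0_level _ _ _ Q (dens A) (measurable_dens mA) (dens_ge0 A) occA.
  set S := [set q | _] in eP.
  have [t t0] : exists t : R, (0 < leb (xsection S t))%E.
    apply: contrapT => nt; move: eP; rewrite lt0e => /andP[/negP S0 _]; apply: S0; apply/eqP.
    rewrite /product_measure1/=; apply: integral0_eq => t _ /=.
    by apply/eqP; rewrite eq_le measure_ge0 leNgt andbT; apply/negP => H; apply: nt; exists t.
  have w0 : exponential_pdf 1 t != 0 :> R.
    apply/negP => /eqP w0; move: t0; rewrite (_ : xsection S t = set0) ?measure0 ?ltxx//.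
    apply/seteqP; split=> // y; rewrite /xsection/= inE /S/= /dens /weight/= w0 mul0r mul0e lee_fin.
    by rewrite leNgt e0.
  have wp : (0 : R) < exponential_pdf 1 t by rewrite lt_neqAle eq_sym w0 exponential_pdf_ge0.
  have tge0 : 0 <= t.
    by rewrite leNgt; apply/negP => tlt0; rewrite lt0_exponential_pdf ?eqxx in w0.
  exists t => //; exists (e / exponential_pdf 1 t); split; first by rewrite divr_gt0.
  apply: lt_le_trans t0 _; apply: le_measure; rewrite ?inE.
  + apply: measurable_xsection; rewrite /S -[X in measurable X]setTI.
    by apply: emeasurable_fun_c_infty => //; exact: measurable_dens.
  + apply: measurableI => //.
    rewrite -[X in measurable X]setTI (_ : [set y | _] =
      (transition t A) @^-1` `[(e / exponential_pdf 1 t), +oo[%classic).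
      by case: (bounded_measurable_transition hK p t mA) => mT _; exact: mT.
    by apply/seteqP; split=> y /=; rewrite in_itv/= andbT.
  + move=> y; rewrite /xsection/= inE /S/= /dens /weight/=.
    have [Cy|nCy] := pselect (C y); last first.
      by rewrite [\1_C _]indicE memNset// mulr0 mul0e lee_fin leNgt e0.
    rewrite [\1_C _]indicE (mem_set Cy) mulr1.
    rewrite (ger0_norm tge0) (spker_transition hK hker tge0 (CK Cy) mA) -EFinM lee_fin => H.
    by split=> //=; rewrite ler_pdivrMr// mulrC.
- move=> A mA C0 HA.
  have mG := measurable_fun_fubini_tonelli_G (m1 := lebesgue_measure) _ (measurable_dens mA) (dens_ge0 A).
  have -> : (nu A = \int[leb]_y fubini_G lebesgue_measure (dens A) y)%E :=
    @fubini_tonelli2 _ _ _ _ R lebesgue_measure leb _ (measurable_dens mA) (dens_ge0 A).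
  apply: (integral_gt0 (S := C)) => //.
  + by move=> y _; exact: integral_ge0.
  + move=> y Cy; rewrite /fubini_G.
    have Hy := HA y Cy; rewrite integral_mkcond in Hy.
    have mt := measurable_transition_time mA (CK Cy).
    have mt0 : measurable_fun setT ((fun t => (transition t A y)%:E) \_ `[0%R, +oo[).
      apply/(measurable_restrictT _ _).1 => //; apply/measurable_EFinP.
      apply: eq_measurable_fun (measurable_funS measurableT (@subsetT _ _) mt).
      by move=> t; rewrite inE/= in_itv/= andbT => t0; rewrite ger0_norm.
    have [|e e0 eP] := @integral_gt0_level _ _ _ lebesgue_measure _ mt0 _ Hy.
      by move=> t; rewrite erestrict_ge0// => ? _; rewrite lee_fin; exact: (transition_ge0 hK).
    apply: (integral_gt0 (S := [set t | _])) eP => //.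
    * rewrite -[X in measurable X]setTI; exact: emeasurable_fun_c_infty.
    * have mp : measurable_fun setT (fun t : R => (t, y)) by exact: measurable_fun_pair.
      exact: (measurableT_comp (measurable_dens mA) mp).
    * move=> t; rewrite /= patchE; case: ifPn => [|_]; last by rewrite lee_fin leNgt e0.
      rewrite inE/= in_itv/= andbT => t0; rewrite lee_fin => et.
      rewrite /dens /weight/= [\1_C _]indicE (mem_set Cy) mulr1 ger0_norm//.
      rewrite (spker_transition hK hker t0 (CK Cy) mA) -EFinM lte_fin mulr_gt0//.
        by rewrite exponential_pdfE// mul1r expR_gt0.
      exact: lt_le_trans et.
Qed.

End discounted_occupation.

Section lebesgue_cone.
Context {R : realType} {n : nat}.
Local Notation V := 'cV[R]_n.
Context (K : set V) (hK : generating_proper_cone K).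
Local Notation leb := (@lebesgue_cV R n).

Let mK : measurable K.
Proof. exact: closed_measurable_mx (cone_closed hK). Qed.

Let mKo : measurable (K° : set V).
Proof. by apply: open_measurable_mx; exact: open_interior. Qed.

(* A point of the boundary of K is moved off the boundary by any interior direction,
   so Steinhaus' theorem makes the boundary negligible. *)
Lemma lebesgue_cone_boundary : leb (K `\` K°) = 0%E.
Proof.
have [e Ke] := cone_interior_neq0 hK.
pose W k : set V := (K `\` K°) `&` [set y | `|y| <= k%:R].
have mW k : measurable (W k).
  apply: measurableI; first exact: measurableD.
  rewrite -[X in measurable X]setTI (_ : [set y | _] = (fun y : V => `|y|) @^-1` `]-oo, (k%:R : R)]%classic).
    exact: measurable_norm_cV.
  by apply/seteqP; split=> y /=; rewrite in_itv.
have WU : \bigcup_k W k = K `\` K°.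
  apply/seteqP; split=> [y [k _ []]//|y Ky].
  exists (Num.bound `|y|) => //; split=> //=; exact/ltW/archi_boundP.
apply/eqP; rewrite -WU eq_le measure_ge0 leNgt andbT; apply/negP => W0.
have [k Wk] := measure_bigcup_gt0 mW W0.
have [|d d0 [c c0 dP]] := lebesgue_setI_shift (M := k%:R) (mW k) _ Wk; first by move=> x [].
pose s := d / (2 * (`|e| + 1)).
have e1 : 0 < `|e| + 1 by rewrite ltr_wpDl.
have s0 : 0 < s by rewrite divr_gt0// mulr_gt0.
have sd : `|s *: e| < d.
  rewrite normrZ gtr0_norm// /s mulrAC ltr_pdivrMr ?mulr_gt0// ltr_pM2l//.
  by have := normr_ge0 e; lra.
have := dP _ sd; rewrite (_ : _ `&` _ = set0) ?measure0 ?lee_fin ?leNgt ?c0//.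
apply/seteqP; split=> // x [[[Kx nKx] _] [[Kxs _] _]]; apply: nKx.
rewrite -[x](subrK (s *: e)) addrC; apply: (interior_coneD hK) => //.
exact: (interior_coneZ hK).
Qed.

(** Up to the null boundary, z + K is z + K°, and this is contained in the union over [k] of the
    sets obtained with the margins [k.+1%:R^-1 *: e]. *)
Lemma lebesgue_cone_shift_interior (z e : V) A : K° e -> measurable A ->
  (0 < leb (A `&` [set y | K (y - z)%R]))%E ->
  exists2 s : R, 0 < s & (0 < leb (A `&` [set y | K° (y - z - s *: e)%R]))%E.
Proof.
move=> Ke mA A0.
have mS (v : V) (S : set V) : measurable S -> measurable [set y | S (y - v)].
  by move=> mS; exact: (measurable_preimageT (measurable_shift (- v))).
have mSs (s : R) : measurable [set y | K° (y - z - s *: e)].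
  exact: (measurable_preimageT (measurable_shift (- z)) (mS _ _ mKo)).
pose F k := A `&` [set y | K° (y - z - (k.+1%:R^-1 : R) *: e)].
have mF k : measurable (F k) by exact: measurableI.
suff [k Fk] : exists k, (0 < leb (F k))%E by exists k.+1%:R^-1 => //; rewrite invr_gt0.
apply: measure_bigcup_gt0 => //.
have FU : A `&` [set y | K° (y - z)] `<=` \bigcup_k F k.
  move=> y [Ay /= Kyz]; have [c c0 cP] := interior_cone_scale e Kyz.
  have [k _ kr] := near_infty_natSinv_lt (PosNum c0).
  have ck : 0 < c - k.+1%:R^-1 by rewrite subr_gt0; exact: (kr k (leqnn k)).
  suff Kk : K° (y - z - (k.+1%:R^-1 : R) *: e) by exists k; [exact: Logic.I|split].
  have -> : y - z - (k.+1%:R^-1 : R) *: e = (c - k.+1%:R^-1) *: e + (y - z - c *: e).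
    by rewrite scalerBl [RHS]addrC [RHS]addrA subrK.
  exact: (interior_coneD hK (interior_coneZ hK ck Ke) cP).
apply: (@lt_le_trans _ _ (leb (A `&` [set y | K° (y - z)]))); last first.
  apply: le_measure; rewrite ?inE//; first by apply: measurableI => //; exact: mS.
  exact: bigcup_measurable.
apply: lt_le_trans A0 _; rewrite -[leRHS]adde0 -lebesgue_cone_boundary.
rewrite -(lebesgue_shift (- z) (measurableD mK mKo)).
apply: (@le_trans _ _ (leb ((A `&` [set y | K° (y - z)]) `|` ((fun x => (x - z)%R) @^-1` (K `\` K°))))).
  apply: le_measure; rewrite ?inE.
  - by apply: measurableI => //; exact: mS.
  - apply: measurableU; first by apply: measurableI => //; exact: mS.
    by apply: mS; exact: measurableD.
  - by move=> y [Ay /= Ky]; have [?|?] := pselect (K° (y - z)); [left|right].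
apply: measureU2; first by apply: measurableI => //; exact: mS.
by apply: mS; exact: measurableD.
Qed.

End lebesgue_cone.

Section irreducibility.
Context {R : realType} {n : nat}.
Local Notation V := 'cV[R]_n.
Context (ip : {dot V for idfun}) (K : set V) (hK : generating_proper_cone K).
Context (b : V) (B : 'M[R]_n) (m : {measure set V -> \bar R}) (mu : set V -> V).
Context (p : R -> R.-spker V ~> V) (phi : R -> V -> R) (psi : R -> V -> V).
Hypothesis hpar : affine_parameters ip K b B m mu.
Hypothesis hker : affine_kernels ip K p phi psi.
Hypothesis hric : riccati ip K b B m mu phi psi.
Hypothesis h_flow : forall t : R, 0 <= t -> [set expmx (t *: B) *m x | x in K°] = K°.
Hypothesis h_tau : tau B < 0.
Hypothesis m_finite : (m K < +oo)%E.
Hypothesis h_density : has_positive_ac_component m K° \/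
  exists2 eta, K° eta & has_positive_ac_component (scalarize ip mu eta) K°.
Hypothesis h_start : ~ has_positive_ac_component m K° -> (0 < m K°)%E \/ K° b.
Context (d : measure_display) (Omega : measurableType d).
Context (P : V -> probability Omega R) (X : R -> Omega -> one_point_compactification V).
Hypothesis hX : cadlag_markov_process K p P X.
Local Notation E t := (expmx (t *: B)).
Local Notation z := (equilibrium B b).
Local Notation Phi := (flow B b).
Local Notation leb := (@lebesgue_cV R n).
Local Notation transition := (transition K p).

Let mK : measurable K.
Proof. exact: closed_measurable_mx (cone_closed hK). Qed.

Lemma occupation_gt0 x A : K x -> measurable A ->
  (exists2 T : R, 0 <= T & forall t, T <= t -> 0 < transition t A x) ->
  (0 < \int[lebesgue_measure]_(t in `[0%R, +oo[) (transition t A x)%:E)%E.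
Proof.
move=> Kx mA [T T0 TP].
have mt := measurable_transition_time hK hker hric mA Kx.
apply: (@integral_gt0 _ _ _ lebesgue_measure `[0%R, +oo[%classic `[T, (T + 1)]%classic) => //.
- by move=> t /=; rewrite !in_itv/= andbT => /andP[Tt _]; exact: le_trans Tt.
- apply/measurable_EFinP; apply: eq_measurable_fun (measurable_funS measurableT (@subsetT _ _) mt).
  by move=> t; rewrite inE/= in_itv/= andbT => t0; rewrite ger0_norm.
- by move=> t _; rewrite lee_fin; exact: (transition_ge0 hK).
- by move=> t /=; rewrite in_itv/= => /andP[Tt _]; rewrite lte_fin TP.
- by rewrite /= lebesgue_measure_itv/= lte_fin ltrDl ltr01 -EFinD lte_fin addrAC subrr add0r.
Qed.

(** A set charged by the Lebesgue measure on z + K is already charged on z + s e + K° for some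
    positive [s]; [reach_all] applies with the margin [s *: e] and gives positive transition
    probabilities at all large times, hence a positive expected occupation time. *)
Lemma irreducible_lebesgue (mz : measurable [set z + k | k in K]) :
  irreducible K P X (mrestr leb mz).
Proof.
have [e Ke] := cone_interior_neq0 hK.
have zK : [set z + k | k in K] = [set y | K (y - z)].
  apply/seteqP; split=> [_ [k Kk <-]|y Ky] /=; first by rewrite addrC addKr.
  by exists (y - z) => //; rewrite addrC subrK.
split.
- have [F FT Foo] := @sigma_finite_lebesgue_cV R n.
  exists F => // k; have [mF Fk] := Foo k; split=> //.
  apply: le_lt_trans Fk; rewrite /mrestr; apply: le_measure; rewrite ?inE//.
  exact: measurableI.
- have mKo : measurable (K° : set V) by apply: open_measurable_mx; exact: open_interior.
  have z0 : (0 < leb (setT `&` [set (z + k)%R | k in K]))%E.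
    rewrite setTI; apply: (@lt_le_trans _ _ (leb [set y | K° (y - z)%R])).
      apply: lebesgue_open_gt0; last by exists (z + e); rewrite /= addrC addKr.
      apply: open_comp => [x _|]; last exact: open_interior.
      by apply: (@cvgB R V _ (nbhs x) _ id (cst z)); [exact: cvg_id|exact: cvg_cst].
    apply: le_measure; rewrite ?inE//.
      exact: (measurable_preimageT (measurable_shift (- z)) mKo).
    by rewrite zK => y; exact: interior_subset.
  by rewrite gt_eqF//; exact: z0.
- move=> A mA A0' x Kx.
  have A0 : (0 < leb (A `&` [set y | K (y - z)%R]))%E by rewrite -zK; exact: A0'.
  have [s s0 sP] := lebesgue_cone_shift_interior hK Ke mA A0.
  rewrite (expected_occupation hK hker hX Kx mA); apply: occupation_gt0 => //.
  exact: (reach_all hK hpar hker hric h_flow h_tau m_finite h_density h_start hX Kx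
    (interior_coneZ hK s0 Ke) mA sP).
Qed.

(** Two jumps spread mass uniformly over a ball around [Phi (1 + 1) x + v0]. As [x] varies in a
    small ball around z + e these centres move little, so a smaller ball [U] is common to all of
    them and carries the minorizing measure. *)
Lemma small_ball e : K° e -> exists C, [/\ small K P X C, (0 < leb C < +oo)%E,
  exists M : R, forall x, C x -> `|x| <= M, C `<=` K° &
  forall x, C x -> K° (x - z - 4%:R^-1 *: e)].
Proof.
move=> Ke.
have [v0 [r [r0 rP]]] := two_jumps_ge hK hpar hker hric h_flow h_tau m_finite h_density hX Ke.
have [r1 r10 r1P] := cvx_interior_ball Ke.
pose L := n%:R * `|E (1 + 1)| + 1.
have L0 : 0 < L by rewrite ltr_wpDl// mulr_ge0.
(* The first bound keeps [C] inside z + e / 2 + K; the second moves the flow end points at time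
   [1 + 1] by at most [r / 2]. *)
pose rho := Num.min (r1 / 2) (r / (2 * L)).
have rho0 : 0 < rho by rewrite lt_min !divr_gt0// mulr_gt0.
pose x0 := z + e.
pose C : set V := [set x | `|x - x0| <= rho].
have mnorm (v : V) : measurable_fun setT (fun x : V => `|x - v|).
  exact: (measurableT_comp measurable_norm_cV (measurable_shift (- v))).
have mC : measurable C.
  rewrite -[X in measurable X]setTI
    (_ : C = (fun x : V => `|x - x0|) @^-1` `]-oo, rho]%classic); first exact: mnorm.
  by apply/seteqP; split=> y /=; rewrite in_itv.
have CM x : C x -> `|x| <= rho + `|x0|.
  by move=> Cx; rewrite -(subrK x0 x) (le_trans (ler_normD _ _))// lerD2r.
have Kh x : C x -> K (x - z - 2^-1 *: e).
  move=> Cx; have -> : x - z - 2^-1 *: e = 2^-1 *: (e + 2 *: (x - x0)).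
    by rewrite /x0; move: z => z'; apply/matrixP => i j; rewrite !mxE; lra.
  apply: (coneZ hK); first by rewrite invr_ge0.
  apply: r1P; rewrite normrZ gtr0_norm// mulrC -ler_pdivlMr//.
  by apply: le_trans Cx _; rewrite ge_min lexx.
have Kh' x : C x -> K (x - 2^-1 *: e).
  move=> Cx; have -> : x - 2^-1 *: e = z + (x - z - 2^-1 *: e).
    by rewrite [RHS]addrA (addrC z) subrK.
  by apply: (coneD hK); [exact: (equilibrium_cone ip hK (param_b hpar) h_flow h_tau)|exact: Kh].
have CK x : C x -> K° x.
  move=> Cx; rewrite -[x](subrK (2^-1 *: e)) addrC.
  by apply: (interior_coneD hK); [apply: (interior_coneZ hK) => //|exact: Kh'].
have C0 : (0 < leb C)%E.
  apply: (@lt_le_trans _ _ (leb (ball x0 rho))).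
    by apply: lebesgue_open_gt0; [exact: ball_open|exists x0; exact: ballxx].
  apply: le_measure; rewrite ?inE//; first by apply: open_measurable_mx; exact: ball_open.
  by move=> y; rewrite mx_norm_ball /ball_/= distrC => /ltW.
have Coo : (leb C < +oo)%E by apply: lebesgue_bounded_lty mC CM.
exists C; split=> //; last 3 first.
- by rewrite C0.
- by exists (rho + `|x0|).
(* Membership in [K] holds with the margin [2^-1 *: e]; giving up half of this margin leads to the
   interior. *)
- move=> x Cx; have -> : x - z - 4%:R^-1 *: e = 4%:R^-1 *: e + (x - z - 2^-1 *: e).
    by move: z => z'; apply/matrixP => i j; rewrite !mxE; lra.
  by apply: (interior_coneD hK); [apply: (interior_coneZ hK) => //|exact: Kh].
have M0 : 0 <= rho + `|x0| by rewrite addr_ge0// ltW.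
have h0 : (0 : R) < 2^-1 by rewrite invr_gt0.
have [c c0 cP] := rP _ _ M0 h0.
(* Half of the radius is left for the motion of the centre, so [U] lies in the ball of radius [r]
   around each [Phi (1 + 1) x + v0] with [x] in [C]. *)
pose U : set V := ball (Phi (1 + 1) x0 + v0) (r / 2).
have r20 : 0 < r / 2 by rewrite divr_gt0.
have oU : open U by exact: ball_open.
have mU : measurable U by exact: open_measurable_mx.
split=> //; first by move=> x /CK; exact: interior_subset.
  by exists x0; rewrite /C/= subrr normr0 ltW.
exists (1 + 1), (mscale (NngNum (ltW c0)) (mrestr leb mU)); split=> //.
  have U0 : (0 < c%:E * leb (setT `&` U))%E.
    rewrite setTI; apply: mule_gt0; first by rewrite lte_fin.
    by apply: lebesgue_open_gt0 => //; exists (Phi (1 + 1) x0 + v0); exact: ballxx.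
  by rewrite gt_eqF//; exact: U0.
move=> x A Cx mA; have Kx : K x by exact: (interior_subset (CK x Cx)).
have t20 : (0 : R) <= 1 + 1 by [].
rewrite (process_law hK hker hX Kx t20 mA).
apply: le_trans (cP x A (CM x Cx) (Kh' x Cx) mA).
rewrite /= /mscale /mrestr lee_pmul2l ?lte_fin//; apply: le_measure; rewrite ?inE.
- exact: measurableI.
- apply: measurableI => //.
  rewrite -[X in measurable X]setTI (_ : [set y | _] =
    (fun y : V => `|y - (Phi (1 + 1) x + v0)|) @^-1` `]-oo, r[%classic); first exact: mnorm.
  by apply/seteqP; split=> y /=; rewrite in_itv/= (opprD (Phi _ x)) addrA.
move=> y [Ay Uy]; split=> //=.
move: Uy; rewrite /U mx_norm_ball /ball_/= distrC => yr.
have -> : y - Phi (1 + 1) x - v0 =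
    (y - (Phi (1 + 1) x0 + v0)) + E (1 + 1) *m (x0 - x).
  have -> : E (1 + 1) *m (x0 - x) = Phi (1 + 1) x0 - Phi (1 + 1) x.
    by rewrite /flow opprD addrACA subrr add0r -mulmxBr opprB addrA subrK.
  by move: (Phi _ x0) (Phi _ x) => v1 v2; apply/matrixP => i j; rewrite !mxE; lra.
apply: le_lt_trans (ler_normD _ _) _; rewrite [ltRHS]splitr ltr_leD//.
apply: le_trans (norm_mulmx _ _) _; rewrite distrC.
apply: (@le_trans _ _ (L * rho)).
  by apply: ler_pM => //; rewrite ?mulr_ge0// /L lerDl.
rewrite mulrC -ler_pdivlMr// -mulrA -invfM.
by rewrite /rho ge_min lexx orbT.
Qed.

(** The discounted occupation measure [nu] started from [C] is maximal. If it charges [A], then at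
    some time [A] is reached with probability bounded below from a part of [C] of positive volume,
    which is itself reached from everywhere. Conversely, a set charged by any irreducibility measure
    is visited from all points of [C], hence charged by [nu]. *)
Lemma accessible_reachable e C : K° e -> measurable C -> (0 < leb C < +oo)%E ->
  (exists M : R, forall x, C x -> `|x| <= M) -> C `<=` K° ->
  (forall x, C x -> K° (x - z - e)) -> accessible K P X C.
Proof.
move=> Ke mC /andP[C0 Coo] [M CM] CK Ce; split=> //.
have CK' : C `<=` K by move=> x /CK; exact: interior_subset.
have [nu [nuoo nu1 nu2]] := discounted_occupation hK hker hric mC CK' Coo.
have [T T0 TP] := reach_lebesgue hK hpar hker hric h_flow h_tau m_finite h_density M Ke.
have nuC : (0 < nu C)%E.
  apply: nu2 => // y Cy; apply: occupation_gt0 => //; first exact: CK'.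
  exists T; first exact: ltW.
  move=> t Tt; apply: TP => //; [exact: CK|exact: CM|].
  by rewrite (_ : C `&` _ = C)//; apply/setIidPl => x; exact: Ce.
exists nu => //; split; first split.
- by exists (fun=> setT) => //; rewrite bigcup_const.
- rewrite gt_eqF//; apply: lt_le_trans nuC _; apply: le_measure; rewrite ?inE//.
- move=> A mA nuA x Kx; have [t t0 [s [s0 sP]]] := nu1 A mA nuA.
  set S := C `&` _ in sP.
  have mS : measurable S.
    apply: measurableI => //.
    rewrite -[X in measurable X]setTI (_ : [set y | _] = (transition t A) @^-1` `[s, +oo[%classic).
      by case: (bounded_measurable_transition hK p t mA) => mT _; exact: mT.
    by apply/seteqP; split=> y /=; rewrite in_itv/= andbT.
  have S0 : (0 < leb (S `&` [set y | K° (y - z - e)%R]))%E.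
    by rewrite (_ : S `&` _ = S)//; apply/setIidPl => y [/Ce].
  have [T1 T10 T1P] := reach_all hK hpar hker hric h_flow h_tau m_finite h_density h_start hX Kx Ke mS S0.
  rewrite (expected_occupation hK hker hX Kx mA); apply: occupation_gt0 => //.
  exists (T1 + t); first exact: addr_ge0.
  move=> u Tu; rewrite -(subrK t u).
  have Tut : T1 <= u - t by rewrite lerBrDr.
  apply: (transition_compose_gt0 hK hker hX Kx (le_trans T10 Tut) t0 mS mA (T1P _ Tut)).
  by move=> y [_ /= sy] _; exact: lt_le_trans sy.
- move=> nu' [_ _ irr]; apply/null_content_dominatesP => A mA nuA0.
  apply/eqP; rewrite eq_le measure_ge0 leNgt andbT; apply/negP => nuA'.
  suff : (0 < nu A)%E by rewrite nuA0 ltxx.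
  apply: nu2 => // y Cy; have := irr A mA nuA' y (CK' y Cy).
  by rewrite (expected_occupation hK hker hX (CK' y Cy) mA).
Qed.

(** The ball lies in z + e / 4 + K° and is bounded, so [reach_lebesgue] with the margin e / 4 brings
    the process back to it from each of its points at all large times. *)
Lemma aperiodic_ball : aperiodic K P X.
Proof.
have [e Ke] := cone_interior_neq0 hK.
have [C [sC C0 [M CM] CK Ce]] := small_ball Ke.
have Ke4 : K° (4%:R^-1 *: e) by apply: (interior_coneZ hK).
have mC : measurable C by case: sC.
exists C; split=> //.
  by apply: (accessible_reachable Ke4 mC C0 _ CK Ce); exists M.
have [T T0 TP] := reach_lebesgue hK hpar hker hric h_flow h_tau m_finite h_density M Ke4.
exists T; first exact: ltW.
move=> t x Tt Cx.
rewrite (process_law hK hker hX (interior_subset (CK x Cx)) (le_trans (ltW T0) Tt) mC) lte_fin.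
apply: TP => //; [exact: CK|exact: CM|].
rewrite (_ : C `&` _ = C); first by case/andP: C0.
by apply/setIidPl => y; exact: Ce.
Qed.

End irreducibility.

Theorem proposition4p5 (R : realType) (n : nat)
    (ip : {dot 'cV[R]_n for idfun}) (K : set 'cV[R]_n)
    (b : 'cV[R]_n) (B : 'M[R]_n) (m : {measure set 'cV[R]_n -> \bar R})
    (mu : set 'cV[R]_n -> 'cV[R]_n)
    (p : R -> R.-spker 'cV[R]_n ~> 'cV[R]_n)
    (d : measure_display) (Omega : measurableType d)
    (P : 'cV[R]_n -> probability Omega R)
    (X : R -> Omega -> one_point_compactification 'cV[R]_n)
    (hK : generating_proper_cone K)
    (hX : affine_process ip K b B m mu p P X)
    (m_finite : (m K < +oo)%E)
    (mu_finite : dual_cone ip K (mu K))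
    (mu_first_moment : exists2 v, dual_cone ip K v &
      is_vintegral ip K mu (K `&` [set xi | 1 <= ip_norm ip xi])
        (ip_norm ip) v)
    (h_density : has_positive_ac_component m K° \/
      exists2 eta, K° eta & has_positive_ac_component (scalarize ip mu eta) K°)
    (h_flow : forall t : R, 0 <= t ->
      [set expmx (t *: B) *m x | x in K°] = K°)
    (h_tau : tau B < 0)
    (h_start : ~ has_positive_ac_component m K° ->
      (0 < m K°)%E \/ K° b) :
  irreducible K P X (mrestr lebesgue_cV
    (measurable_translate (- (invmx B *m b)) (cone_closed hK))) /\
  aperiodic K P X.
Proof.
have [hpar [hproc [phi [psi [hker hric]]]]] := hX.
split.
  exact: (irreducible_lebesgue hK hpar hker hric h_flow h_tau m_finite h_density h_start hproc).
exact: (aperiodic_ball hK hpar hker hric h_flow h_tau m_finite h_density h_start hproc).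
Qed.
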